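(* Let $K$ be a finite extension of $\mathbb{Q}_p$ with ramification index $e$ and residue degree $f$. Let $g(x)\in x\mathcal{O}_K[\![x]\!]$ be a stable noninvertible power series with $\mathrm{hgt}(g)=ef$, and assume $\partial_0(\mathrm{Stab}_{\mathcal{O}_K}(g))=U_K$. Then $g$ is an endomorphism of a Lubin–Tate formal group defined over $\mathcal{O}_K$ provided one of the following holds: (1) $v_K(g'(0))=1$ ($e$ arbitrary); (2) $e=1$ (i.e. $K/\mathbb{Q}_p$ is unramified) and all the roots of all iterates $g^{\circ n}$ ($n\ge1$) of $g$ are simple.
   Context: $\mathcal{O}_K$ is the ring of integers of $K$, $\mathcal{M}_K$ its maximal ideal, $U_K$ its unit group, $v_K$ the normalized valuation, and $\mathbb{F}_q$ ($q=p^f$) the residue field. $\mathcal{D}_0(\mathcal{O}_K)=x\mathcal{O}_K[\![x]\!]$ is a monoid under composition $f\circ g$; $g^{\circ n}$ denotes the $n$-th iterate. A series $u\in\mathcal{D}_0(\mathcal{O}_K)$ is invertible if $u'(0)\in U_K$, noninvertible otherwise. $g$ is stable if $g'(0)$ is neither $0$ nor a root of unity. $\mathrm{Stab}_{\mathcal{O}_K}(g)$ is the group of invertible $u\in\mathcal{D}_0(\mathcal{O}_K)$ with $u\circ g=g\circ u$, and $\partial_0(u)=u'(0)$ (for stable $g$ this is an injective homomorphism $\mathrm{Stab}_{\mathcal{O}_K}(g)\to U_K$). The Weierstrass degree $\mathrm{wideg}(g)$ is the least $n$ such that the coefficient of $x^n$ in $g$ is a unit. The height of a stable noninvertible $g$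 is $\mathrm{hgt}(g)=e\cdot\log_p(\mathrm{wideg}(g))/v_K(g'(0))$. A Lubin–Tate formal group over $\mathcal{O}_K$ is a one-dimensional commutative formal group law $F$ over $\mathcal{O}_K$ having, for some uniformizer $\pi$ of $K$, an endomorphism $[\pi]_F(x)\equiv \pi x \pmod{\deg 2}$ and $[\pi]_F(x)\equiv x^q\pmod{\mathcal{M}_K}$. *)

(* Defs.v *)
From HB Require Import structures.
From mathcomp Require Import all_boot all_order all_algebra all_field.
Set Implicit Arguments. Unset Strict Implicit. Unset Printing Implicit Defensive.
Import Order.TTheory GRing.Theory Num.Theory.
Local Open Scope ring_scope.

(* w is a (rank one, additively written) valuation on the nonzero elements of F;
   the value w 0 is irrelevant and never used. *)
Definition is_valuation (F : fieldType) (R : numDomainType) (w : F -> R) : Prop :=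
  (forall x y : F, x != 0 -> y != 0 -> w (x * y) = w x + w y) /\
  (forall x y : F, x != 0 -> y != 0 -> x + y != 0 ->
      (w x <= w (x + y)) || (w y <= w (x + y))).

Definition inO (K : fieldType) (v : K -> int) (x : K) : bool := (x == 0) || (0 <= v x).
Definition inM (K : fieldType) (v : K -> int) (x : K) : bool := (x == 0) || (0 < v x).
Definition inU (K : fieldType) (v : K -> int) (x : K) : bool := (x != 0) && (v x == 0).

Definition vsmall (K : fieldType) (v : K -> int) (x : K) (N : nat) : bool :=
  (x == 0) || (N%:Z <= v x).

Definition v_complete (K : fieldType) (v : K -> int) : Prop :=
  forall a : nat -> K,
    (forall N : nat, exists M : nat, forall m n : nat,
        (M <= m)%N -> (M <= n)%N -> vsmall v (a m - a n) N) ->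
    exists l : K, forall N : nat, exists M : nat, forall m : nat,
        (M <= m)%N -> vsmall v (a m - l) N.

Definition residue_card (K : fieldType) (v : K -> int) (q : nat) : Prop :=
  exists r : seq K,
    [/\ size r = q, all (inO v) r,
        (forall i j : nat, (i < q)%N -> (j < q)%N -> inM v (r`_i - r`_j) -> i = j)
      & (forall x : K, inO v x -> exists2 i : nat, (i < q)%N & inM v (x - r`_i))].

(* (K, v) is a finite extension of Q_p with ramification index e and residue
   degree f, v being its normalized valuation: a complete discretely valued
   field of characteristic 0, with normalized valuation v, v(p) = e and residue
   field of cardinality p^f. *)
Definition padic_field (p e f : nat) (K : fieldType) (v : K -> int) : Prop :=
  [/\ prime p, is_valuation v, (exists pi : K, pi != 0 /\ v pi = 1),
      (forall n : nat, (n%:R : K) = 0 -> n = 0%N) &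
      [/\ v p%:R = e%:Z, v_complete v & residue_card v (p ^ f)%N]].

Definition psmul (K : fieldType) (a b : nat -> K) : nat -> K :=
  fun n => \sum_(i < n.+1) a i * b (n - i)%N.
Definition ps1 (K : fieldType) : nat -> K := fun n => (n == 0%N)%:R.
Definition psX (K : fieldType) : nat -> K := fun n => (n == 1%N)%:R.
Definition pspow (K : fieldType) (a : nat -> K) (k : nat) : nat -> K :=
  iter k (psmul a) (@ps1 K).
(* composition a o b, meaningful for b 0 = 0 *)
Definition pscomp (K : fieldType) (a b : nat -> K) : nat -> K :=
  fun n => \sum_(k < n.+1) a k * pspow b k n.
Definition psiter (K : fieldType) (g : nat -> K) (n : nat) : nat -> K :=
  iter n (pscomp g) (@psX K).
Definition psderiv (K : fieldType) (h : nat -> K) : nat -> K :=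
  fun n => h n.+1 *+ n.+1.

Definition inD0 (K : fieldType) (v : K -> int) (g : nat -> K) : Prop :=
  g 0%N = 0 /\ forall n, inO v (g n).

Definition stable (K : fieldType) (g : nat -> K) : Prop :=
  g 1%N != 0 /\ forall n : nat, (0 < n)%N -> g 1%N ^+ n != 1.

Definition is_wideg (K : fieldType) (v : K -> int) (g : nat -> K) (w : nat) : Prop :=
  inU v (g w) /\ forall m : nat, (m < w)%N -> ~~ inU v (g m).

(* hgt(g) = h, i.e. e * log_p(wideg g) / v_K(g'(0)) = h, written as
   wideg g = p^k and e * k = h * v_K(g'(0)). *)
Definition height_is (p e : nat) (K : fieldType) (v : K -> int) (g : nat -> K)
    (h : nat) : Prop :=
  exists w k : nat, [/\ is_wideg v g w, w = (p ^ k)%N & (e * k)%:Z = h%:Z * v (g 1%N)].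

Definition stab_deriv_full (K : fieldType) (v : K -> int) (g : nat -> K) : Prop :=
  forall a : K,
    (exists u : nat -> K,
        [/\ inD0 v u, inU v (u 1%N), pscomp u g = pscomp g u & u 1%N = a])
    <-> inU v a.

Definition ps_sums_to (K : fieldType) (L : fieldExtType K) (w : L -> rat)
    (h : nat -> K) (x y : L) : Prop :=
  forall N : nat, exists M : nat, forall m : nat, (M <= m)%N ->
    let s := \sum_(i < m) (h i)%:A * x ^+ i - y in (s == 0) || (N%:Q <= w s).

Definition iterates_simple_roots (K : fieldType) (v : K -> int) (g : nat -> K) : Prop :=
  forall n : nat, (0 < n)%N ->
  forall (L : fieldExtType K) (w : L -> rat),
    is_valuation w -> (forall a : K, a != 0 -> w a%:A = (v a)%:~R) ->
    forall x : L, (x == 0) || (0 < w x) ->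
      ps_sums_to w (psiter g n) x 0 -> ~ ps_sums_to w (psderiv (psiter g n)) x 0.

Definition ps2mul (K : fieldType) (A B : nat -> nat -> K) : nat -> nat -> K :=
  fun i j => \sum_(a < i.+1) \sum_(b < j.+1) A a b * B (i - a)%N (j - b)%N.
Definition ps2pow (K : fieldType) (A : nat -> nat -> K) (k : nat) : nat -> nat -> K :=
  iter k (ps2mul A) (fun i j => ((i == 0%N) && (j == 0%N))%:R).

(* F(F(X,Y),Z) = F(X,F(Y,Z)), coefficientwise at X^i Y^j Z^k *)
Definition fgl_assoc (K : fieldType) (F : nat -> nat -> K) : Prop :=
  forall i j k : nat,
    \sum_(a < (i + j).+1) F a k * ps2pow F a i j
    = \sum_(b < (j + k).+1) F i b * ps2pow F b j k.

Definition is_fgl (K : fieldType) (v : K -> int) (F : nat -> nat -> K) : Prop :=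
  [/\ forall i j, inO v (F i j),
      F 0%N 0%N = 0 /\ F 1%N 0%N = 1 /\ F 0%N 1%N = 1,
      forall i j, F i j = F j i & fgl_assoc F].

(* h in x O_K[[x]] is an endomorphism of F: h(F(X,Y)) = F(h(X),h(Y)) *)
Definition is_fgl_endo (K : fieldType) (v : K -> int) (F : nat -> nat -> K)
    (h : nat -> K) : Prop :=
  inD0 v h /\ forall i j : nat,
    \sum_(a < (i + j).+1) h a * ps2pow F a i j
    = \sum_(a < i.+1) \sum_(b < j.+1) F a b * pspow h a i * pspow h b j.

Definition lubin_tate (K : fieldType) (v : K -> int) (q : nat) (F : nat -> nat -> K) : Prop :=
  is_fgl v F /\
  exists pi : K, [/\ pi != 0, v pi = 1 &
    exists h : nat -> K, [/\ is_fgl_endo v F h, h 1%N = pi &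
       forall n : nat, inM v (h n - (n == q)%:R)]].

(* Main.v *)
(* Let L be the logarithm of g: L(g) = g'(0) L and L'(0) = 1. By uniqueness every u in the
   stabilizer satisfies L(u) = u'(0) L.

   The derivative g' is divisible by g'(0): otherwise g' has a root, which by commutation with a
   stabilizer of infinite order is fixed by some iterate u^N; then it is a multiple root of an
   iterate of g, which is excluded by hypothesis in case (2) and by an Eisenstein argument in
   case (1). Hence L' is integral, and L respects congruences modulo a uniformizer pi.

   Since the multipliers of the stabilizer fill the unit group, whose image in F_q^* detects the
   q-Frobenius, a series modulo pi that is an eigenvector of all the u is determined up to
   a series in x^q. Peeling off multiples of L successively shows that L(x^q) = w L modulo pi with
   v(w) = 1. This is the functional equation of Honda type which makes the group law
   F = L^-1(L(X) + L(Y)) integral, and makes [w] = L^-1(w L) congruent to x^q. Since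
   L(g) = g'(0) L, the series g is an endomorphism of F. *)
Require Import Defs.
From HB Require Import structures.
From mathcomp Require Import all_boot all_order all_algebra all_field.
From mathcomp Require Import boolp.
From mathcomp Require Import zify ring.
Set Implicit Arguments. Unset Strict Implicit. Unset Printing Implicit Defensive.
Import Order.TTheory GRing.Theory Num.Theory.
Local Open Scope ring_scope.

(** The obstacle is that [L] has denominators although [L'] has none, so y = z modulo the
    uniformizer does not formally give L(y) = L(z); the predicate [good] isolates this. When the
    uniformizer is p it follows from the integrality of [L'], because p^j / j is divisible by p.
    Under ramification pi^j / j need not even be integral; there L(g^k) = pi^k L is used instead:
    iterating [g] brings y and z so close that the denominators of [L] in a given degree are
    absorbed. The height fixes the Weierstrass degree: q if g'(0) is a uniformizer, q^n if e = 1 and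
    v(g'(0)) = n. In the first case it makes [g] congruent to G(x^q) with G invertible, so that
    series in x^q become series in [g]; in the second it keeps p L from descending too far through
    the powers x^(q^k). Roots are mostly replaced by divisibility in O[[x]] by an irreducible
    distinguished polynomial; finite extensions serve to count the roots of g' and to meet the
    hypothesis on simple roots. *)

Definition ps (R : Type) := nat -> R.
HB.instance Definition _ (R : Type) := gen_eqMixin (ps R).
HB.instance Definition _ (R : Type) := gen_choiceMixin (ps R).

Lemma psP (R : Type) (f g : ps R) : (forall n, f n = g n) -> f = g.
Proof. exact: funext. Qed.

(** Course-of-values recursion: the lists [F n] hold the first n values, and the element of [T] is
    only the default of [nth]. Inverses, logarithms and solutions of L(F) = Z are all built this
    way. *)
Lemma ps_rec (T : Type) (Phi : (nat -> T) -> nat -> T) :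
  (forall n f g, (forall i, (i < n)%N -> f i = g i) -> Phi f n = Phi g n) ->
  T -> exists f : nat -> T, forall n, f n = Phi f n.
Proof.
move=> HPhi x0.
pose F := fix F n := if n is m.+1 then rcons (F m) (Phi (nth x0 (F m)) m) else [::].
have sF n : size (F n) = n by elim: n => //= n IH; rewrite size_rcons IH.
have nF n k : (k < n)%N -> nth x0 (F n) k = nth x0 (F k.+1) k.
  elim: n => // n IH; rewrite ltnS leq_eqVlt => /orP[/eqP->//|kn].
  by rewrite [F n.+1]/= nth_rcons sF kn IH.
exists (fun n => nth x0 (F n.+1) n) => n; rewrite /= nth_rcons sF ltnn eqxx.
by apply: HPhi => i ilt; rewrite nF.
Qed.

(** * The ring of formal power series *)

Section PsRing.
Variable R : comNzRingType.
Implicit Types f g h : ps R.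

Definition ps_zero : ps R := fun=> 0.
Definition ps_opp f : ps R := fun n => - f n.
Definition ps_add f g : ps R := fun n => f n + g n.
Definition ps_one : ps R := fun n => (n == 0%N)%:R.
Definition ps_mul f g : ps R := fun n => \sum_(i < n.+1) f i * g (n - i)%N.

(** The ring laws, composition and the chain rule are transferred from polynomials: a given
    coefficient of either side depends only on sufficiently long truncations. *)
Definition tr N f : {poly R} := \poly_(i < N) f i.

Lemma coef_tr N f i : (tr N f)`_i = if (i < N)%N then f i else 0.
Proof. exact: coef_poly. Qed.

Lemma tr_mul N f g i : (i < N)%N -> (tr N f * tr N g)`_i = ps_mul f g i.
Proof.
move=> iN; rewrite coefM; apply: eq_bigr => -[j /= ji] _; rewrite !coef_tr.
by rewrite (leq_trans ji iN) (leq_ltn_trans (leq_subr _ _) iN).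
Qed.

Fact ps_addA : associative ps_add.
Proof. by move=> f g h; apply: psP => n; rewrite /ps_add addrA. Qed.
Fact ps_addC : commutative ps_add.
Proof. by move=> f g; apply: psP => n; rewrite /ps_add addrC. Qed.
Fact ps_add0 : left_id ps_zero ps_add.
Proof. by move=> f; apply: psP => n; rewrite /ps_add add0r. Qed.
Fact ps_addN : left_inverse ps_zero ps_opp ps_add.
Proof. by move=> f; apply: psP => n; rewrite /ps_add addNr. Qed.
HB.instance Definition _ := GRing.isZmodule.Build (ps R) ps_addA ps_addC ps_add0 ps_addN.

Fact ps_mulA : associative ps_mul.
Proof.
move=> f g h; apply: psP => n.
rewrite -(tr_mul _ _ (ltnSn n)) -(tr_mul _ _ (ltnSn n)).
transitivity ((tr n.+1 f * (tr n.+1 g * tr n.+1 h))`_n).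
  rewrite !(coefM (tr _ f)); apply: eq_bigr => j _; congr (_ * _).
  by rewrite tr_mul ?coef_tr ltnS leq_subr.
rewrite mulrA coefM [RHS]coefM; apply: eq_bigr => -[j /= jn] _; congr (_ * _).
by rewrite tr_mul ?coef_tr jn.
Qed.
Fact ps_mulC : commutative ps_mul.
Proof. by move=> f g; apply: psP => n; rewrite -!(tr_mul _ _ (ltnSn n)) mulrC. Qed.
Fact ps_mul1 : left_id ps_one ps_mul.
Proof.
move=> f; apply: psP => n; rewrite /ps_mul big_ord_recl subn0 mul1r big1 ?addr0 //.
by move=> i _; rewrite mul0r.
Qed.
Fact ps_mulD : left_distributive ps_mul ps_add.
Proof.
move=> f g h; apply: psP => n; rewrite /ps_mul /ps_add -big_split.
by apply: eq_bigr => i _; rewrite mulrDl.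
Qed.
Fact ps_1neq0 : ps_one != ps_zero.
Proof. by apply/eqP => /(congr1 (fun f => f 0%N)) /eqP; rewrite oner_eq0. Qed.
HB.instance Definition _ := GRing.Zmodule_isComNzRing.Build (ps R) ps_mulA ps_mulC ps_mul1 ps_mulD ps_1neq0.

Lemma ps0E n : (0 : ps R) n = 0. Proof. by []. Qed.
Lemma ps1E n : (1 : ps R) n = (n == 0%N)%:R. Proof. by []. Qed.
Lemma psDE f g n : (f + g) n = f n + g n. Proof. by []. Qed.
Lemma psNE f n : (- f) n = - f n. Proof. by []. Qed.
Lemma psBE f g n : (f - g) n = f n - g n. Proof. by []. Qed.
Lemma psME f g n : (f * g) n = \sum_(i < n.+1) f i * g (n - i)%N. Proof. by []. Qed.
Lemma psM0E f g : (f * g) 0%N = f 0%N * g 0%N.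
Proof. by rewrite psME big_ord1. Qed.
Lemma psM_tr f g N n : (n < N)%N -> (f * g) n = (tr N f * tr N g)`_n.
Proof. by move=> nN; rewrite tr_mul. Qed.
Lemma ps_sumE (I : Type) (r : seq I) (P : pred I) (F : I -> ps R) n :
  (\sum_(i <- r | P i) F i) n = \sum_(i <- r | P i) F i n.
Proof. by elim/big_rec2: _ => // i x y _ <-. Qed.

Definition psC (c : R) : ps R := fun n => if n == 0%N then c else 0.
Lemma psCM c f n : (psC c * f) n = c * f n.
Proof.
rewrite psME big_ord_recl subn0 big1 ?addr0 // => i _.
by rewrite /psC /= mul0r.
Qed.
Fact psC_monoid : monoid_morphism psC.
Proof.
split; first by apply: psP => n; rewrite /psC ps1E; case: eqP.
by move=> a b; apply: psP => n; rewrite psCM /psC; case: eqP; rewrite ?mulr0.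
Qed.
Fact psC_additive : nmod_morphism psC.
Proof.
split; first by apply: psP => n; rewrite /psC; case: eqP.
by move=> a b; apply: psP => n; rewrite psDE /psC; case: eqP; rewrite ?addr0.
Qed.
HB.instance Definition _ := GRing.isNmodMorphism.Build R (ps R) psC psC_additive.
HB.instance Definition _ := GRing.isMonoidMorphism.Build R (ps R) psC psC_monoid.

Definition px : ps R := fun n => (n == 1%N)%:R.
Lemma pxM f n : (px * f) n = if n is m.+1 then f m else 0.
Proof.
rewrite psME; case: n => [|n]; first by rewrite big_ord1 mul0r.
rewrite big_ord_recl mul0r add0r big_ord_recl mul1r subn1 big1 ?addr0 //= => i _.
by rewrite /px mul0r.
Qed.
Lemma pxXM k f n : (px ^+ k * f) n = if (k <= n)%N then f (n - k)%N else 0.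
Proof.
elim: k n => [|k IH] n; first by rewrite mul1r subn0.
by rewrite exprS -mulrA pxM; case: n => // n; rewrite IH.
Qed.
Lemma pxX k n : (px ^+ k) n = (n == k)%:R.
Proof.
rewrite -[px ^+ k]mulr1 pxXM ps1E subn_eq0.
case: ltngtP => // ; rewrite ?eqxx //.
Qed.

Definition eqps N f g := forall i, (i < N)%N -> f i = g i.
Lemma eqps_sym N f g : eqps N f g -> eqps N g f.
Proof. by move=> E i iN; rewrite E. Qed.
Lemma eqps_mul N f g f' g' : eqps N f f' -> eqps N g g' -> eqps N (f * g) (f' * g').
Proof.
move=> E F n nN; rewrite !psME; apply: eq_bigr => -[i /= iN] _.
by rewrite E ?F // ?(leq_trans iN) // (leq_ltn_trans _ nN) // leq_subr.
Qed.
Lemma eqps_exp N f g k : eqps N f g -> eqps N (f ^+ k) (g ^+ k).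
Proof. by move=> E; elim: k => // k IH; rewrite !exprS; apply: eqps_mul. Qed.
Definition ordps N f := forall i, (i < N)%N -> f i = 0.
Lemma ordpsM a b f g : ordps a f -> ordps b g -> ordps (a + b) (f * g).
Proof.
move=> fa gb n nab; rewrite psME big1 // => -[i /= iN] _.
case: (ltnP i a) => [ia|ai]; first by rewrite fa ?mul0r.
by rewrite gb ?mulr0 //; lia.
Qed.
Lemma ordpsX a f k : ordps a f -> ordps (k * a) (f ^+ k).
Proof.
move=> fa; elim: k => [|k IH]; first by [].
by rewrite exprS mulSn; apply: ordpsM.
Qed.
Lemma ordps1 f : f 0%N = 0 -> ordps 1 f.
Proof. by move=> f0 [|i]. Qed.
Lemma ordpsX0 f k n : f 0%N = 0 -> (n < k)%N -> (f ^+ k) n = 0.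
Proof. by move=> /ordps1 /(ordpsX (k := k)) F nk; apply: F; rewrite muln1. Qed.
Lemma ordpsXn f k : f 0%N = 0 -> (f ^+ k) k = f 1%N ^+ k.
Proof.
move=> f0; elim: k => // k IH; rewrite exprS psME big_ord_recl f0 mul0r add0r.
rewrite big_ord_recl /= subSS subn0 IH -exprS big1 ?addr0 // => i _.
rewrite [X in _ * X]ordpsX0 ?mulr0 //; have := ltn_ord i; rewrite /bump; lia.
Qed.

Lemma ps_unit f : f 0%N = 1 -> exists g, f * g = 1.
Proof.
move=> f0.
have [g Hg] : exists g : ps R, forall n, g n = (n == 0%N)%:R - \sum_(i < n) f i.+1 * g (n - i.+1)%N.
  apply: (@ps_rec R (fun g n => (n == 0%N)%:R - \sum_(i < n) f i.+1 * g (n - i.+1)%N) _ 0).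
  move=> n g g' E; congr (_ - _); apply: eq_bigr => -[i /= iN] _; rewrite E //; lia.
exists g; apply: psP => n; rewrite psME big_ord_recl subn0 f0 mul1r Hg ps1E.
by rewrite subrK.
Qed.

End PsRing.
Arguments px {R}.
Arguments psC {R}.

(** * Composition and derivation of power series *)

Section Comp.
Variables (K R : comNzRingType) (iota : {rmorphism K -> R}).
Implicit Types (f g : ps K) (h : ps R) (p : {poly K}).

(* [f(h)] with the coefficients of [f] mapped by [iota]; meaningful only if [h 0 = 0]. *)
Definition psco f h : ps R := fun n => \sum_(k < n.+1) iota (f k) * (h ^+ k) n.
(** Evaluation of a polynomial at [h] is a ring morphism by construction; multiplicativity and
    associativity of [psco] follow by comparing it with [ev] on truncations. *)
Definition ev h p : ps R := (map_poly (psC \o iota) p).[h].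

Lemma evE h p n N : (size p <= N)%N -> ev h p n = \sum_(k < N) iota p`_k * (h ^+ k) n.
Proof.
move=> sN; rewrite /ev (@horner_coef_wide _ N) ?size_map_poly //; last first.
  by rewrite (leq_trans _ sN) // size_poly.
by rewrite ps_sumE; apply: eq_bigr => i _; rewrite coef_map /= psCM.
Qed.

Lemma psco_wide f h n N : h 0%N = 0 -> (n < N)%N ->
  psco f h n = \sum_(k < N) iota (f k) * (h ^+ k) n.
Proof.
move=> h0 nN; rewrite /psco -!(big_mkord xpredT (fun k => iota (f k) * (h ^+ k) n)).
rewrite [RHS](big_cat_nat (n := n.+1)) //= [X in _ = _ + X]big_nat_cond.
by rewrite [X in _ = _ + X]big1 ?addr0 // => k /andP[/andP[nk _] _]; rewrite ordpsX0 ?mulr0.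
Qed.

Lemma psco_ev f h n p : h 0%N = 0 -> (forall i, (i <= n)%N -> p`_i = f i) ->
  psco f h n = ev h p n.
Proof.
move=> h0 pf; set N := maxn n.+1 (size p).
rewrite (@evE h p n N) ?leq_maxr // (@psco_wide f h n N) ?leq_maxl //.
apply: eq_bigr => -[i iN] _ /=; case: (leqP i n) => [/pf->//|ni].
by rewrite ordpsX0 ?mulr0.
Qed.

Lemma psco0E f h : psco f h 0%N = iota (f 0%N).
Proof. by rewrite /psco big_ord1 expr0 mulr1. Qed.
Lemma psco1E f h : h 0%N = 0 -> psco f h 1%N = iota (f 1%N) * h 1%N.
Proof.
move=> h0; rewrite /psco big_ord_recl big_ord1 /= expr0 expr1 ps1E /= mulr0 add0r.
by [].
Qed.

Lemma pscoD f g h : psco (f + g) h = psco f h + psco g h.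
Proof.
by apply: psP => n; rewrite psDE /psco -big_split; apply: eq_bigr => i _; rewrite psDE rmorphD mulrDl.
Qed.
Lemma pscoN f h : psco (- f) h = - psco f h.
Proof.
by apply: psP => n; rewrite psNE /psco -sumrN; apply: eq_bigr => i _; rewrite psNE rmorphN mulNr.
Qed.
Lemma pscoB f g h : psco (f - g) h = psco f h - psco g h.
Proof. by rewrite pscoD pscoN. Qed.
Lemma psco_psC c h : psco (psC c) h = psC (iota c).
Proof.
apply: psP => n; rewrite /psco big_ord_recl big1 ?addr0.
  by rewrite expr0 ps1E /psC /=; case: eqP; rewrite ?mulr1 ?mulr0.
by move=> i _; rewrite /psC /= rmorph0 mul0r.
Qed.
Lemma psco1 h : psco 1 h = 1.
Proof. by have := psco_psC 1 h; rewrite !rmorph1. Qed.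
Lemma pscoM f g h : h 0%N = 0 -> psco (f * g) h = psco f h * psco g h.
Proof.
move=> h0; apply: psP => n.
rewrite (@psco_ev _ _ _ (tr n.+1 f * tr n.+1 g)) //; last first.
  by move=> i ni; rewrite tr_mul.
rewrite /ev rmorphM hornerM !psME; apply: eq_bigr => -[i /= ni] _.
by congr (_ * _); apply/esym/psco_ev => // j ji; rewrite coef_tr ifT //; lia.
Qed.
Lemma pscoX f h k : h 0%N = 0 -> psco (f ^+ k) h = psco f h ^+ k.
Proof. by move=> h0; elim: k => [|k IH]; rewrite ?psco1 // !exprS pscoM ?IH. Qed.
Lemma psco_px h : h 0%N = 0 -> psco px h = h.
Proof.
move=> h0; apply: psP => n; rewrite (@psco_ev _ _ _ 'X) //.
  by rewrite /ev map_polyX hornerX.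
by move=> i _; rewrite coefX.
Qed.
Lemma pscoZ c f h : h 0%N = 0 -> psco (psC c * f) h = psC (iota c) * psco f h.
Proof. by move=> h0; rewrite pscoM // psco_psC. Qed.

Lemma psco_eqps N f h h' : eqps N h h' -> eqps N (psco f h) (psco f h').
Proof.
move=> E n nN; apply: eq_bigr => k _; congr (_ * _); exact: (eqps_exp k E).
Qed.
Definition ps_map f : ps R := fun n => iota (f n).
Lemma psco_pxr f : psco f px = ps_map f.
Proof.
apply: psP => n; rewrite /psco big_ord_recr /= big1 ?add0r ?pxX ?eqxx ?mulr1 //.
by move=> [i iN] _ /=; rewrite pxX gtn_eqF ?mulr0.
Qed.
Lemma ps_mapM f g : ps_map (f * g) = ps_map f * ps_map g.
Proof.
by apply: psP => n; rewrite /ps_map !psME rmorph_sum; apply: eq_bigr => i _; rewrite rmorphM.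
Qed.
Lemma ps_mapX f k : ps_map (f ^+ k) = ps_map f ^+ k.
Proof.
elim: k => [|k IH]; last by rewrite !exprS ps_mapM IH.
by apply: psP => n; rewrite /ps_map !expr0 !ps1E rmorph_nat.
Qed.
End Comp.

Section CompA.
Variables (K R : comNzRingType) (iota : {rmorphism K -> R}).
Notation compK := (psco idfun).
Lemma evA (p q : {poly K}) (h : ps R) : ev iota h (p \Po q) = ev iota (ev iota h q) p.
Proof.
by rewrite /ev map_comp_poly horner_comp.
Qed.
Lemma pscoA (f g : ps K) (h : ps R) : g 0%N = 0 -> h 0%N = 0 ->
  psco iota f (psco iota g h) = psco iota (compK f g) h.
Proof.
move=> g0 h0; apply: psP => n.
have gh0 : psco iota g h 0%N = 0 by rewrite psco0E g0 rmorph0.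
pose p := tr n.+1 f; pose q := tr n.+1 g.
have Ep i : (i <= n)%N -> p`_i = f i by move=> ni; rewrite coef_tr ltnS ni.
have Eq i : (i <= n)%N -> q`_i = g i by move=> ni; rewrite coef_tr ltnS ni.
have E1 : eqps n.+1 (psco iota g h) (ev iota h q).
  by move=> i ni; apply: psco_ev => // j ji; apply: Eq; lia.
rewrite (psco_eqps iota f E1 (ltnSn n)) (@psco_ev _ _ _ _ _ _ p) //; last first.
  by rewrite -E1.
rewrite -evA; apply/esym/psco_ev => // i ni.
rewrite (@psco_ev _ _ _ _ _ _ p) //; last by move=> j ji; apply: Ep; lia.
rewrite (@evE _ _ _ _ _ _ (size p)) // coef_comp_poly; apply: eq_bigr => -[k kp] _ /=.
congr (_ * _).
have E2 (r : {poly K}) (s : ps K) : (forall j, (j <= n)%N -> r`_j = s j) ->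
   forall m, forall j, (j <= n)%N -> (r ^+ m)`_j = (s ^+ m) j.
  move=> E; elim=> [|m IH] j jn; first by rewrite !expr0 coef1 ps1E.
  rewrite !exprS coefM psME; apply: eq_bigr => -[l /= lj] _.
  by rewrite E ?IH //; lia.
exact: E2.
Qed.
End CompA.

Section Deriv.
Variable K : comNzRingType.
Notation compK := (psco (idfun : {rmorphism K -> K})).
Definition psd (f : ps K) : ps K := fun n => f n.+1 *+ n.+1.
Lemma psdM (f g : ps K) : psd (f * g) = psd f * g + f * psd g.
Proof.
apply: psP => n; rewrite /psd (psM_tr f g (ltnSn n.+1)) -coef_deriv derivM coefD.
have E (h : ps K) i : (i <= n.+1)%N -> (tr n.+2 h)`_i = h i by move=> ?; rewrite coef_tr ltnS ifT.
rewrite !coefM psDE !psME; congr (_ + _); apply: eq_bigr => -[i ni] _ /=.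
  by rewrite coef_deriv !E //; lia.
by rewrite coef_deriv !E //; lia.
Qed.
Lemma psd_comp (f g : ps K) : g 0%N = 0 -> psd (compK f g) = compK (psd f) g * psd g.
Proof.
move=> g0; apply: psP => n.
have E (h : ps K) i : (i <= n.+1)%N -> (tr n.+2 h)`_i = h i by move=> ?; rewrite coef_tr ltnS ifT.
pose p := tr n.+2 f; pose q := tr n.+2 g.
have Epow m j : (j <= n.+1)%N -> (q ^+ m)`_j = (g ^+ m) j.
  elim: m j => [|m IH] j jn; first by rewrite !expr0 coef1 ps1E.
  rewrite !exprS coefM psME; apply: eq_bigr => -[l /= lj] _.
  by rewrite E ?IH //; lia.
have Ecomp (r : {poly K}) (s : ps K) m : (m <= n.+1)%N ->
    (forall j, (j <= m)%N -> r`_j = s j) -> (r \Po q)`_m = compK s g m.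
  move=> mn Ers; rewrite (@psco_ev _ _ _ _ _ _ r) // (@evE _ _ _ _ _ _ (size r)) // coef_comp_poly.
  by apply: eq_bigr => -[k kp] _ /=; rewrite Epow.
rewrite /psd -(Ecomp p) //; last by move=> j jn; rewrite E.
rewrite -coef_deriv deriv_comp coefM psME; apply: eq_bigr => -[i ni] _ /=.
congr (_ * _); last by rewrite coef_deriv E //; lia.
apply: Ecomp; first lia.
by move=> j ji; rewrite coef_deriv /psd E //; lia.
Qed.
Lemma psdD (f g : ps K) : psd (f + g) = psd f + psd g.
Proof. by apply: psP => n; rewrite /psd !psDE mulrnDl. Qed.
Lemma psdZ c (f : ps K) : psd (psC c * f) = psC c * psd f.
Proof. by apply: psP => n; rewrite /psd !psCM mulrnAr. Qed.
Lemma psd_px : psd px = 1.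
Proof. by apply: psP => -[|n]; rewrite /psd /px ps1E //= mul0rn. Qed.
End Deriv.

(** * Congruences modulo an ideal of a subring *)

Definition is_sub (R : comNzRingType) (S : R -> Prop) : Prop :=
  [/\ S 1, forall x y, S x -> S y -> S (x - y) & forall x y, S x -> S y -> S (x * y)].
Definition is_idl (R : comNzRingType) (S I : R -> Prop) : Prop :=
  [/\ I 0, forall x y, I x -> I y -> I (x - y), forall x, I x -> S x
    & forall s x, S s -> I x -> I (s * x)].
Definition pall (R : Type) (S : R -> Prop) (f : ps R) : Prop := forall n, S (f n).
(** Only the difference is constrained, so both sides may lie outside the subring; congruences
    between multiples of the logarithm are of this kind. *)
Definition cg (R : comNzRingType) (I : R -> Prop) (x y : R) : Prop := I (x - y).

Section Congruences.
Variable R : comNzRingType.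
Variable S : R -> Prop.
Hypothesis hS : is_sub S.

Lemma sub1 : S 1. Proof. by case: hS. Qed.
Lemma subB x y : S x -> S y -> S (x - y). Proof. by case: hS => _ + _; apply. Qed.
Lemma subM x y : S x -> S y -> S (x * y). Proof. by case: hS => _ _; apply. Qed.
Lemma sub0 : S 0. Proof. by rewrite -(subrr 1); apply: subB; apply: sub1. Qed.
Lemma subN x : S x -> S (- x). Proof. by rewrite -sub0r; apply/subB/sub0. Qed.
Lemma subD x y : S x -> S y -> S (x + y).
Proof. by move=> Sx Sy; rewrite -[y]opprK; apply/subB/subN. Qed.
Lemma subX x n : S x -> S (x ^+ n).
Proof. by move=> Sx; elim: n => [|n IH]; rewrite ?exprS; [apply: sub1|apply: subM]. Qed.
Lemma sub_sum (J : Type) (r : seq J) (P : pred J) (F : J -> R) :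
  (forall i, P i -> S (F i)) -> S (\sum_(i <- r | P i) F i).
Proof. by move=> SF; elim/big_ind: _ => //; [apply: sub0|apply: subD]. Qed.
Lemma sub_nat n : S n%:R.
Proof. by elim: n => [|n IH]; [apply: sub0|rewrite -natr1; apply/subD/sub1]. Qed.

Lemma pall0 : pall S 0. Proof. by move=> n; apply: sub0. Qed.
Lemma pall1 : pall S 1. Proof. by move=> n; rewrite ps1E; apply: sub_nat. Qed.
Lemma pall_px : pall S px. Proof. by move=> n; rewrite /px; apply: sub_nat. Qed.
Lemma pallC c : S c -> pall S (psC c).
Proof. by move=> Sc n; rewrite /psC; case: eqP => // _; apply: sub0. Qed.
Lemma pallB f g : pall S f -> pall S g -> pall S (f - g).
Proof. by move=> Sf Sg n; apply: subB. Qed.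
Lemma pallD f g : pall S f -> pall S g -> pall S (f + g).
Proof. by move=> Sf Sg n; apply: subD. Qed.
Lemma pallN f : pall S f -> pall S (- f).
Proof. by move=> Sf n; apply: subN. Qed.
Lemma pallM f g : pall S f -> pall S g -> pall S (f * g).
Proof. by move=> Sf Sg n; apply: sub_sum => i _; apply: subM. Qed.
Lemma pallX f n : pall S f -> pall S (f ^+ n).
Proof. by move=> Sf; elim: n => [|n IH]; rewrite ?exprS; [apply: pall1|apply: pallM]. Qed.
Lemma pall_is_sub : is_sub (pall S).
Proof. by split; [apply: pall1|apply: pallB|apply: pallM]. Qed.
Lemma pall_psd f : pall S f -> pall S (psd f).
Proof. by move=> Sf n; rewrite /psd -mulr_natr; apply/subM/sub_nat. Qed.
Lemma pall_unit f g : pall S f -> f 0%N = 1 -> f * g = 1 -> pall S g.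
Proof.
move=> Sf f0 fg n; elim/ltn_ind: n => n IH.
have := congr1 (fun h => h n) fg; rewrite psME big_ord_recl subn0 f0 mul1r.
move/(canRL (addrK _)) => ->; apply: subB; first exact: pall1.
by apply: sub_sum => -[i iN] _; apply: subM => //; apply: IH; rewrite /= /bump; lia.
Qed.

Variable I : R -> Prop.
Hypothesis hI : is_idl S I.
Lemma idl0 : I 0. Proof. by case: hI. Qed.
Lemma idlB x y : I x -> I y -> I (x - y). Proof. by case: hI => _ + _ _; apply. Qed.
Lemma idlW x : I x -> S x. Proof. by case: hI => _ _ + _; apply. Qed.
Lemma idlM s x : S s -> I x -> I (s * x). Proof. by case: hI => _ _ _; apply. Qed.
Lemma idlMr s x : S s -> I x -> I (x * s). Proof. by rewrite mulrC; apply: idlM. Qed.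
Lemma idlN x : I x -> I (- x). Proof. by rewrite -sub0r; apply/idlB/idl0. Qed.
Lemma idlD x y : I x -> I y -> I (x + y).
Proof. by move=> Sx Sy; rewrite -[y]opprK; apply/idlB/idlN. Qed.
Lemma idl_sum (J : Type) (r : seq J) (P : pred J) (F : J -> R) :
  (forall i, P i -> I (F i)) -> I (\sum_(i <- r | P i) F i).
Proof. by move=> SF; elim/big_ind: _ => //; [apply: idl0|apply: idlD]. Qed.
Lemma pall_is_idl : is_idl (pall S) (pall I).
Proof.
split; first by move=> n; apply: idl0.
- by move=> x y Ix Iy n; apply: idlB.
- by move=> x Ix n; apply: idlW.
by move=> s x Ss Ix n; apply: idl_sum => i _; apply: idlM.
Qed.

Notation cg := (cg I).
Lemma cg_refl x : cg x x. Proof. by rewrite /cg subrr; apply: idl0. Qed.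
Lemma cg_sym x y : cg x y -> cg y x. Proof. by rewrite /cg -(opprB x); apply: idlN. Qed.
Lemma cg_trans y x z : cg x y -> cg y z -> cg x z.
Proof. by move=> C D; have := idlD C D; rewrite addrA subrK. Qed.
Lemma cgD x y x' y' : cg x x' -> cg y y' -> cg (x + y) (x' + y').
Proof. by move=> C D; have := idlD C D; rewrite /cg opprD addrACA. Qed.
Lemma cgN x x' : cg x x' -> cg (- x) (- x').
Proof. by move=> /idlN; rewrite /cg opprB opprK addrC. Qed.
Lemma cgB x y x' y' : cg x x' -> cg y y' -> cg (x - y) (x' - y').
Proof. by move=> C D; apply/cgD/cgN. Qed.
Lemma cgM x y x' y' : S y -> S x' -> cg x x' -> cg y y' -> cg (x * y) (x' * y').
Proof.
move=> Sy Sx' /(idlMr Sy) C /(idlM Sx') D.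
rewrite /cg; have -> : x * y - x' * y' = (x - x') * y + x' * (y - y') by ring.
exact: idlD.
Qed.
Lemma cg_sum (J : Type) (r : seq J) (P : pred J) (F G : J -> R) :
  (forall i, P i -> cg (F i) (G i)) -> cg (\sum_(i <- r | P i) F i) (\sum_(i <- r | P i) G i).
Proof. by move=> C; rewrite /cg -sumrB; apply: idl_sum. Qed.
Lemma cg_sub x y : cg x y -> S y -> S x.
Proof. by move=> /idlW Sx Sy; rewrite -(subrK y x); apply: subD. Qed.
Lemma cgX x y n : S x -> S y -> cg x y -> cg (x ^+ n) (y ^+ n).
Proof.
move=> Sx Sy C; elim: n => [|n IH]; first exact: cg_refl.
by rewrite !exprS; apply: cgM => //; apply: subX.
Qed.
End Congruences.

Section CongruenceComp.
Variables (K R : comNzRingType) (iota : {rmorphism K -> R}).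
Variables (SK : K -> Prop) (S : R -> Prop).
Hypotheses (hSK : is_sub SK) (hS : is_sub S) (SKS : forall a, SK a -> S (iota a)).
Lemma pall_comp f h : pall SK f -> pall S h -> pall S (psco iota f h).
Proof.
move=> Sf Sh n; apply: (sub_sum hS) => k _; apply: (subM hS); first exact: SKS.
exact: (pallX hS).
Qed.
Variable I : R -> Prop.
Hypothesis hI : is_idl S I.
Notation "x =~ y" := (cg (pall I) x y) (at level 70).
Lemma cg_comp f h h' : pall SK f -> pall S h -> pall S h' -> h =~ h' ->
  psco iota f h =~ psco iota f h'.
Proof.
move=> Sf Sh Sh' C n; apply: (cg_sum hI) => k _.
change (cg I (iota (f k) * (h ^+ k) n) (iota (f k) * (h' ^+ k) n)).
apply: (cgM hI); [exact: pallX|exact: SKS|exact: (cg_refl hI)|].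
exact: (cgX (pall_is_sub hS) (pall_is_idl hI) _ Sh Sh' C).
Qed.
Variable IK : K -> Prop.
Hypothesis IKI : forall a, IK a -> I (iota a).
Lemma cg_compl f f' h : pall S h -> cg (pall IK) f f' ->
  psco iota f h =~ psco iota f' h.
Proof.
move=> Sh C; rewrite /cg -pscoB => n; apply: (idl_sum hI) => k _.
by apply: (idlMr hI); [exact: pallX|apply: IKI; apply: C].
Qed.
End CongruenceComp.

Section CongruenceCompId.
Variables (K : comNzRingType) (S I : K -> Prop).
Hypotheses (hS : is_sub S) (hI : is_idl S I).
Lemma pall_co f h : pall S f -> pall S h -> pall S (psco idfun f h).
Proof. exact: (pall_comp hS). Qed.
Lemma cg_cor f h h' : pall S f -> pall S h -> pall S h' ->
  cg (pall I) h h' -> cg (pall I) (psco idfun f h) (psco idfun f h').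
Proof. by move=> Sf Sh Sh' C; apply: (cg_comp hS (SK := S)). Qed.
Lemma cg_col f f' h : pall S h ->
  cg (pall I) f f' -> cg (pall I) (psco idfun f h) (psco idfun f' h).
Proof. by move=> Sh C; apply: (cg_compl hS hI (IK := I)). Qed.
End CongruenceCompId.

(** * Low-order coefficients, substitution of x^P, Taylor expansion *)

Section PowLow.
Variable R : comNzRingType.
Implicit Types f g h : ps R.
Lemma mul_low n f g f' g' : f 0%N = 0 -> g 0%N = 0 -> f' 0%N = 0 -> g' 0%N = 0 ->
  eqps n f f' -> eqps n g g' -> (f * g) n = (f' * g') n.
Proof.
move=> f0 g0 f'0 g'0 Ef Eg; rewrite !psME; apply: eq_bigr => -[i /= iN] _.
case: i iN => [|i] iN; first by rewrite f0 f'0 !mul0r.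
case: (ltnP i.+1 n) => [lt|]; last first.
  by move=> ge; have -> : (n - i.+1)%N = 0%N by [lia]; rewrite g0 g'0 !mulr0.
by rewrite Ef ?Eg //; lia.
Qed.
(** A power of exponent at least 2 of a series without constant term sees, in degree n, only
    coefficients below n. This makes composition with x + ... triangular, which drives every
    coefficientwise induction below. *)
Lemma pow_low n h h' k : h 0%N = 0 -> h' 0%N = 0 -> eqps n h h' ->
  (h ^+ k.+2) n = (h' ^+ k.+2) n.
Proof.
move=> h0 h'0 E; rewrite !(exprS _ k.+1); apply: mul_low => //.
- by rewrite ordpsX0.
- by rewrite ordpsX0.
exact: eqps_exp.
Qed.
Definition low n f : ps R := fun i => if (i < n)%N then f i else 0.
Lemma low_eqps n f : eqps n (low n f) f.
Proof. by move=> i lt; rewrite /low lt. Qed.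
(* [f(x^P)] *)
Definition psexp (P : nat) f : ps R := fun n => if (P %| n)%N then f (n %/ P)%N else 0.
(** Frobenius twist of the coefficients: for P = p^i, the power f^P is congruent to the twist of f
    taken at x^P. *)
Definition fr (P : nat) f : ps R := fun n => f n ^+ P.
Lemma psexpX P f n : (0 < P)%N -> psexp P f (P * n)%N = f n.
Proof. by move=> P0; rewrite /psexp dvdn_mulr // mulKn. Qed.
Lemma psexp1 f : psexp 1 f = f.
Proof. by apply: psP => n; rewrite /psexp dvd1n divn1. Qed.
Lemma psexp_psexp P Q f : (0 < P)%N -> (0 < Q)%N -> psexp P (psexp Q f) = psexp (P * Q) f.
Proof.
move=> P0 Q0; apply: psP => n; rewrite /psexp.
case: (boolP (P %| n)%N) => [/dvdnP[m ->]|Pn].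
  by rewrite mulnK // (mulnC m) dvdn_pmul2l // divnMA mulKn.
rewrite ifN //; apply: contra Pn; exact: dvdn_trans (dvdn_mulr _ (dvdnn _)).
Qed.
Lemma psexp_psco P f : (0 < P)%N -> psexp P f = psco idfun f (px ^+ P).
Proof.
move=> P0; apply: psP => n; rewrite /psco /psexp.
under eq_bigr => i _ do rewrite -exprM pxX.
case: (boolP (P %| n)%N) => [/dvdnP[m ->]|Pn].
  rewrite mulnK // (bigD1 (inord m)) //= big1 ?addr0.
    by rewrite inordK ?ltnS ?leq_pmulr // mulnC eqxx mulr1.
  move=> i im; case: eqP => [E|_]; last by rewrite mulr0.
  case/eqP: im; apply: val_inj; rewrite /= inordK ?ltnS ?leq_pmulr //.
  by move: E; rewrite [RHS]mulnC => /eqP; rewrite eqn_pmul2r // => /eqP.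
rewrite big1 // => i _; case: eqP => [E|_]; last by rewrite mulr0.
by rewrite E dvdn_mulr in Pn.
Qed.
Lemma psexpB P f g : psexp P (f - g) = psexp P f - psexp P g.
Proof. by apply: psP => n; rewrite psBE /psexp; case: ifP; rewrite ?subr0. Qed.
Lemma psexpM P f g : (0 < P)%N -> psexp P (f * g) = psexp P f * psexp P g.
Proof.
move=> P0; have x0 : (px ^+ P : ps R) 0%N = 0 by rewrite pxX; case: P P0.
by rewrite !psexp_psco // pscoM.
Qed.
Lemma psexpZ P c f : psexp P (psC c * f) = psC c * psexp P f.
Proof. by apply: psP => n; rewrite psCM /psexp; case: ifP; rewrite ?psCM ?mulr0. Qed.
Lemma psexp_pall (S : R -> Prop) P f : S 0 -> pall S f -> pall S (psexp P f).
Proof. by move=> S0 Sf n; rewrite /psexp; case: ifP. Qed.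
Lemma psexp_pallK (S : R -> Prop) P f : (0 < P)%N -> pall S (psexp P f) -> pall S f.
Proof. by move=> P0 Sf n; have := Sf (P * n)%N; rewrite psexpX. Qed.
Lemma fr_fr P Q f : fr P (fr Q f) = fr (P * Q) f.
Proof. by apply: psP => n; rewrite /fr -exprM mulnC. Qed.
Lemma fr1 f : fr 1 f = f. Proof. by []. Qed.
Lemma fr_psexp P Q f : (0 < P)%N -> fr P (psexp Q f) = psexp Q (fr P f).
Proof. by move=> P0; apply: psP => n; rewrite /fr /psexp; case: ifP; rewrite ?expr0n ?gtn_eqF. Qed.
End PowLow.

Section PowLowComp.
Variables (K R : comNzRingType) (iota : {rmorphism K -> R}).
Lemma psco_eqsum N M (f : ps K) (h : ps R) : h 0%N = 0 -> (N <= M)%N ->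
  eqps N (psco iota f h) (\sum_(k < M) psC (iota (f k)) * h ^+ k).
Proof.
move=> h0 NM n nN; rewrite (psco_wide iota f h0 (leq_trans nN NM)) ps_sumE.
by apply: eq_bigr => i _; rewrite psCM.
Qed.
Lemma psco_psexp P (f : ps K) (h : ps R) : (0 < P)%N -> h 0%N = 0 ->
  psco iota (psexp P f) h = psco iota f (h ^+ P).
Proof.
move=> P0 h0; have x0 : (px ^+ P : ps K) 0%N = 0 by rewrite pxX; case: P P0.
by rewrite psexp_psco // -pscoA // pscoX // psco_px.
Qed.
Lemma psexpXn P (h : ps R) k : (0 < P)%N -> psexp P (h ^+ k) = psexp P h ^+ k.
Proof.
move=> P0; elim: k => [|k IH]; last by rewrite !exprS psexpM // IH.
apply: psP => n; rewrite /psexp !expr0 !ps1E; case: n => [|n]; first by rewrite dvdn0 div0n.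
case: ifP => // Pn; case: eqP => // E.
by have := dvdn_leq (ltn0Sn n) Pn; rewrite -divn_gt0 // E.
Qed.
Lemma psexp_pscoE P (f : ps K) (h : ps R) : (0 < P)%N -> h 0%N = 0 ->
  psexp P (psco iota f h) = psco iota f (psexp P h).
Proof.
move=> P0 h0; apply: psP => n; rewrite {2}/psco.
under eq_bigr => i _ do rewrite -psexpXn //.
rewrite /psexp; case: ifP => _; last by rewrite big1 // => i _; rewrite mulr0.
by apply: psco_wide => //; rewrite ltnS leq_div.
Qed.

(** The quotient of (y + z)^k - y^k - k y^(k-1) z by z^2, produced by recursion on k so that no
    division occurs. *)
Fixpoint taylor_rem (y z : ps R) k : ps R :=
  if k is k'.+1 then y ^+ k'.-1 *+ k' + (y + z) * taylor_rem y z k' else 0.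
Lemma taylor_remP (y z : ps R) k :
  (y + z) ^+ k = y ^+ k + (y ^+ k.-1 *+ k) * z + z ^+ 2 * taylor_rem y z k.
Proof.
elim: k => [|k IH]; first by rewrite !expr0 mulr0n mul0r mulr0 !addr0.
case: k IH => [|k] IH; first by rewrite /= !expr1 expr0 !mulr0n mulr1n !mulr0 !addr0 mul1r mulr0 addr0.
rewrite exprS IH /= [y ^+ k.+2]exprS [y ^+ k.+1]exprS.
rewrite -[y ^+ k *+ k.+1]mulr_natr -[(y * y ^+ k) *+ k.+2]mulr_natr -[k.+2]addn1 natrD.
ring.
Qed.
Lemma taylor_rem_ord (y z : ps R) k : y 0%N = 0 -> z 0%N = 0 -> ordps (k - 2) (taylor_rem y z k).
Proof.
move=> y0 z0; elim: k => [|[|k] IH] //=.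
move=> i ik; rewrite psDE.
have -> : ((y + z) * taylor_rem y z k.+1) i = 0.
  have yz1 : ordps 1 (y + z) by apply: ordps1; rewrite psDE y0 z0 addr0.
  by apply: (ordpsM yz1 IH); lia.
have E m (h : ps R) : (h *+ m) i = h i *+ m.
  by elim: m => [|m IHm]; rewrite ?mulr0n // !mulrS psDE IHm.
by rewrite E ordpsX0 ?mul0rn ?addr0 //; lia.
Qed.
(** The cofactor w does not depend on the subring, so its integrality is quantified over all
    subrings inside the existential. *)
Lemma taylor (f : ps K) (y z : ps R) : y 0%N = 0 -> z 0%N = 0 ->
  exists w : ps R,
  psco iota f (y + z) = psco iota f y + z * (psco iota (psd f) y + z * w) /\
  forall (SK : K -> Prop) (S : R -> Prop), is_sub S -> (forall a, SK a -> S (iota a)) ->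
    pall SK f -> pall S y -> pall S z -> pall S w.
Proof.
(* The k-th remainder has order at least k - 2, so in degree n the terms with k >= n + 3 vanish. *)
move=> y0 z0; pose w : ps R := fun n => \sum_(k < n.+3) iota (f k) * taylor_rem y z k n.
exists w; split; last first.
  move=> SK S hS hSS Sf Sy Sz n; apply: (sub_sum hS) => -[k kn] _ /=.
  apply: (subM hS); first exact: hSS.
  move: n {kn}; change (pall S (taylor_rem y z k)); elim: k => [|k IH] /=; first exact: pall0.
  apply: (pallD hS); last by apply: (pallM hS) => //; apply: (pallD hS).
  by rewrite -mulr_natr; apply: (pallM hS); [apply: (pallX hS)|apply: (sub_nat (pall_is_sub hS))].
have wE i : w i = \sum_(k < i.+3) iota (f k) * taylor_rem y z k i by [].
apply: psP => n; pose M := n.+3.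
have yz0 : (y + z) 0%N = 0 by rewrite psDE y0 z0 addr0.
have nM : (n.+1 <= M)%N by rewrite /M; lia.
rewrite (psco_eqsum _ yz0 nM (ltnSn n)).
have Ew : eqps n.+1 w (\sum_(k < M) psC (iota (f k)) * taylor_rem y z k).
  move=> i ni; rewrite ps_sumE wE.
  rewrite -(big_mkord xpredT (fun k => iota (f k) * taylor_rem y z k i)).
  rewrite -(big_mkord xpredT (fun k => (psC (iota (f k)) * taylor_rem y z k) i)).
  rewrite [RHS](big_cat_nat (n := i.+3)) //=.
  rewrite [X in _ = _ + X]big_nat_cond [X in _ = _ + X]big1 ?addr0; last first.
    move=> k /andP[/andP[ik _] _]; rewrite psCM taylor_rem_ord ?mulr0 //; lia.
  by apply: eq_bigr => k _; rewrite psCM.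
have Ed : eqps n.+1 (psco iota (psd f) y) (\sum_(k < M) psC (iota (f k)) * (y ^+ k.-1 *+ k)).
  move=> i ni; have nM' : (n.+1 <= n.+2)%N by [].
  rewrite (psco_eqsum _ y0 nM' ni) !ps_sumE [RHS]big_ord_recl mulr0n mulr0 ps0E add0r.
  apply: eq_bigr => k _; rewrite /psd lift0 /= (raddfMn iota) (raddfMn (@psC R)).
  by rewrite mulrnAl mulrnAr.
have Ey := psco_eqsum f y0 nM.
transitivity ((\sum_(k < M) psC (iota (f k)) * y ^+ k + z * (\sum_(k < M) psC (iota (f k)) * (y ^+ k.-1 *+ k)
   + z * (\sum_(k < M) psC (iota (f k)) * taylor_rem y z k))) n); last first.
  apply/esym; rewrite psDE [RHS]psDE Ey //; congr (_ + _).
  apply: (eqps_mul (N := n.+1)) => // i ni; rewrite psDE [RHS]psDE Ed //; congr (_ + _).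
  by apply: (eqps_mul (N := n.+1)).
congr (fun h : ps R => h n).
rewrite mulrDr mulr_sumr mulrA mulr_sumr -!big_split; apply: eq_bigr => k _ /=.
rewrite taylor_remP; ring.
Qed.
End PowLowComp.

(** * Inverting a series x + ... and its congruences *)

Section Solve.
Variables (K R : comNzRingType) (iota : {rmorphism K -> R}).
Variable L : ps K.
Hypotheses (L0 : L 0%N = 0) (L1 : L 1%N = 1).
Notation "L @ h" := (psco iota L h) (at level 35).
Implicit Types (y z h Z F : ps R).

Lemma pscoL_n h n : h 0%N = 0 ->
  (L @ h) n = h n + \sum_(k < n) iota (L k.+2) * (h ^+ k.+2) n.
Proof.
move=> h0; rewrite (psco_wide iota L h0 (N := n.+2)) //.
rewrite big_ord_recl L0 rmorph0 mul0r add0r big_ord_recl /= L1 rmorph1 mul1r expr1.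
by congr (_ + _).
Qed.

Lemma pscoL_diff h h' n : h 0%N = 0 -> h' 0%N = 0 -> eqps n h h' ->
  (L @ h) n - (L @ h') n = h n - h' n.
Proof.
move=> h0 h'0 E; rewrite !pscoL_n // opprD addrACA -[RHS]addr0; congr (_ + _).
by apply/eqP; rewrite subr_eq0; apply/eqP; apply: eq_bigr => k _; rewrite (pow_low _ h0 h'0 E).
Qed.

Lemma pscoL_inj h h' : h 0%N = 0 -> h' 0%N = 0 -> L @ h = L @ h' -> h = h'.
Proof.
move=> h0 h'0 E; apply: psP => n; elim/ltn_ind: n => n IH.
have := pscoL_diff h0 h'0 IH; rewrite E subrr => /esym/eqP.
by rewrite subr_eq0 => /eqP.
Qed.

Lemma pscoL_solve Z : Z 0%N = 0 -> exists2 F : ps R, F 0%N = 0 & L @ F = Z.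
Proof.
move=> Z0.
(* The cut makes the recursion depend only on coefficients below n, as [ps_rec] demands, and removes
   the constant term, as [pow_low] demands. *)
pose cut n (F : ps R) : ps R := fun i => if (0 < i < n)%N then F i else 0.
have [F HF] : exists F : ps R, forall n, F n =
    Z n - \sum_(k < n) iota (L k.+2) * (cut n F ^+ k.+2) n.
  apply: (@ps_rec R (fun F n => Z n - \sum_(k < n) iota (L k.+2) * (cut n F ^+ k.+2) n) _ 0).
  move=> n F F' E; congr (_ - _); apply: eq_bigr => k _.
  suff -> : cut n F = cut n F' by [].
  by apply: psP => i; rewrite /cut; case: ifP => // /andP[_ /E].
have F0 : F 0%N = 0 by rewrite HF Z0 big_ord0 subr0.
exists F => //; apply: psP => n; rewrite pscoL_n // {1}HF.
rewrite -[RHS]addr0 -addrA; congr (_ + _); rewrite addrC.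
apply/eqP; rewrite subr_eq0; apply/eqP; apply: eq_bigr => k _.
rewrite (@pow_low _ n _ (cut n F)) // => i lt; rewrite /cut lt andbT.
by case: i lt => [|i] _ //=; rewrite F0.
Qed.

Variables (S I : R -> Prop).
Hypotheses (hS : is_sub S) (hI : is_idl S I).
(** A genuine condition when [L] has denominators. It is stated over a general [R] because it is
    needed both for series over K and for bivariate series, encoded over K[X]. *)
Definition good : Prop := forall y z, pall S y -> pall S z -> y 0%N = 0 -> z 0%N = 0 ->
  cg (pall I) y z -> cg (pall I) (L @ y) (L @ z).

(** Let y' agree with y below degree i and with z from there on. By induction y' is congruent to z,
    so [good] gives L(y') = L(z) modulo I, and triangularity identifies y_i - z_i with the
    coefficient i of L(y) - L(y'). Integrality of y is not assumed; it comes out of the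
    congruence. *)
Lemma pscoL_inj_cg N y z : good -> pall S z -> y 0%N = 0 -> z 0%N = 0 ->
  (forall i, (i < N)%N -> cg I ((L @ y) i) ((L @ z) i)) ->
  forall i, (i < N)%N -> cg I (y i) (z i).
Proof.
move=> gL Sz y0 z0 C i; elim/ltn_ind: i => i IH iN.
pose y' : ps R := fun j => if (j < i)%N then y j else z j.
have y'z : cg (pall I) y' z.
  move=> j; rewrite psBE /y'; case: ltnP => ji; first by apply: IH => //; apply: ltn_trans iN.
  by rewrite subrr; apply: (idl0 hI).
have Sy' : pall S y' by move=> j; apply: (cg_sub hS hI (y'z j)).
have y'0 : y' 0%N = 0 by rewrite /y'; case: ifP.
have E : eqps i y y' by move=> j ji; rewrite /y' ji.
have := pscoL_diff y0 y'0 E; rewrite {2}/y' ltnn => D.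
rewrite /cg -D.
apply: (cg_trans hI (C i iN)); apply: (cg_sym hI).
exact: (gL _ _ Sy' Sz y'0 z0 y'z i).
Qed.
End Solve.

Section RightDivision.
Variables (K : comNzRingType) (S : K -> Prop).
Hypothesis hS : is_sub S.
(** The system X(G) = T is triangular with diagonal entries G'(0)^n, inverted within S by c^n. *)
Lemma psco_divr (G T : ps K) c : pall S G -> pall S T -> S c -> G 0%N = 0 -> G 1%N * c = 1 ->
  exists2 X : ps K, pall S X & psco idfun X G = T.
Proof.
move=> SG ST Sc G0 Gc.
have [X HX] : exists X : ps K, forall n, X n =
    (T n - \sum_(k < n) X k * (G ^+ k) n) * c ^+ n.
  apply: (@ps_rec K (fun X n => (T n - \sum_(k < n) X k * (G ^+ k) n) * c ^+ n) _ 0).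
  by move=> n f g E; congr ((_ - _) * _); apply: eq_bigr => -[k kn] _ /=; rewrite E.
exists X.
  move=> n; elim/ltn_ind: n => n IH; rewrite HX; apply: (subM hS); last exact: subX.
  apply: (subB hS) => //; apply: (sub_sum hS) => k _; apply: (subM hS); first exact: IH.
  exact: (pallX hS).
apply: psP => n; rewrite /psco big_ord_recr /= ordpsXn // (HX n) -mulrA -exprMn [c * _]mulrC Gc.
by rewrite expr1n mulr1 addrC subrK.
Qed.
End RightDivision.

(** * Frobenius congruences *)

Section Frobenius.
Variables (R : comNzRingType) (S I : R -> Prop) (p : nat).
Hypotheses (hS : is_sub S) (hI : is_idl S I) (p_pr : prime p) (Ip : I p%:R).

Lemma frobD a b : S a -> S b -> cg I ((a + b) ^+ p) (a ^+ p + b ^+ p).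
Proof.
move=> Sa Sb; case: p p_pr Ip => // q q_pr Iq.
rewrite exprDn big_ord_recl big_ord_recr /= subn0 bin0 mulr1n expr0 mulr1.
rewrite subnn expr0 mul1r binn mulr1n /cg.
rewrite addrA [X in X - _]addrAC opprD addrA [X in X - _ - _]addrC.
rewrite -!addrA; set s := (X in X + _).
have -> : s + (a ^+ q.+1 + (b ^+ q.+1 + (- a ^+ q.+1 - b ^+ q.+1))) = s by ring.
apply: (idl_sum hI) => i _; rewrite -mulr_natr; apply: (idlM hI).
  by apply: (subM hS); apply: (subX hS).
have /dvdnP[m ->] : (q.+1 %| 'C(q.+1, lift ord0 i))%N.
  by apply: prime_dvd_bin => //; rewrite lift0 /= ltnS; apply: ltn_ord.
rewrite natrM; apply: (idlM hI) => //; exact: sub_nat.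
Qed.

Lemma frob_sum (J : Type) (r : seq J) (F : J -> R) : (forall i, S (F i)) ->
  cg I ((\sum_(i <- r) F i) ^+ p) (\sum_(i <- r) F i ^+ p).
Proof.
move=> SF; elim: r => [|j r IH].
  by rewrite !big_nil expr0n gtn_eqF ?prime_gt0 //; apply: (cg_refl hI).
rewrite !big_cons; apply: (cg_trans hI (frobD _ _)) => //; first exact: (sub_sum hS).
by apply: (cgD hI) => //; apply: (cg_refl hI).
Qed.

Lemma frob_natX n i : cg I (n%:R ^+ (p ^ i)) n%:R.
Proof.
elim: i => [|i IH]; first exact: (cg_refl hI).
rewrite expnS mulnC exprM; apply: (@cg_trans _ _ _ hI (n%:R ^+ p)).
  by apply: (cgX hS hI) => //; [apply/(subX hS)/(sub_nat hS)|apply: (sub_nat hS)].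
elim: n {IH} => [|n IH]; first by rewrite expr0n gtn_eqF ?prime_gt0 //; apply: (cg_refl hI).
rewrite -natr1; apply: (cg_trans hI (frobD _ _)).
- exact: (sub_nat hS).
- exact: (sub1 hS).
by rewrite expr1n; apply: (cgD hI) => //; apply: (cg_refl hI).
Qed.
End Frobenius.

Section FrobeniusPs.
Variables (R : comNzRingType) (S I : R -> Prop) (p : nat).
Hypotheses (hS : is_sub S) (hI : is_idl S I) (p_pr : prime p) (Ip : I p%:R).
Notation "x =~ y" := (cg (pall I) x y) (at level 70).

Lemma pall_fr P f : pall S f -> pall S (fr P f).
Proof. by move=> Sf n; apply: subX. Qed.

Lemma frob_ps1 f : pall S f -> f ^+ p =~ psexp p (fr p f).
Proof.
move=> Sf n; pose N := n.+1; pose s : ps R := \sum_(i < N) psC (f i) * px ^+ i.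
have p0 := prime_gt0 p_pr.
have E : eqps N f s.
  move=> j jN; rewrite /s ps_sumE (bigD1 (Ordinal jN)) //= big1 ?addr0.
    by rewrite psCM pxX eqxx mulr1.
  move=> i /eqP ne; rewrite psCM pxX; case: eqP => [e|_]; last by rewrite mulr0.
  by case: ne; apply: val_inj.
have hS' := pall_is_sub hS; have hI' := pall_is_idl hI.
rewrite psBE (eqps_exp p E (ltnSn n)).
have Ip' : pall I p%:R.
  have -> : p%:R = psC p%:R :> ps R by rewrite rmorph_nat.
  by move=> i; rewrite /psC; case: ifP => // _; apply: (idl0 hI).
have := @frob_sum _ _ _ p hS' hI' p_pr Ip' _ (index_enum 'I_N) (fun i : 'I_N => psC (f i) * px ^+ i).
move=> /(_ _)/(_ n); rewrite psBE => H.
have -> : psexp p (fr p f) n = (\sum_(i < N) (psC (f i) * px ^+ i) ^+ p) n.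
  rewrite ps_sumE /psexp /fr.
  under eq_bigr => i _ do rewrite exprMn -rmorphXn psCM -exprM pxX.
  case: (boolP (p %| n)%N) => [/dvdnP[m Em]|pn].
    have mN : (m < N)%N by rewrite /N Em ltnS leq_pmulr.
    rewrite (bigD1 (Ordinal mN)) //= Em mulnK // eqxx mulr1 big1 ?addr0 // => i /eqP ne.
    case: eqP => [e|_]; last by rewrite mulr0.
    case: ne; apply: val_inj => /=; move/eqP: e; rewrite eqn_pmul2r // => /eqP //.
  rewrite big1 // => i _; case: eqP => [e|_]; last by rewrite mulr0.
  by rewrite e dvdn_mull in pn.
apply: H => i; apply: (pallM hS); first exact: (pallC hS).
by apply: (pallX hS); apply: (pall_px hS).
Qed.

Lemma frob_ps i f : pall S f -> f ^+ (p ^ i) =~ psexp (p ^ i) (fr (p ^ i) f).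
Proof.
have hS' := pall_is_sub hS; have hI' := pall_is_idl hI.
have p0 := prime_gt0 p_pr.
move=> Sf; elim: i => [|i IH]; first by rewrite expn0 expr1 psexp1 fr1; apply: (cg_refl hI').
rewrite expnS mulnC exprM.
have S1 : pall S (psexp (p ^ i) (fr (p ^ i) f)).
  by apply: psexp_pall; [apply: (sub0 hS)|apply: pall_fr].
apply: (@cg_trans _ _ _ hI' (psexp (p ^ i) (fr (p ^ i) f) ^+ p)).
  by apply: (cgX hS' hI') => //; apply: (pallX hS).
apply: (cg_trans hI' (frob_ps1 S1)).
rewrite fr_psexp // fr_fr psexp_psexp ?expn_gt0 ?p0 // mulnC; exact: (cg_refl hI').
Qed.

(** The twist and the derivative commute because the integer factor n + 1 is fixed by Frobenius
    modulo I. *)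
Lemma frob_psd i f : pall S f ->
  cg (pall I) (psd (fr (p ^ i) f)) (fr (p ^ i) (psd f)).
Proof.
move=> Sf n; rewrite psBE /psd /fr -[f n.+1 *+ n.+1]mulr_natr -[_ ^+ _ *+ n.+1]mulr_natr exprMn -mulrBr.
apply: (idlM hI); first exact: subX.
by rewrite -opprB; apply: (idlN hI); apply: (frob_natX hS hI p_pr Ip).
Qed.
End FrobeniusPs.

(** * Valuations and residue fields *)

Definition dvS (R : comNzRingType) (S : R -> Prop) (c x : R) : Prop :=
  exists2 s, S s & x = c * s.

Section DvS.
Variables (R : comNzRingType) (S : R -> Prop).
Hypothesis hS : is_sub S.
Lemma dvS_idl c : S c -> is_idl S (dvS S c).
Proof.
move=> Sc; split.
- by exists 0; [apply: (sub0 hS)|rewrite mulr0].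
- by move=> x y [s Ss ->] [t St ->]; exists (s - t); [apply: (subB hS)|rewrite mulrBr].
- by move=> x [s Ss ->]; apply: (subM hS).
by move=> s x Ss [t St ->]; exists (s * t); [apply: (subM hS)|rewrite mulrCA].
Qed.
Lemma dvS_self c s : S s -> dvS S c (c * s). Proof. by exists s. Qed.
Lemma dvSM c d x y : dvS S c x -> dvS S d y -> dvS S (c * d) (x * y).
Proof. by move=> [s Ss ->] [t St ->]; exists (s * t); [apply: (subM hS)|rewrite mulrACA]. Qed.
Lemma pall_dvS c f : pall (dvS S c) f -> exists2 h, pall S h & f = psC c * h.
Proof.
move=> H; have /choice[h Hh] : forall n, exists s, S s /\ f n = c * s.
  by move=> n; case: (H n) => s; exists s.
exists h; first by move=> n; case: (Hh n).
by apply: psP => n; rewrite psCM; case: (Hh n).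
Qed.
Lemma dvS_pall c h : pall S h -> pall (dvS S c) (psC c * h).
Proof. by move=> Sh n; exists (h n) => //; rewrite psCM. Qed.
Lemma dvS1 x : S x -> dvS S 1 x.
Proof. by move=> Sx; exists x => //; rewrite mul1r. Qed.
End DvS.

Section Valuation.
Variables (K : fieldType) (v : K -> int).
Hypothesis hv : is_valuation v.
Definition OK (x : K) : Prop := inO v x.

Lemma vM x y : x != 0 -> y != 0 -> v (x * y) = v x + v y. Proof. by case: hv => + _; apply. Qed.
Lemma v1 : v 1 = 0.
Proof.
have := vM (oner_neq0 K) (oner_neq0 K).
by rewrite mulr1 => /eqP; rewrite -subr_eq0 opprD addNKr oppr_eq0 => /eqP.
Qed.
Lemma vV x : x != 0 -> v x^-1 = - v x.
Proof.
move=> x0; have := vM x0 (invr_neq0 x0); rewrite mulfV // v1 => /esym/eqP.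
by rewrite addr_eq0 => /eqP ->; rewrite opprK.
Qed.
Lemma vX x n : x != 0 -> v (x ^+ n) = v x *+ n.
Proof.
move=> x0; elim: n => [|n IH]; first by rewrite v1.
by rewrite exprS vM ?expf_neq0 // IH mulrS.
Qed.
Lemma vN x : v (- x) = v x.
Proof.
have [->|x0] := eqVneq x 0; first by rewrite oppr0.
have E : v (-1) = 0.
  have : v ((-1) * (-1)) = 0 by rewrite mulrNN mulr1 v1.
  by rewrite vM ?oppr_eq0 ?oner_neq0 //; lia.
by rewrite -mulN1r vM ?oppr_eq0 ?oner_neq0 // E add0r.
Qed.
Lemma OK_sub : is_sub OK.
Proof.
split; first by rewrite /OK /inO v1 oner_eq0 lexx.
- move=> x y; rewrite /OK /inO.
  have [->|x0] := eqVneq x 0; first by rewrite sub0r oppr_eq0 vN.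
  have [->|y0] := eqVneq y 0; first by rewrite subr0 (negPf x0).
  have [//|d0] := eqVneq (x - y) 0.
  rewrite /= => vx vy; case: hv => _ /(_ x (- y) x0).
  rewrite oppr_eq0 => /(_ y0 d0) /orP[|]; rewrite ?vN; first exact: le_trans.
  exact: le_trans.
move=> x y; rewrite /OK /inO.
have [->|x0] := eqVneq x 0; first by rewrite mul0r eqxx.
have [->|y0] := eqVneq y 0; first by rewrite mulr0 eqxx.
by rewrite vM // /= => vx vy; rewrite addr_ge0 ?orbT.
Qed.
Lemma OKV x : v x = 0 -> OK x^-1.
Proof.
have [->|x0] := eqVneq x 0; first by rewrite invr0 /OK /inO eqxx.
by move=> vx; rewrite /OK /inO vV // vx lexx orbT.
Qed.
Lemma OK0 x : v x = 0 -> OK x. Proof. by rewrite /OK /inO => ->; rewrite lexx orbT. Qed.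

Lemma dvOP c x : c != 0 -> dvS OK c x <-> (x == 0) || (v c <= v x).
Proof.
move=> c0; have [->|x0 /=] := eqVneq x 0.
  by split=> // _; exists 0; rewrite ?mulr0 // /OK /inO eqxx.
split=> [[s Os E]|le].
  have s0 : s != 0 by apply: contraNneq x0 => s0; rewrite E s0 mulr0.
  by move: Os; rewrite E vM // /OK /inO (negPf s0) /=; lia.
exists (x / c); last by rewrite mulrC divfK.
by rewrite /OK /inO vM ?invr_neq0 // vV //; apply/orP; right; lia.
Qed.
Lemma dvO_trans c d x : c != 0 -> d != 0 -> v d <= v c -> dvS OK c x -> dvS OK d x.
Proof.
move=> c0 d0 le /(dvOP _ c0) H; apply/(dvOP _ d0).
by case/orP: H => [->//|le']; rewrite (le_trans le le') orbT.
Qed.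

Variable pi : K.
Hypotheses (pi0 : pi != 0) (vpi : v pi = 1).
Notation MK := (dvS OK pi).
Lemma OKpi : OK pi. Proof. by rewrite /OK /inO vpi orbT. Qed.
Lemma MK_idl : is_idl OK MK. Proof. exact: (dvS_idl OK_sub OKpi). Qed.
Lemma MKE x : MK x <-> inM v x.
Proof. by rewrite dvOP // vpi /inM; have -> : (1 <= v x) = (0 < v x) by lia. Qed.
Lemma vpiX n : v (pi ^+ n) = n%:Z. Proof. by rewrite vX // vpi; lia. Qed.
Lemma piX0 n : pi ^+ n != 0. Proof. by rewrite expf_neq0. Qed.
Lemma dvpiE n x : dvS OK (pi ^+ n) x <-> vsmall v x n.
Proof. by rewrite dvOP ?piX0 // vpiX. Qed.
Lemma OK_unit x : OK x -> ~ MK x -> x != 0 /\ v x = 0.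
Proof.
rewrite MKE /OK /inO /inM; have [//|x0 /=] := eqVneq x 0.
by move=> ge /negP; rewrite -leNgt; split=> //; lia.
Qed.
Lemma unit_notMK x : x != 0 -> v x = 0 -> ~ MK x.
Proof. by move=> x0 vx; rewrite MKE /inM (negPf x0) vx ltxx. Qed.
Lemma MK1 : ~ MK 1. Proof. by apply: unit_notMK; rewrite ?oner_neq0 ?v1. Qed.
Lemma MK_prime x y : OK x -> OK y -> MK (x * y) -> MK x \/ MK y.
Proof.
move=> Ox Oy; rewrite !MKE /inM /OK /inO in Ox Oy *.
have [->|x0] := eqVneq x 0; first by left.
have [->|y0] := eqVneq y 0; first by right.
rewrite mulf_eq0 (negPf x0) (negPf y0) /= in Ox Oy *; rewrite vM //.
by move=> H; case: (ltrP 0 (v x)) => [|le]; [left|right; lia].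
Qed.
Lemma MKX x n : OK x -> MK (x ^+ n) -> MK x.
Proof.
move=> Ox; elim: n => [|n IH]; first by move/MK1.
by rewrite exprS => /(MK_prime Ox) []//; apply: (subX OK_sub).
Qed.
Lemma dvpi_sep x : (forall n, dvS OK (pi ^+ n) x) -> x = 0.
Proof.
move=> H; apply/eqP; case: eqVneq => // x0.
have := H `|v x|.+1; rewrite dvpiE /vsmall (negPf x0) /=; lia.
Qed.
Lemma dvpiW m n x : (m <= n)%N -> dvS OK (pi ^+ n) x -> dvS OK (pi ^+ m) x.
Proof. by move=> mn; apply: dvO_trans; rewrite ?piX0 // !vpiX; lia. Qed.
Lemma dvpiX_idl n : is_idl OK (dvS OK (pi ^+ n)).
Proof. by apply: (dvS_idl OK_sub); apply: (subX OK_sub); apply: OKpi. Qed.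
Lemma dvpi_bound x : exists n, OK (pi ^+ n * x).
Proof.
have [->|x0] := eqVneq x 0; first by exists 0%N; rewrite mulr0 /OK /inO eqxx.
exists `|v x|%N; rewrite /OK /inO vM ?piX0 // vpiX; lia.
Qed.

Hypothesis hc : v_complete v.
Lemma pi_complete (a : nat -> K) : (forall n, dvS OK (pi ^+ n) (a n.+1 - a n)) ->
  exists l, forall n, dvS OK (pi ^+ n) (l - a n).
Proof.
move=> H.
have H2 n k : dvS OK (pi ^+ n) (a (n + k)%N - a n).
  elim: k => [|k IH]; first by rewrite addn0 subrr; apply: (idl0 (dvpiX_idl n)).
  rewrite -(subrK (a (n + k)%N) (a (n + k.+1)%N)) -addrA; apply: (idlD (dvpiX_idl n)) => //.
  rewrite addnS; apply: (dvpiW (leq_addr k n)); apply: H.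
have [|l Hl] := hc (a := a).
  move=> N; exists N => m n Nm Nn; apply/dvpiE.
  have -> : a m - a n = (a (N + (m - N))%N - a N) - (a (N + (n - N))%N - a N).
    by rewrite !subnKC //; ring.
  exact: (idlB (dvpiX_idl N)).
exists l => n; have [M HM] := Hl n.
have := HM (n + M)%N (leq_addl _ _); rewrite -dvpiE => D.
have -> : l - a n = (a (n + M)%N - a n) - (a (n + M)%N - l) by ring.
exact: (idlB (dvpiX_idl n)).
Qed.

(** Contraction principle for the coefficientwise pi-adic topology, iterating from 0; the quotient
    in Weierstrass division is obtained as such a fixed point. *)
Lemma pi_fixpoint (Phi : ps K -> ps K) :
  (forall f, pall OK f -> pall OK (Phi f)) ->
  (forall n f g, pall OK f -> pall OK g -> pall (dvS OK (pi ^+ n)) (f - g) ->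
     pall (dvS OK (pi ^+ n.+1)) (Phi f - Phi g)) ->
  exists2 f, pall OK f & Phi f = f.
Proof.
move=> PO PC; pose a n := iter n Phi 0.
have aO n : pall OK (a n) by elim: n => [|n IH]; [apply: (pall0 OK_sub)|apply: PO].
have aD n : pall (dvS OK (pi ^+ n)) (a n.+1 - a n).
  elim: n => [|n IH]; last exact: (PC _ _ _ (aO _) (aO _) IH).
  by move=> i; rewrite expr0; apply: dvS1; apply: (pallB OK_sub) => //; apply: aO.
have /choice[l Hl] : forall i, exists l, forall n, dvS OK (pi ^+ n) (l - a n i).
  by move=> i; apply: pi_complete => n; apply: aD.
have lO : pall OK l.
  by move=> i; rewrite -(subrK (a 0%N i) (l i)); apply: (subD OK_sub); last exact: aO;
    apply: (idlW (dvpiX_idl 0)); apply: Hl.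
exists l => //; apply: psP => i; apply/eqP; rewrite -subr_eq0; apply/eqP/dvpi_sep => n.
have -> : Phi l i - l i = (Phi l - Phi (a n)) i - (l i - a n.+1 i).
  by rewrite psBE /=; ring.
apply: (idlB (dvpiX_idl n)); last exact: (dvpiW (leqnSn n)).
by apply: (dvpiW (leqnSn n)); apply: PC => // j; apply: Hl.
Qed.
End Valuation.

Section ResidueField.
Variables (p f : nat) (K : fieldType) (v : K -> int) (pi : K).
Hypotheses (hv : is_valuation v) (pi0 : pi != 0) (vpi : v pi = 1) (p_pr : prime p).
Hypothesis hr : residue_card v (p ^ f)%N.
Notation q := (p ^ f)%N.
Notation O := (OK v).
Notation M := (dvS O pi).
Let hS := OK_sub hv.
Let hI := MK_idl hv vpi.

Lemma residue_reps : exists r : 'I_q -> K, exists cl : K -> 'I_q,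
  [/\ forall i, O (r i), forall i j, cg M (r i) (r j) -> i = j
    & forall x, O x -> cg M x (r (cl x))].
Proof.
case: hr => s [ss sO sinj scov].
have q0 : (0 < q)%N by rewrite expn_gt0 prime_gt0.
have /choice[cl Hcl] : forall x, exists i : 'I_q, O x -> cg M x s`_i.
  move=> x; have [Ox|nOx] := pselect (O x); last by exists (Ordinal q0).
  have [i iq Hi] := scov x Ox; exists (Ordinal iq) => _; exact/(MKE hv pi0 vpi).
exists (fun i => s`_i), cl; split => //.
  by move=> i; apply: (allP sO); rewrite mem_nth ?ss.
by move=> i j /(MKE hv pi0 vpi) H; apply: val_inj; apply: sinj => //=; apply: ltn_ord.
Qed.

(** Adding 1 permutes the residue classes; comparing the two sums of representatives gives q = 0. *)
Lemma residue_nat : M q%:R.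
Proof.
have [r [cl [rO rinj rcl]]] := residue_reps.
pose s i := cl (r i + 1).
have r1 i : O (r i + 1) by apply: (subD hS) => //; apply: (sub1 hS).
have s_inj : injective s.
  move=> i j E; apply: rinj; rewrite /cg.
  have -> : r i - r j = (r i + 1 - r (s i)) - (r j + 1 - r (s j)) by rewrite E; ring.
  by apply: (idlB hI); apply: rcl.
have E : \sum_i r i = \sum_i r (s i) by rewrite [LHS](reindex_inj s_inj).
have : cg M (\sum_i (r i + 1)) (\sum_i r (s i)) by apply: (cg_sum hI) => i _; apply: rcl.
by rewrite /cg -E big_split /= sumr_const card_ord addrAC subrr add0r.
Qed.
Lemma residue_char : M p%:R.
Proof. by apply: (MKX hv pi0 vpi (n := f)); [apply: (sub_nat hS)|rewrite -natrX; apply: residue_nat]. Qed.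
Lemma residue_f_gt0 : (0 < f)%N.
Proof. by have := residue_nat; case: f => // /(MK1 hv pi0 vpi). Qed.

(** Multiplication by a unit fixes the zero class z and permutes the others; comparing the products
    of the latter, which are units, gives a^(q-1) = 1. *)
Lemma residue_fermat a : O a -> cg M (a ^+ q) a.
Proof.
move=> Oa; have q0 : (0 < q)%N by rewrite expn_gt0 prime_gt0.
have [Ma|nMa] := pselect (M a).
  apply: (idlB hI) => //; rewrite -(prednK q0) exprS; apply: (idlMr hI) => //.
  exact: (subX hS).
have [r [cl [rO rinj rcl]]] := residue_reps.
pose s i := cl (a * r i).
have O0 := sub0 hS.
have sO i : O (a * r i) by apply: (subM hS).
have s_inj : injective s.
  move=> i j E; apply: rinj; rewrite /cg.
  have : M (a * (r i - r j)).
    have -> : a * (r i - r j) = (a * r i - r (s i)) - (a * r j - r (s j)) by rewrite E; ring.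
    by apply: (idlB hI); apply: rcl.
  by case/(MK_prime hv pi0 vpi) => //; apply: (subB hS).
pose z := cl 0; have rz : M (r z) by have := idlN hI (rcl 0 O0); rewrite sub0r opprK.
have zP i : M (r i) -> i = z.
  by move=> Mi; apply: rinj; apply: (idlB hI).
have sz : s z = z.
  apply: zP; have -> : r (s z) = a * r z - (a * r z - r (s z)) by ring.
  by apply: (idlB hI); [apply: (idlM hI)|apply: rcl].
have E : \prod_(i | i != z) r i = \prod_(i | i != z) r (s i).
  rewrite [LHS](reindex_inj s_inj); apply: eq_bigl => i.
  by rewrite -{1}sz (inj_eq s_inj).
pose P := \prod_(i | i != z) r i.
have OP (F : 'I_q -> K) : (forall i, O (F i)) -> O (\prod_(i | i != z) F i).
  by move=> FO; elim/big_ind: _ => //; [apply: (sub1 hS)|apply: (subM hS)].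
have C : cg M (\prod_(i | i != z) (a * r i)) P.
  rewrite /P E; suff : O (\prod_(i | i != z) (a * r i)) /\ O (\prod_(i | i != z) r (s i)) /\
     cg M (\prod_(i | i != z) (a * r i)) (\prod_(i | i != z) r (s i)) by case=> _ [].
  elim/big_rec2: _ => [|i x y _ [Oy [Ox C]]].
    by split; [apply: (sub1 hS)|split; [apply: (sub1 hS)|apply: (cg_refl hI)]].
  by split; [|split]; [apply: (subM hS)|apply: (subM hS)|apply: (cgM hI) => //; apply: rcl].
have [_ nP] : O P /\ ~ M P.
  rewrite /P; elim/big_ind: _ => [|x y [Ox nx] [Oy ny]|i /eqP iz].
  - by split; [apply: (sub1 hS)|apply: (MK1 hv pi0 vpi)].
  - by split; [apply: (subM hS)|move=> /(MK_prime hv pi0 vpi Ox Oy) []].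
  by split; [apply: rO|move=> /zP].
move: C; rewrite /cg big_split /= prodr_const -/P -[X in _ - X]mul1r -mulrBl.
have -> : #|[pred i | i != z]| = q.-1 by rewrite cardC1 card_ord.
case/(MK_prime hv pi0 vpi) => //.
- by apply: (subB hS); [apply: (subX hS)|apply: (sub1 hS)].
- exact: OP.
by move=> H; rewrite -{2}[a]mulr1 -(prednK q0) exprS -mulrBr; apply: (idlM hI).
Qed.

Definition Opoly (F : {poly K}) := forall i, O F`_i.

(** Lagrange's bound over the residue field, phrased over O. The quotient G of F - F(a) by X - a is
    written out so that its integrality is visible; the remaining roots are roots of G because the
    differences of incongruent elements are units. *)
Lemma residue_roots n (F : {poly K}) (s : seq K) : Opoly F -> (size F <= n)%N ->
  size s = n -> all (inO v) s -> pairwise (fun x y => ~~ inM v (x - y)) s ->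
  (forall x, x \in s -> M F.[x]) -> forall i, M F`_i.
Proof.
elim: n F s => [|n IH] F s OF sF.
  by move=> _ _ _ _ i; rewrite nth_default ?(leq_trans sF) //; apply: (idl0 hI).
case: s => // a s [ss] /= /andP[Oa Os] /andP[/allP as_ Ps] Fs.
pose G : {poly K} := \sum_(i < n) F`_i.+1 *: \sum_(j < i.+1) 'X ^+ (i - j) * (a%:P) ^+ j.
have EF : F = ('X - a%:P) * G + (F.[a])%:P.
  rewrite /G mulr_sumr (_ : F.[a] = \sum_(i < n.+1) F`_i * a ^+ i); last exact: horner_coef_wide.
  rewrite big_ord_recl /= mulr1 polyCD raddf_sum /= addrCA -big_split /=.
  rewrite {1}[F](_ : _ = \poly_(i < n.+1) F`_i); last first.
    apply/polyP => i; rewrite coef_poly; case: ltnP => // ni.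
    by rewrite nth_default // (leq_trans sF).
  rewrite poly_def big_ord_recl expr0 alg_polyC; congr (_ + _); apply: eq_bigr => i _.
  rewrite -scalerAr -subrXX /bump ?add1n polyCM polyC_exp scalerBr -mul_polyC -[X in _ - X]mul_polyC.
  by rewrite subrK.
have OG : Opoly G.
  move=> k; rewrite /G coef_sum; apply: (sub_sum hS) => i _; rewrite coefZ; apply: (subM hS) => //.
  rewrite coef_sum; apply: (sub_sum hS) => j _; rewrite -polyC_exp coefMC coefXn.
  by apply: (subM hS); [apply: (sub_nat hS)|apply: (subX hS)].
have sG : (size G <= n)%N.
  rewrite /G (leq_trans (size_sum _ _ _)) //; apply/bigmax_leqP => i _.
  rewrite (leq_trans (size_scale_leq _ _)) // (leq_trans (size_sum _ _ _)) //.
  apply/bigmax_leqP => j _; rewrite -polyC_exp mulrC mul_polyC (leq_trans (size_scale_leq _ _)) //.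
  by rewrite size_polyXn; case: i j => i /= iN [j /= jN]; lia.
have MG : forall i, M G`_i.
  apply: (IH G s) => // x xs.
  have Ox : O x by apply: (allP Os).
  have := Fs x; rewrite inE xs orbT => /(_ isT).
  have := Fs a; rewrite inE eqxx => /(_ isT) Fa.
  rewrite {1}EF hornerD hornerM hornerXsubC hornerC => H.
  have : M ((x - a) * G.[x]) by rewrite -[X in M X](addrK F.[a]); apply: (idlB hI).
  case/(MK_prime hv pi0 vpi) => //; first exact: (subB hS).
    rewrite horner_coef; apply: (sub_sum hS) => i _; apply: (subM hS) => //; exact: (subX hS).
  move/(idlN hI); rewrite opprB => /(MKE hv pi0 vpi) Mx.
  by have := as_ x xs; rewrite Mx.
move=> i; rewrite EF coefD coefC; apply: (idlD hI).
  rewrite coefM; apply: (idl_sum hI) => j _; apply: (idlM hI) => //.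
  rewrite coefB coefX coefC; apply: (subB hS); first exact: (sub_nat hS).
  by case: ifP => // _; apply: (sub0 hS).
case: ifP => _; last exact: (idl0 hI).
by apply: Fs; rewrite inE eqxx.
Qed.

(** Otherwise X^P - X with P = p^i < q would have P + 1 incongruent roots. *)
Lemma residue_nontrivial_power i : (0 < i < f)%N ->
  exists a, [/\ a != 0, v a = 0 & ~ cg M (a ^+ (p ^ i)) a].
Proof.
move=> /andP[i0 i_f]; set P := (p ^ i)%N.
have P1 : (1 < P)%N by rewrite -(exp1n i) ltn_exp2r // prime_gt1.
have Pq : (P < q)%N by rewrite ltn_exp2l // prime_gt1.
apply: contrapT => H.
have aP a : O a -> M (a ^+ P - a).
  move=> Oa; have [Ma|nMa] := pselect (M a).
    by apply: (idlB hI) => //; rewrite -(ltn_predK P1) exprS; apply: (idlMr hI) => //; apply: (subX hS).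
  have [a0 va] := OK_unit hv pi0 vpi Oa nMa.
  by apply: contrapT => H2; apply: H; exists a.
have [r [cl [rO rinj rcl]]] := residue_reps.
pose s := take P.+1 [seq r j | j <- enum 'I_q].
have ss : size s = P.+1 by rewrite size_takel // size_map size_enum_ord.
have sr x : x \in s -> exists j, x = r j.
  by move/mem_take => /mapP[j _ ->]; exists j.
have : M ('X^P - 'X : {poly K})`_P.
  apply: (@residue_roots P.+1 _ s) => //.
  - move=> j; rewrite coefB coefXn coefX; apply: (subB hS); exact: (sub_nat hS).
  - by rewrite size_polyDl ?size_polyXn // size_polyN size_polyX ltnS.
  - by apply/allP => x /sr[j ->]; apply: rO.
  - have : pairwise (fun x y => ~~ inM v (x - y)) [seq r j | j <- enum 'I_q].
      rewrite pairwise_map; have := enum_uniq 'I_q; rewrite uniq_pairwise.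
      apply: sub_pairwise => j k /= ne; apply/negP => /(MKE hv pi0 vpi) /rinj E.
      by rewrite E eqxx in ne.
    by rewrite -{1}[map _ _](cat_take_drop P.+1) pairwise_cat => /and3P[].
  by move=> x /sr[j ->]; rewrite hornerD hornerN hornerXn hornerX; apply: aP.
rewrite coefB coefXn coefX eqxx gtn_eqF // subr0; exact: (MK1 hv pi0 vpi).
Qed.
End ResidueField.

(** * Weierstrass preparation *)

Definition pp (K : comNzRingType) (F : {poly K}) : ps K := fun i => F`_i.

Section PolySeries.
Variable K : comNzRingType.
Implicit Types F G : {poly K}.
Lemma ppM F G : pp (F * G) = pp F * pp G.
Proof. by apply: psP => n; rewrite /pp coefM psME. Qed.
Lemma ppD F G : pp (F + G) = pp F + pp G.
Proof. by apply: psP => n; rewrite /pp coefD psDE. Qed.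
Lemma ppN F : pp (- F) = - pp F.
Proof. by apply: psP => n; rewrite /pp coefN psNE. Qed.
Lemma ppB F G : pp (F - G) = pp F - pp G.
Proof. by rewrite ppD ppN. Qed.
Lemma ppC (c : K) : pp c%:P = psC c.
Proof. by apply: psP => n; rewrite /pp coefC. Qed.
Lemma pp_inj : injective (@pp K).
Proof. by move=> F G E; apply/polyP => i; have := congr1 (fun h => h i) E. Qed.
Lemma pp_tr d (r : ps K) : (forall i, (d <= i)%N -> r i = 0) -> r = pp (tr d r).
Proof. by move=> H; apply: psP => n; rewrite /pp coef_tr; case: ltnP => // /H. Qed.
Lemma ppXn d : pp ('X^d : {poly K}) = px ^+ d.
Proof. by apply: psP => n; rewrite /pp coefXn pxX. Qed.
Lemma psd_pp F : psd (pp F) = pp F^`().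
Proof. by apply: psP => n; rewrite /psd /pp coef_deriv. Qed.
End PolySeries.

Section Weierstrass.
Variables (K : fieldType) (v : K -> int) (pi : K).
Hypotheses (hv : is_valuation v) (pi0 : pi != 0) (vpi : v pi = 1).
Notation O := (OK v).
Notation M := (dvS O pi).
Let hS := OK_sub hv.
Let hI := MK_idl hv vpi.
Implicit Types f g h : ps K.

Definition prim f := pall O f /\ ~ pall M f.
Definition wd f n := (forall i, (i < n)%N -> M (f i)) /\ ~ M (f n).

Lemma wd_prim f n : pall O f -> wd f n -> prim f.
Proof. by move=> Of [_ nM]; split=> // H; apply: nM. Qed.
Lemma prim_wd f : prim f -> exists n, wd f n.
Proof.
case=> Of nM.
have ex : exists n, ~~ inM v (f n).
  apply: contrapT => H; apply: nM => n; apply/(MKE hv pi0 vpi).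
  by apply: contrapT => H2; apply: H; exists n; apply/negP.
exists (ex_minn ex); case: ex_minnP => n /negP nn min; split; last by move/(MKE hv pi0 vpi).
move=> i lt; apply/(MKE hv pi0 vpi); apply: contraTT lt; rewrite -leqNgt; exact: min.
Qed.
Lemma wd_mul f g m n : pall O f -> pall O g -> wd f m -> wd g n -> wd (f * g) (m + n).
Proof.
move=> Of Og [fm nf] [gn ng]; split.
  move=> i lt; apply: (idl_sum hI) => -[j /= ji] _.
  case: (ltnP j m) => [/fm H|jm]; first exact: (idlMr hI).
  by apply: (idlM hI) => //; apply: gn; lia.
have mn : (m < (m + n).+1)%N by lia.
rewrite psME (bigD1 (Ordinal mn)) //= addKn => H.
have : M (f m * g n).
  rewrite -[X in M X](addrK (\sum_(i < (m + n).+1 | i != Ordinal mn) f i * g (m + n - i)%N)).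
  apply: (idlB hI) => //; apply: (idl_sum hI) => -[j /= ji] /eqP ne.
  have {}ne : j <> m by move=> E; apply: ne; apply: val_inj.
  case: (ltnP j m) => [/fm|jm]; first exact: (idlMr hI).
  by apply: (idlM hI) => //; apply: gn; lia.
by case/(MK_prime hv pi0 vpi).
Qed.
Lemma prim_mul f g : prim f -> prim g -> prim (f * g).
Proof.
move=> pf pg; have [m wf] := prim_wd pf; have [n wg] := prim_wd pg.
case: pf pg => [Of _] [Og _].
by apply: (@wd_prim _ (m + n)); [apply: (pallM hS)|apply: wd_mul].
Qed.
Lemma pall_pidiv f n : pall (dvS O (pi ^+ n)) f <-> exists2 h, pall O h & f = psC (pi ^+ n) * h.
Proof.
split; first exact: pall_dvS.
by case=> h Oh ->; apply: dvS_pall.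
Qed.

Lemma content f : pall O f -> f <> 0 -> exists t h, prim h /\ f = psC (pi ^+ t) * h.
Proof.
move=> Of f0; apply: contrapT => H; apply: f0; apply: psP => i; apply: (dvpi_sep hv pi0 vpi).
suff A n : pall (dvS O (pi ^+ n)) f by move=> n; apply: A.
elim: n => [|n /pall_pidiv[h Oh E]]; first by move=> j; rewrite expr0; apply: dvS1.
have Mh : pall M h by apply: contrapT => nM; apply: H; exists n, h.
have [h' Oh' E'] := pall_dvS Mh.
by apply/pall_pidiv; exists h' => //; rewrite E E' mulrA -rmorphM exprSr.
Qed.
Lemma contentK f N : pall O (psC (pi ^+ N) * f) -> f <> 0 ->
  exists c h, [/\ c != 0, prim h & f = psC c * h].
Proof.
move=> Of f0; have [|t [h [ph E]]] := content Of.
  move=> E; apply: f0; apply: psP => n; have := congr1 (fun h => h n) E.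
  by rewrite psCM => /eqP; rewrite mulf_eq0 (negPf (piX0 pi0 N)) => /eqP.
exists ((pi ^+ N)^-1 * pi ^+ t), h; split=> //.
  by rewrite mulf_neq0 ?invr_neq0 ?piX0.
rewrite rmorphM -mulrA -E mulrA -rmorphM mulVf ?piX0 // rmorph1 mul1r //.
Qed.
Lemma prim_scale c d h h' : prim h -> prim h' -> c != 0 -> d != 0 ->
  psC c * h = psC d * h' -> v c = v d.
Proof.
suff A a b (x y : ps K) : prim x -> prim y -> a != 0 -> b != 0 -> psC a * x = psC b * y -> v a <= v b.
  by move=> ph ph' c0 d0 E; apply/eqP; rewrite eq_le (A c d h h') // (A d c h' h).
move=> [Ox nx] [Oy ny] a0 b0 E; rewrite leNgt; apply/negP => lt; apply: ny => n.
have := congr1 (fun h => h n) E; rewrite !psCM => En.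
have -> : y n = (a / b) * x n by rewrite mulrAC En mulrAC mulfV // mul1r.
apply: (idlMr hI) => //; apply/(MKE hv pi0 vpi).
by rewrite /inM vM ?invr_neq0 // vV //; apply/orP; right; rewrite subr_gt0.
Qed.

(** Modulo pi, h starts with h_m x^m and g with g_w x^w, so h(g) starts with h_m g_w^m x^(m w).
    Composition with [g] therefore detects whether an integral series vanishes modulo pi. *)
Lemma psco_prim g h : pall O g -> g 0%N = 0 -> prim g -> prim h -> prim (psco idfun h g).
Proof.
move=> Og g0 pg ph; have [w [gw nw]] := prim_wd pg; have [m [hm nm]] := prim_wd ph.
case: ph => Oh _; split; first exact: (pall_co hS).
move=> /(_ (m * w)%N) H.
have w0 : (0 < w)%N by case: w nw {gw H} => //; rewrite g0 => /(_ (idl0 hI)).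
have gk k j : (j < k * w)%N -> M ((g ^+ k) j).
  elim: k j => [|k IH] j; rewrite ?mul0n // mulSn exprS => jw.
  apply: (idl_sum hI) => -[i ij] _ /=; case: (ltnP i w) => [/gw|wi].
    by apply: (idlMr hI); apply: (pallX hS).
  by apply: (idlM hI) => //; apply: IH; lia.
have gm : ~ M ((g ^+ m) (m * w)%N).
  elim: (m) => [|k IH]; first by rewrite mul0n expr0; apply: (MK1 hv pi0 vpi).
  rewrite exprS mulSn; have := @wd_mul g (g ^+ k) w (k * w) Og (pallX hS _ Og) (conj gw nw).
  by move=> /(_ (conj (gk k) IH)) [].
have lt : (m < (m * w).+1)%N by rewrite ltnS leq_pmulr.
move: H; rewrite /psco (bigD1 (Ordinal lt)) //= => H.
have : M (h m * (g ^+ m) (m * w)%N).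
  rewrite -[X in M X](addrK (\sum_(i < (m * w).+1 | i != Ordinal lt) idfun (h i) * (g ^+ i) (m * w)%N)).
  apply: (idlB hI) => //; apply: (idl_sum hI) => -[j /= ji] /eqP ne.
  have {}ne : j <> m by move=> E; apply: ne; apply: val_inj.
  case: (ltnP j m) => [/hm|jm].
    by apply: (idlMr hI); apply: (pallX hS).
  apply: (idlM hI) => //; apply: gk; rewrite ltn_pmul2r //; lia.
by case/(MK_prime hv pi0 vpi) => //; apply: (pallX hS).
Qed.

Definition tau d f : ps K := fun n => f (n + d)%N.
Lemma unit_inv f : pall O f -> ~ M (f 0%N) -> exists2 g, pall O g & f * g = 1.
Proof.
move=> Of nM; have [f0 vf] := OK_unit hv pi0 vpi (Of 0%N) nM.
have [g Hg] : exists g, (psC (f 0%N)^-1 * f) * g = 1.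
  by apply: ps_unit; rewrite psCM mulVf.
have OV := OKV hv vf.
exists (psC (f 0%N)^-1 * g); last by rewrite mulrCA mulrA.
apply: (pallM hS); first exact: (pallC hS).
apply: (pall_unit hS _ _ Hg); last by rewrite psCM mulVf.
by apply: (pallM hS) => //; apply: (pallC hS).
Qed.

Hypothesis hc : v_complete v.

(** Write f = l + x^d t with l divisible by pi and t of inverse e. A quotient of the form e Z leaves
    a remainder of degree below d exactly when Z = tau h - tau (l e Z), a contraction since l is
    divisible by pi. *)
Lemma weierstrass_div f d h : pall O f -> wd f d -> pall O h ->
  exists Q r, [/\ pall O Q, pall O r, forall i, (d <= i)%N -> r i = 0 & h = f * Q + r].
Proof.
move=> Of [fd nd] Oh.
have [e Oe fe] : exists2 e, pall O e & tau d f * e = 1.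
  by apply: unit_inv; rewrite /tau // => n; apply: Of.
pose l : ps K := fun i => if (i < d)%N then f i else 0.
have fE : f = l + px ^+ d * tau d f.
  apply: psP => n; rewrite psDE pxXM /l /tau; case: ltnP => dn; last by rewrite subnK // add0r.
  by rewrite addr0.
have Ml : pall M l by move=> i; rewrite /l; case: ifP => [/fd //|_]; apply: (idl0 hI).
have [l' Ol' El] := pall_dvS Ml.
have tauB x y : tau d (x - y) = tau d x - tau d y by [].
have tauO x : pall O x -> pall O (tau d x) by move=> Ox n; apply: Ox.
have [Z OZ EZ] : exists2 Z, pall O Z & tau d h - tau d (l * (e * Z)) = Z.
  apply: (@pi_fixpoint K v hv pi pi0 vpi hc (fun Z => tau d h - tau d (l * (e * Z)))).
    move=> Z OZ; apply: (pallB hS); apply: tauO => //; rewrite El.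
    apply: (pallM hS); last exact: (pallM hS).
    by apply: (pallM hS) => //; apply: (pallC hS); apply: (OKpi vpi).
  move=> n Z Z' OZ OZ' /pall_pidiv[D OD ED].
  have -> : tau d h - tau d (l * (e * Z)) - (tau d h - tau d (l * (e * Z'))) =
     tau d (psC (pi ^+ n.+1) * (- (l' * (e * D)))).
    have -> : tau d h - tau d (l * (e * Z)) - (tau d h - tau d (l * (e * Z'))) =
       tau d (l * (e * Z') - l * (e * Z)) by rewrite tauB; ring.
    have -> : Z' = Z - psC (pi ^+ n) * D by rewrite -ED; ring.
    by congr (tau d _); rewrite El exprS rmorphM; ring.
  move=> i; rewrite /tau psCM; apply: dvS_self; apply: (pallN hS).
  by apply: (pallM hS) => //; apply: (pallM hS).
exists (e * Z), (h - f * (e * Z)); split.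
- exact: (pallM hS).
- by apply: (pallB hS) => //; apply: (pallM hS) => //; apply: (pallM hS).
- move=> i di.
  have : tau d (h - f * (e * Z)) (i - d)%N = 0.
    have -> : tau d (h - f * (e * Z)) = 0; last by [].
    rewrite tauB {1}fE mulrDl.
    have -> : tau d (l * (e * Z) + px ^+ d * tau d f * (e * Z)) = tau d (l * (e * Z)) + Z.
      have -> : px ^+ d * tau d f * (e * Z) = px ^+ d * ((tau d f * e) * Z) by ring.
      rewrite fe mul1r; apply: psP => n; by rewrite psDE /tau psDE pxXM leq_addl addnK.
    by rewrite opprD addrA EZ subrr.
  by rewrite /tau subnK.
by rewrite addrC subrK.
Qed.

(** [Q] may have bounded denominators, so that Euclidean division over K can be compared with
    Weierstrass division over O. If Q is nonzero, its primitive part of Weierstrass degree n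
    produces a nonzero coefficient of f Q in degree d + n. *)
Lemma weierstrass_uniq f d (Q r : ps K) N : pall O f -> wd f d -> pall O (psC (pi ^+ N) * Q) ->
  (forall i, (d <= i)%N -> r i = 0) -> f * Q = r -> Q = 0 /\ r = 0.
Proof.
move=> Of wf OQ rd E; suff Q0 : Q = 0 by split=> //; rewrite -E Q0 mulr0.
have [//|Q0] := pselect (Q = 0); case: (contentK OQ Q0) => c [h [c0 ph Eh]].
have [n wh] := prim_wd ph; have := wd_mul Of (proj1 ph) wf wh; case=> _ [].
have := congr1 (fun g => g (d + n)%N) E; rewrite (rd (d + n)%N) ?leq_addr //.
have -> : f * Q = psC c * (f * h) by rewrite Eh; ring.
rewrite psCM => /eqP; rewrite mulf_eq0 (negPf c0) => /eqP ->; exact: (idl0 hI).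
Qed.

Definition disting (P : {poly K}) d :=
  [/\ P \is monic, size P = d.+1 & forall i, (i < d)%N -> M P`_i].

Lemma distingP P d : disting P d -> pall O (pp P) /\ wd (pp P) d.
Proof.
case=> mP sP MP; have Pd : P`_d = 1 by move: mP; rewrite monicE lead_coefE sP => /eqP.
split.
  move=> i; rewrite /pp; case: (ltngtP i d) => [/MP|di|->]; first exact: (idlW hI).
    by rewrite nth_default ?sP //; apply: (sub0 hS).
  by rewrite Pd; apply: (sub1 hS).
by split=> //; rewrite /pp Pd; apply: (MK1 hv pi0 vpi).
Qed.

Lemma weierstrass_prep f d : pall O f -> wd f d ->
  exists P U, [/\ disting P d, pall O U, ~ M (U 0%N) & f = pp P * U].
Proof.
move=> Of wf; have Ox : pall O (px ^+ d) by apply: (pallX hS); apply: (pall_px hS).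
have [Q [r [OQ Or rd E]]] := weierstrass_div Of wf Ox.
have fQ : f * Q = px ^+ d - r by rewrite E addrK.
have MfQ i : (i < d)%N -> M ((f * Q) i).
  move=> lt; apply: (idl_sum hI) => -[j ji] _ /=; apply: (idlMr hI) => //; apply: (proj1 wf); lia.
have nQ : ~ M (Q 0%N).
  move=> MQ; have : M ((f * Q) d).
    rewrite psME big_ord_recr /= subnn; apply: (idlD hI); last exact: (idlM hI).
    by apply: (idl_sum hI) => -[j ji] _ /=; apply: (idlMr hI) => //; apply: (proj1 wf).
  by rewrite fQ psBE pxX eqxx rd // subr0; apply: (MK1 hv pi0 vpi).
have [U OU QU] := unit_inv OQ nQ.
have rpp := pp_tr rd.
exists ('X^d - tr d r), U.
have sr : (size (tr d r) <= d)%N by apply: size_poly.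
have sP : size ('X^d - tr d r) = d.+1 by rewrite size_polyDl size_polyXn // size_polyN ltnS.
split=> //.
- split=> //; first by rewrite monicE lead_coefDl ?lead_coefXn // size_polyN size_polyXn ltnS.
  move=> i lt; have := MfQ i lt; rewrite fQ psBE pxX coefB coefXn coef_tr lt //.
- move=> MU; have : M (1 : K).
    have <- : (Q * U) 0%N = 1 by rewrite QU.
    by rewrite psM0E; apply: (idlM hI).
  exact: (MK1 hv pi0 vpi).
by rewrite ppB ppXn -rpp -fQ -mulrA QU mulr1.
Qed.

(** For an irreducible distinguished P this expresses, without adjoining roots, that the series
    vanishes at the roots of P. *)
Definition pdv (P : {poly K}) h := exists2 Q, pall O Q & h = pp P * Q.
Lemma pdvM P h g : pall O g -> pdv P h -> pdv P (h * g).
Proof. by move=> Og [Q OQ ->]; exists (Q * g); [apply: (pallM hS)|rewrite mulrA]. Qed.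
Lemma pdvMl P h g : pall O g -> pdv P h -> pdv P (g * h).
Proof. by rewrite mulrC; apply: pdvM. Qed.
Lemma pdvB P h g : pdv P h -> pdv P g -> pdv P (h - g).
Proof. by move=> [Q OQ ->] [Q' OQ' ->]; exists (Q - Q'); [apply: (pallB hS)|rewrite mulrBr]. Qed.
Lemma pdvD P h g : pdv P h -> pdv P g -> pdv P (h + g).
Proof. by move=> [Q OQ ->] [Q' OQ' ->]; exists (Q + Q'); [apply: (pallD hS)|rewrite mulrDr]. Qed.

Lemma pdv_rem P d h : disting P d -> pall O h ->
  exists r : {poly K}, (size r <= d)%N /\ pdv P (h - pp r) .
Proof.
move=> dP Oh; have [OP wP] := distingP dP.
have [Q [r [OQ Or rd E]]] := weierstrass_div OP wP Oh.
exists (tr d r); split; first exact: size_poly.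
by exists Q => //; rewrite -(pp_tr rd) E addrK.
Qed.

Lemma pp_bound (F : {poly K}) : exists N, pall O (psC (pi ^+ N) * pp F).
Proof.
have /choice[N HN] : forall i, exists n, O (pi ^+ n * F`_i) by move=> i; apply: (dvpi_bound hv).
exists (\sum_(i < size F) N i)%N => i; rewrite psCM /pp.
case: (ltnP i (size F)) => [lt|ge]; last by rewrite nth_default // mulr0; apply: (sub0 hS).
rewrite (bigD1 (Ordinal lt)) //= exprD mulrC mulrA mulrC.
by apply: (subM hS); [apply/(subX hS)/(OKpi vpi)|rewrite mulrC; apply: HN].
Qed.

(** Euclidean division by P over K is a Weierstrass division with bounded denominators; uniqueness
    forces its remainder to be 0. *)
Lemma pdv_poly P d (F : {poly K}) : disting P d -> pdv P (pp F) -> P %| F.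
Proof.
move=> dP [Q OQ E]; have [OP wP] := distingP dP.
case: (dP) => mP sP _.
have [N HN] := pp_bound (F %/ P).
have [|||_ r0] := @weierstrass_uniq (pp P) d (Q - pp (F %/ P)) (pp (F %% P)) N OP wP.
- rewrite mulrBr; apply: (pallB hS) => //; apply: (pallM hS) => //; apply: (pallC hS).
  by apply/(subX hS)/(OKpi vpi).
- move=> i di; rewrite /pp nth_default // -ltnS (leq_trans _ (di : (d < i.+1)%N)) // -sP.
  by rewrite ltn_modp monic_neq0.
- rewrite mulrBr -E {1}(divp_eq F P) ppD ppM [pp P * _]mulrC; ring.
by apply/eqP/pp_inj; rewrite r0; apply/esym/psP => n; rewrite /pp coef0.
Qed.

(** Modulo P every integral series is a polynomial remainder, so primality of P in K[X] carries
    over. *)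
Lemma pdv_prime P d h g : disting P d -> irreducible_poly P -> pall O h -> pall O g ->
  pdv P (h * g) -> pdv P h \/ pdv P g.
Proof.
move=> dP iP Oh Og H.
have [r [sr Dr]] := pdv_rem dP Oh; have [s [ss Ds]] := pdv_rem dP Og.
have [OP wP] := distingP dP; case: (dP) => mP sP _.
have Or : pall O (pp r).
  by case: Dr => Q OQ E; have -> : pp r = h - pp P * Q by [rewrite -E; ring];
    apply: (pallB hS) => //; apply: (pallM hS).
have : P %| r * s.
  apply: (pdv_poly dP); rewrite ppM.
  have -> : pp r * pp s = h * g - (h - pp r) * g - pp r * (g - pp s) by ring.
  by apply: pdvB; [apply: pdvB => //; apply: pdvM|apply: pdvMl].
have small (t : {poly K}) (x : ps K) : (size t <= d)%N -> P %| t -> pdv P (x - pp t) -> pdv P x.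
  move=> st Pt; suff -> : t = 0 by rewrite (_ : pp 0 = 0) ?subr0 //; apply: psP => n; rewrite /pp coef0.
  by apply/eqP; apply: contraTT Pt => t0; apply: contraL st => Pt; rewrite -ltnNge -sP dvdp_leq.
have [Pr|nPr] := boolP (P %| r); first by left; apply: small Dr.
rewrite Gauss_dvdpr; first by right; apply: small Ds.
by rewrite irreducible_poly_coprime.
Qed.

(** Gauss's lemma: the contents of the two monic factors have valuation at most 0 and product a
    unit, so both factors are primitive. Their Weierstrass degrees are bounded by their degrees and
    add up to d, which forces equality. *)
Lemma disting_factor P0 d P : disting P0 d -> P \is monic -> P %| P0 ->
  disting P (size P).-1.
Proof.
move=> dP0 mP /dvdpP[C E]; have [OP0 wP0] := distingP dP0; case: (dP0) => mP0 sP0 _.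
have mC : C \is monic by move: mP0; rewrite E monicMr.
have prim_monic (F : {poly K}) : F \is monic -> exists c h, [/\ c != 0, prim h, pp F = psC c * h & v c <= 0].
  move=> mF; have [N HN] := pp_bound F.
  have F0 : pp F <> 0.
    move=> F0; move/monic_neq0/eqP: (mF); apply; apply: pp_inj; rewrite F0.
    by apply/esym/psP => n; rewrite /pp coef0.
  have [c [h [c0 ph Eh]]] := contentK HN F0; exists c, h; split=> //.
  have := congr1 (fun h => h (size F).-1) Eh; rewrite /= psCM /pp.
  move: mF; rewrite monicE lead_coefE => /eqP -> Ec.
  have h0 : h (size F).-1 != 0 by apply: contraTneq (oner_neq0 K) => h0; rewrite Ec h0 mulr0 negbK.
  have := congr1 v Ec; rewrite vM // (v1 hv).
  by case: ph => /(_ (size F).-1); rewrite /OK /inO (negPf h0) /=; lia.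
have [c [h [c0 ph Eh vc]]] := prim_monic P mP.
have [c' [h' [c'0 ph' Eh' vc']]] := prim_monic C mC.
have pP0 := wd_prim OP0 wP0.
have : v (c * c') = v 1.
  apply: (prim_scale (prim_mul ph ph') pP0) => //; rewrite ?mulf_neq0 ?oner_neq0 //.
  by rewrite rmorph1 mul1r E ppM Eh Eh' rmorphM; ring.
rewrite vM // (v1 hv) => vcc.
have vc0 : v c = 0.
  by apply/eqP; rewrite eq_le vc /=; move/eqP: vcc; rewrite addr_eq0 => /eqP ->; rewrite oppr_ge0.
have vc'0 : v c' = 0 by move: vcc; rewrite vc0 add0r.
have intF (F : {poly K}) a x : a != 0 -> v a = 0 -> prim x -> pp F = psC a * x -> prim (pp F).
  move=> a0 va px EF; rewrite EF; apply: prim_mul => //; split.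
    by apply: (pallC hS); apply: (OK0 va).
  by move=> /(_ 0%N); rewrite /psC /=; apply: (unit_notMK hv pi0 vpi).
have pP := intF _ _ _ c0 vc0 ph Eh; have pC := intF _ _ _ c'0 vc'0 ph' Eh'.
have [a wP] := prim_wd pP; have [b wC] := prim_wd pC.
have le (F : {poly K}) n : wd (pp F) n -> (n < size F)%N.
  move=> [_ nM]; rewrite ltnNge; apply/negP => ge; apply: nM.
  by rewrite /pp nth_default //; apply: (idl0 hI).
have := wd_mul (proj1 pP) (proj1 pC) wP wC; rewrite mulrC -ppM -E => -[_ nM].
have la := le _ _ wP; have lb := le _ _ wC.
have dab : (a + b = d)%N.
  have lab : (a + b <= d)%N.
    rewrite leqNgt; apply/negP => lt; apply: nM; rewrite /pp nth_default ?sP0 //; exact: (idl0 hI).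
  apply/eqP; rewrite eqn_leq lab /= leqNgt; apply/negP => lt; apply: nM; exact: (proj1 wP0).
have sE : (size P0 = (size C + size P).-1)%N by rewrite E size_monicM ?monic_neq0.
have aE : a = (size P).-1.
  by move: sE la lb; rewrite sP0; move: (size C) (size P) => x y; lia.
by split=> //; [rewrite (ltn_predK la)|rewrite -aE; case: wP].
Qed.
End Weierstrass.

(** * Critical points of the iterates *)

Lemma irreducible_factor (K : fieldType) (F : {poly K}) : (1 < size F)%N ->
  exists P, [/\ irreducible_poly P, P \is monic & P %| F].
Proof.
have [n] := ubnP (size F); elim: n F => // n IH F; rewrite ltnS => sFn sF.
have F0 : F != 0 by rewrite -size_poly_gt0 ltnW.
have [iF|nF] := pselect (irreducible_poly F).
  exists ((lead_coef F)^-1 *: F).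
  have c0 : (lead_coef F)^-1 != 0 by rewrite invr_eq0 lead_coef_eq0.
  split.
  - split; first by rewrite size_scale.
    case: iF => _ iF q sq; rewrite dvdpZr // => /(iF q sq) qF.
    by rewrite (eqp_trans qF) // eqp_sym eqp_scale.
  - by rewrite monicE lead_coefZ mulVf // lead_coef_eq0.
  by rewrite dvdpZl.
have [q [sq qF nq]] : exists q : {poly K}, [/\ size q != 1%N, q %| F & ~~ (q %= F)].
  apply: contrapT => H; apply: nF; split=> // q sq qF.
  by apply: contrapT => nq; apply: H; exists q; split=> //; apply/negP.
have q0 : q != 0 by apply: contraTneq qF => ->; rewrite dvd0p.
have sqF : (size q < size F)%N.
  rewrite ltn_neqAle dvdp_leq // andbT; apply: contra nq => /eqP E.
  by rewrite -dvdp_size_eqp // E.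
have [|P [iP mP Pq]] := IH q (leq_trans sqF sFn).
  by move: sq; rewrite neq_ltn ltnS leqn0 size_poly_eq0 (negPf q0).
by exists P; split=> //; apply: dvdp_trans qF.
Qed.

Section Adic.
Variables (R : comNzRingType) (S : R -> Prop) (c : R).
Hypotheses (hS : is_sub S) (Sc : S c).
(* Membership in the [j]-th power of the ideal [(c, x)]. *)
Definition adic j (f : ps R) := forall i, dvS S (c ^+ (j - i)) (f i).
Lemma dvSW (m n : nat) x : (m <= n)%N -> dvS S (c ^+ n) x -> dvS S (c ^+ m) x.
Proof.
move=> mn [s Ss ->]; exists (c ^+ (n - m) * s); last by rewrite mulrA -exprD subnKC.
by apply: (subM hS) => //; apply: (subX hS).
Qed.
Lemma adicW j k f : (j <= k)%N -> adic k f -> adic j f.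
Proof. by move=> jk H i; apply: (dvSW _ (H i)); apply: leq_sub2r. Qed.
Lemma adic_pall j f : adic j f -> pall S f.
Proof. by move=> H i; case: (H i) => s Ss ->; apply: (subM hS) => //; apply: (subX hS). Qed.
Lemma adicM j k f h : adic j f -> adic k h -> adic (j + k) (f * h).
Proof.
move=> Hf Hh n; apply: (idl_sum (dvS_idl hS (subX hS _ Sc))) => -[i /= ni] _.
have := dvSM hS (Hf i) (Hh (n - i)%N); rewrite -exprD; apply: dvSW; lia.
Qed.
Lemma adic0 f : pall S f -> adic 0 f.
Proof. by move=> Sf i; rewrite sub0n expr0; apply: dvS1. Qed.
Lemma adicX k j f : adic j f -> adic (k * j) (f ^+ k).
Proof.
move=> Hf; elim: k => [|k IH]; first by rewrite mul0n; apply/adic0/(pall1 hS).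
by rewrite exprS mulSn; apply: adicM.
Qed.
Lemma adic_px : adic 1 px.
Proof.
move=> [|[|i]]; rewrite /px.
- by exists 0; rewrite ?mulr0 //; apply: (sub0 hS).
- by exists 1; rewrite ?mulr1 ?expr0 //; apply: (sub1 hS).
by exists 0; rewrite ?mulr0 //; apply: (sub0 hS).
Qed.
(** The linear term gains a factor c from g'(0), and a term of degree k >= 2 lies in the power k j
    >= j + 1. Hence the iterates of [g] tend to 0 in the (c, x)-adic topology. *)
Lemma adic_psco (K : comNzRingType) (iota : {rmorphism K -> R}) (g : ps K) j f :
  (forall n, S (iota (g n))) -> g 0%N = 0 -> dvS S c (iota (g 1%N)) ->
  (0 < j)%N -> adic j f -> adic j.+1 (psco iota g f).
Proof.
move=> Sg g0 g1 j0 Hf n; apply: (idl_sum (dvS_idl hS (subX hS _ Sc))) => -[[|[|k]] kn] _ /=.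
- by rewrite g0 rmorph0 mul0r; apply: (idl0 (dvS_idl hS (subX hS _ Sc))).
- rewrite expr1; have := dvSM hS g1 (Hf n); rewrite -exprS; apply: dvSW; lia.
apply: (idlM (dvS_idl hS (subX hS _ Sc))) => //.
by have := adicX k.+2 Hf n; apply: dvSW; apply: leq_sub2r; lia.
Qed.
End Adic.

Lemma psd0E (K : comNzRingType) (f : ps K) : psd f 0%N = f 1%N.
Proof. by rewrite /psd mulr1n. Qed.
Section Iterates.
Variables (K : comNzRingType) (S : K -> Prop) (g : ps K).
Hypotheses (hS : is_sub S) (Sg : pall S g) (g0 : g 0%N = 0).
Definition itr (h : ps K) n : ps K := iter n (psco idfun h) px.
Lemma itr0 h n : h 0%N = 0 -> itr h n 0%N = 0.
Proof. by move=> h0; elim: n => //= n IH; rewrite psco0E h0. Qed.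
Lemma itr_pall h n : pall S h -> pall S (itr h n).
Proof. by move=> Sh; elim: n => [|n IH]; [apply: (pall_px hS)|apply: (pall_co hS)]. Qed.
Lemma itrS h n : itr h n.+1 = psco idfun h (itr h n). Proof. by []. Qed.
Lemma psco_idpx (h : ps K) : psco idfun h px = h.
Proof. by rewrite psco_pxr. Qed.
Lemma itrSr h n : h 0%N = 0 -> itr h n.+1 = psco idfun (itr h n) h.
Proof.
move=> h0; elim: n => [|n IH]; first by rewrite /= psco_idpx psco_px.
by rewrite itrS {1}IH pscoA ?itr0.
Qed.
Lemma itrD h m n : h 0%N = 0 -> itr h (m + n) = psco idfun (itr h m) (itr h n).
Proof.
move=> h0; elim: m => [|m IH]; first by rewrite psco_px ?itr0.
by rewrite addSn itrS IH pscoA ?itr0.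
Qed.
Lemma itr_comm h w n : h 0%N = 0 -> w 0%N = 0 -> psco idfun w h = psco idfun h w ->
  psco idfun w (itr h n) = psco idfun (itr h n) w.
Proof.
move=> h0 w0 C; elim: n => [|n IH]; first by rewrite psco_idpx psco_px.
by rewrite itrS pscoA ?itr0 // C -pscoA ?itr0 // IH pscoA ?itr0.
Qed.
Lemma itr1 h n : h 0%N = 0 -> itr h n 1%N = h 1%N ^+ n.
Proof.
move=> h0; elim: n => [|n IH]; first by rewrite expr0.
by rewrite itrS psco1E ?itr0 // IH exprS.
Qed.
End Iterates.

Section DerivativeRoots.
Variables (K : fieldType) (v : K -> int) (pi : K).
Hypotheses (hv : is_valuation v) (pi0 : pi != 0) (vpi : v pi = 1) (hc : v_complete v).
Notation O := (OK v).
Notation M := (dvS O pi).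
Let hS := OK_sub hv.
Let hI := MK_idl hv vpi.
Notation pdv := (pdv v).
Notation disting := (disting v pi).
Notation co := (psco idfun).
Let Opi := OKpi vpi.

Lemma pdv_unitK P h w : pall O w -> ~ M (w 0%N) -> pdv P (h * w) -> pdv P h.
Proof.
move=> Ow nw H; have [z Oz wz] := unit_inv hv pi0 vpi Ow nw.
by rewrite -[h]mulr1 -wz mulrA; apply: (pdvM hv).
Qed.

(** P = x^d + pi l, so modulo P each block x^d is worth a factor pi: the ideal (pi, x)^(d k) lies in
    (P, pi^k). *)
Lemma adic_disting P d k f : (0 < d)%N -> disting P d -> adic O pi (d * k) f ->
  exists Q r, [/\ pall O Q, pall O r & f = pp P * Q + psC (pi ^+ k) * r].
Proof.
move=> d0 dP; have [OP wP] := distingP hv pi0 vpi dP; case: (dP) => mP sP MP.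
elim: k f => [|k IH] f Hf.
  exists 0, f; rewrite mulr0 add0r expr0 rmorph1 mul1r; split=> //; first exact: (pall0 hS).
  exact: (adic_pall hS Opi Hf).
have Hlo : pall (dvS O (pi ^+ k.+1)) (low d f).
  move=> i; rewrite /low; case: ltnP => id; last exact: (idl0 (dvpiX_idl hv vpi _)).
  by apply: (dvSW hS Opi _ (Hf i)); nia.
have [lo Olo Elo] := pall_dvS Hlo.
have [|Q [r [OQ Or E]]] := IH (tau d f).
  by move=> i; apply: (dvSW hS Opi _ (Hf (i + d)%N)); lia.
have [l Ol El] : exists2 l, pall O l & pp P = px ^+ d + psC pi * l.
  have Hl : pall M (pp P - px ^+ d).
    move=> i; rewrite psBE pxX /pp; case: (ltngtP i d) => [/MP|id|->].
    - by rewrite subr0.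
    - by rewrite nth_default ?sP // subr0; apply: (idl0 hI).
    by move: mP; rewrite monicE lead_coefE sP => /eqP ->; rewrite subrr; apply: (idl0 hI).
  by have [l Ol El] := pall_dvS Hl; exists l; rewrite // -El addrC subrK.
exists (tau d f - psC pi * l * Q), (lo - l * r).
have Opil : pall O (psC pi * l) by apply: (pallM hS) => //; apply: (pallC hS).
split.
- apply: (pallB hS); last exact: (pallM hS).
  by move=> i; apply: (adic_pall hS Opi Hf).
- by apply: (pallB hS) => //; apply: (pallM hS).
transitivity (low d f + px ^+ d * tau d f).
  apply: psP => n; rewrite psDE pxXM /low /tau; case: ltnP => dn; last by rewrite subnK // add0r.
  by rewrite addr0.
have -> : px ^+ d = pp P - psC pi * l by rewrite El addrK.
set T := tau d f in E *; rewrite mulrBl {2}E Elo exprSr rmorphM; ring.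
Qed.

Variables (g u : ps K).
Hypotheses (Og : pall O g) (g0 : g 0%N = 0) (g1 : g 1%N != 0) (Mg1 : M (g 1%N)).
Hypotheses (Ou : pall O u) (u0 : u 0%N = 0) (u1 : ~ M (u 1%N))
  (u1n : forall n, (0 < n)%N -> u 1%N ^+ n != 1).
Hypothesis gu : co u g = co g u.

(* If [P] is an irreducible distinguished factor of [g'], every iterate [u^k] permutes the finitely
   many roots of [g'], so [D = u^N - x] is divisible by [P] for some [N > 0]. Commutation makes [P]
   divide [D(g^m) = g^m * (D'(0) + ...)]; for large [m] the second factor is prime to [P]. *)
Lemma derivative_root : ~ pall (dvS O (g 1%N)) (psd g) ->
  exists P d m, [/\ disting P d, irreducible_poly P, (0 < d)%N & (0 < m)%N] /\
    [/\ P`_0 != 0, pdv P (itr g m) & pdv P (psd g)].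
Proof.
move=> nd.
have dg0 : psd g <> 0 by move=> E; have := congr1 (fun h => h 0%N) E; rewrite psd0E; apply/eqP.
have [s [h [ph Eh]]] := content hv pi0 vpi (pall_psd hS Og) dg0.
have Oh := proj1 ph.
have Eg1 : g 1%N = pi ^+ s * h 0%N by have := congr1 (fun h => h 0%N) Eh; rewrite psd0E psCM.
(* A unit h(0) would make g'(0) divide every coefficient of g' = pi^s h, against the assumption. *)
have Mh0 : M (h 0%N).
  apply: contrapT => nM; apply: nd; rewrite Eh.
  have [h0 vh] := OK_unit hv pi0 vpi (Oh 0%N) nM.
  move=> n; rewrite psCM; exists ((h 0%N)^-1 * h n); last by rewrite Eg1 -mulrA mulVKf.
  by apply: (subM hS) => //; apply: (OKV hv).
have h0 : h 0%N != 0 by apply: contraNneq g1 => E; rewrite Eg1 E mulr0.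
have [d wh] := prim_wd hv pi0 vpi ph.
have d0 : (0 < d)%N by case: d wh => // -[_ []].
have [P0 [U [dP0 OU nU EhP]]] := weierstrass_prep hv pi0 vpi hc Oh wh.
have [OP0 wP0] := distingP hv pi0 vpi dP0; case: (dP0) => mP0 sP0 MP0.
have [|P [iP mP PP0]] := @irreducible_factor K P0; first by rewrite sP0.
have dP := disting_factor hv pi0 vpi dP0 mP PP0; set e := (size P).-1 in dP.
have [OP wP] := distingP hv pi0 vpi dP; case: (dP) => _ sP MP.
have e0 : (0 < e)%N by case: iP; rewrite sP.
have pdvP0 : pdv P (pp P0).
  have [C EC] := dvdpP _ _ PP0.
  have mC : C \is monic by move: mP0; rewrite EC monicMr.
  have dC : disting C (size C).-1 by apply: (disting_factor hv pi0 vpi dP0 mC); rewrite EC dvdp_mulr.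
  by exists (pp C); [apply: (proj1 (distingP hv pi0 vpi dC))|rewrite EC ppM mulrC].
have pdvh : pdv P h by rewrite EhP; apply: (pdvM hv).
have pdvdg : pdv P (psd g) by rewrite Eh; apply: (pdvMl hv) => //; apply/(pallC hS)/(subX hS).
have P00 : P`_0 != 0.
  have [C EC] := dvdpP _ _ PP0; apply: contraNneq h0 => E.
  by rewrite EhP psM0E /pp EC coefM big_ord1 E mulr0 mul0r.
exists P, e.
(* Differentiating w(g) = g(w) and cancelling pi^s gives h(w) w' = w'(g) h; since w' is invertible,
   w maps roots of h to roots of h. *)
have perm w : pall O w -> w 0%N = 0 -> ~ M (w 1%N) -> co w g = co g w -> pdv P (co (pp P0) w).
  move=> Ow w0 nw wg.
  have E : co h w * psd w = co (psd w) g * h.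
    have := congr1 (@psd K) wg; rewrite !psd_comp // Eh pscoM // psco_psC => E.
    apply: psP => n; have := congr1 (fun k => k n) E.
    have -> : co (psd w) g * (psC (pi ^+ s) * h) = psC (pi ^+ s) * (co (psd w) g * h) by ring.
    by rewrite -mulrA !psCM => /(mulfI (piX0 pi0 s)).
  have dw : pall O (psd w) by apply: (pall_psd hS).
  have H : pdv P (co h w).
    apply: (pdv_unitK (w := psd w)) => //.
    by rewrite E; apply: (pdvMl hv) => //; apply: (pall_co hS).
  apply: (pdv_unitK (w := co U w)); first exact: (pall_co hS).
    by rewrite psco0E.
  by rewrite -pscoM // -EhP.
have itu k : pall O (itr u k) /\ itr u k 0%N = 0.
  by split; [apply: (itr_pall hS)|apply: itr0].
have itu1 k : ~ M (itr u k 1%N).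
  by rewrite itr1 // => /(MKX hv pi0 vpi (Ou 1%N)).
have itug k : co (itr u k) g = co g (itr u k).
  by apply/esym/itr_comm.
have /choice[r Hr] : forall k, exists r : {poly K}, (size r <= e)%N /\ pdv P (itr u k - pp r).
  by move=> k; apply: (pdv_rem hv pi0 vpi hc dP); case: (itu k).
have Pr k : P %| (P0 \Po r k).
  apply: (pdv_poly hv pi0 vpi dP).
  have -> : pp (P0 \Po r k) = co (pp P0) (itr u k) - (co (pp P0) (itr u k) - pp (P0 \Po r k)) by ring.
  apply: (pdvB hv); first by apply: perm => //; case: (itu k).
  have -> : co (pp P0) (itr u k) = ev idfun (itr u k) P0.
    by apply: psP => n; apply: psco_ev => //; case: (itu k).
  have -> : pp (P0 \Po r k) = ev idfun (pp (r k)) P0.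
    apply: psP => n; rewrite (@evE _ _ _ _ _ _ (size P0)) // /pp coef_comp_poly.
    apply: eq_bigr => i _ /=; congr (_ * _).
    by elim: (nat_of_ord i) n => [|m IH] n; rewrite ?expr0 ?coef1 ?ps1E // !exprS coefM psME;
      apply: eq_bigr => j _; rewrite IH.
  rewrite /ev !horner_poly -sumrB.
  elim/big_ind: _ => [|x y|i _].
  - by exists 0; [apply: (pall0 hS)|rewrite mulr0].
  - exact: (pdvD hv).
  rewrite -mulrBr subrXX; apply: (pdvMl hv); first by apply/(pallC hS)/OP0.
  apply: (pdvM hv); last by case: (Hr k).
  have Or : pall O (pp (r k)).
    case: (Hr k) => _ [Q OQ EQ]; have -> : pp (r k) = itr u k - pp P * Q by rewrite -EQ; ring.
    by apply: (pallB hS); [case: (itu k)|apply: (pallM hS)].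
  apply: (sub_sum (pall_is_sub hS)) => j _; apply: (pallM hS); apply: (pallX hS) => //.
  by case: (itu k).
(* At a root z of P, the values u^k(z) are roots of P0, which has degree d, so d + 1 of them cannot
   be distinct. Two remainders agreeing at z are equal, their degrees being below that of P. *)
have [i [j [ij Eij]]] : exists i j, (i < j)%N /\ r i = r j.
  have [L _ [z rz _]] := irredp_FAdjoin iP.
  have PL (F : {poly K}) : P %| F -> root (map_poly (in_alg L) F) z.
    by move=> /dvdpP[C ->]; rewrite rmorphM rootM rz orbT.
  have LP (F : {poly K}) : root (map_poly (in_alg L) F) z -> P %| F.
    move=> rF; apply: contraT => nPF.
    have : coprimep P F by rewrite irreducible_poly_coprime.
    rewrite -(coprimep_map (in_alg L)) => cp.
    by have /negP[] := coprimep_root cp rz; exact: rF.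
  pose a k := (map_poly (in_alg L) (r k)).[z].
  have [|H] := boolP (uniq [seq a k | k <- iota 0 d.+1]).
    move=> un; have P0L : map_poly (in_alg L) P0 != 0 by rewrite map_poly_eq0 monic_neq0.
    have allr : all (root (map_poly (in_alg L) P0)) [seq a k | k <- iota 0 d.+1].
      apply/allP => x /mapP[k _ ->]; have := PL _ (Pr k).
      by rewrite map_comp_poly /root horner_comp.
    by have := max_poly_roots P0L allr un; rewrite size_map size_iota size_map_poly sP0 ltnn.
  have [i [j [ij Ea]]] : exists i j, (i < j)%N /\ a i = a j.
    apply: contrapT => nex; case/negP: H; rewrite map_inj_uniq ?iota_uniq // => i j Ea.
    case: (ltngtP i j) => // lt; case: nex; first by exists i, j.
    by exists j, i.
  exists i, j; split=> //; apply/eqP; rewrite -subr_eq0.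
  have : P %| r i - r j by apply: LP; rewrite rmorphB /root hornerD hornerN -/(a i) -/(a j) Ea subrr.
  apply: contraTT => nz; apply: contraL (ltnSn e) => Pd; rewrite -leqNgt.
  have := dvdp_leq nz Pd; rewrite sP => le; apply: (leq_trans le).
  by rewrite (leq_trans (size_polyD _ _)) // geq_max size_polyN; case: (Hr i) => -> _; case: (Hr j).
pose N := (j - i)%N; have N0 : (0 < N)%N by rewrite subn_gt0.
pose D := itr u N - px.
have OD : pall O D by apply: (pallB hS); [case: (itu N)|apply: (pall_px hS)].
have D0 : D 0%N = 0 by rewrite /D psBE; case: (itu N) => _ ->; rewrite subr0.
have pD : pdv P D.
  have H : pdv P (itr u j - itr u i).
    have -> : itr u j - itr u i = (itr u j - pp (r j)) - (itr u i - pp (r i)) by rewrite Eij; ring.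
    by apply: (pdvB hv); [case: (Hr j)|case: (Hr i)].
  have [Oi i0] := itu i.
  (* u^j = u^i(x + D), so u^j - u^i is D times a series with constant term u'(0)^i, a unit; hence P
     divides D. *)
  have [w [Ew Ow]] := taylor idfun (itr u i) (erefl : (px : ps K) 0%N = 0) D0.
  have {}Ow := Ow O O hS (fun _ => id) Oi (pall_px hS) OD.
  move: H; have -> : itr u j - itr u i = D * (psd (itr u i) + D * w).
    rewrite -{1}(subnKC (ltnW ij)) -/N itrD // -[itr u N](subrK px) addrC -/D.
    rewrite [D + px]addrC Ew !psco_idpx; ring.
  apply: pdv_unitK.
    apply: (pallD hS); first exact: (pall_psd hS).
    exact: (pallM hS).
  by rewrite psDE psM0E D0 mul0r addr0 psd0E.
have pDm m : pdv P (co D (itr g m)).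
  have [Om m0] : pall O (itr g m) /\ itr g m 0%N = 0 by split; [apply: (itr_pall hS)|apply: itr0].
  have [w [Ew Ow]] := taylor idfun (itr g m) (erefl : (px : ps K) 0%N = 0) D0.
  have {}Ow := Ow O O hS (fun _ => id) Om (pall_px hS) OD.
  have -> : co D (itr g m) = D * (psd (itr g m) + D * w).
    rewrite {1}/D pscoB psco_px // itr_comm //; last by case: (itu N).
    by rewrite -[itr u N](subrK px) -/D [D + px]addrC Ew !psco_idpx; ring.
  apply: (pdvM hv) => //; apply: (pallD hS); first exact: (pall_psd hS).
  exact: (pallM hS).
apply: contrapT => Hno.
have no m : (0 < m)%N -> ~ pdv P (itr g m).
  by move=> m0 H; apply: Hno; exists m.
pose D1 := tau 1 D; pose E1 := tau 1 D1; pose delta := D1 0%N.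
have tauO (x : ps K) : pall O x -> pall O (tau 1 x) by move=> Ox n; apply: Ox.
have tauE (x : ps K) : x = psC (x 0%N) + px * tau 1 x.
  by apply: psP => -[|n]; rewrite psDE pxM /psC /= ?addr0 ?add0r // /tau addn1.
have ED : D = px * D1 by rewrite {1}[D]tauE D0 rmorph0 add0r.
have ED1 : D1 = psC delta + px * E1 by rewrite {1}[D1]tauE.
have OD1 := tauO _ OD; have OE1 := tauO _ OD1.
have delta0 : delta != 0.
  by rewrite /delta /D1 /tau add0n /D psBE itr1 // subr_eq0 u1n.
(* The exponent k makes pi^k divisible by delta pi, and m = e k puts g^m in (P, pi^k). Then D(x) /
   x, taken at g^m, is delta times a unit modulo P, and P cannot divide the nonzero constant
   delta. *)
pose k := `|v delta|.+1; pose m := (e * k)%N.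
have m0 : (0 < m)%N by rewrite muln_gt0 e0.
have [Om m00] : pall O (itr g m) /\ itr g m 0%N = 0 by split; [apply: (itr_pall hS)|apply: itr0].
have adm n : adic O pi n.+1 (itr g n).
  elim: n => [|n IH]; first exact: (adic_px _ hS).
  by rewrite itrS; apply: (adic_psco hS Opi).
have [Q [R [OQ OR EQ]]] := adic_disting e0 dP (adicW hS Opi (leqnSn m) (adm m)).
have := pDm m; rewrite ED pscoM // psco_px // => /(pdv_prime hv pi0 vpi hc dP iP Om).
case; [exact: (pall_co hS)|exact: no|].
rewrite ED1 pscoD psco_psC /= pscoM // psco_px //.
have OEm : pall O (co E1 (itr g m)) by apply: (pall_co hS).
set E2 := co E1 (itr g m) in OEm *.
have [t Ot Et] : dvS O (delta * pi) (pi ^+ k).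
  apply/(dvOP hv); first by rewrite mulf_neq0.
  apply/orP; right; rewrite vM // vpiX // vpi /k; lia.
have -> : psC delta + itr g m * E2 = psC delta * (1 + psC pi * (psC t * R * E2)) + pp P * (Q * E2).
  by rewrite EQ Et !rmorphM; ring.
move=> H.
have H2 : pdv P (psC delta * (1 + psC pi * (psC t * R * E2))).
  rewrite -[X in pdv P X](addrK (pp P * (Q * E2))); apply: (pdvB hv) => //.
  by exists (Q * E2) => //; apply: (pallM hS).
have : pdv P (psC delta).
  apply: (pdv_unitK _ _ H2).
    apply: (pallD hS); first exact: (pall1 hS).
    apply: (pallM hS); first exact: (pallC hS).
    by apply: (pallM hS) => //; apply: (pallM hS) => //; apply: (pallC hS).
  rewrite psDE psCM => M1; apply: (MK1 hv pi0 vpi).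
  rewrite -[X in M X](addrK (pi * (psC t * R * E2) 0%N)); apply: (idlB hI) => //.
  apply: dvS_self; have : pall O (psC t * R * E2); last by apply.
  by apply: (pallM hS) => //; apply: (pallM hS) => //; apply: (pallC hS).
rewrite -ppC => /(pdv_poly hv pi0 vpi dP) /dvdp_leq; rewrite polyC_eq0 => /(_ delta0).
by rewrite sP size_polyC delta0 ltnS leqNgt e0.
Qed.
End DerivativeRoots.

Section EisensteinCase.
Variables (K : fieldType) (v : K -> int) (pi : K).
Hypotheses (hv : is_valuation v) (pi0 : pi != 0) (vpi : v pi = 1) (hc : v_complete v).
Hypothesis char0 : forall n : nat, (n%:R : K) = 0 -> n = 0%N.
Notation O := (OK v).
Notation M := (dvS O pi).
Let hS := OK_sub hv.
Let hI := MK_idl hv vpi.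
Notation pdv := (pdv v).
Notation co := (psco idfun).

Lemma pdv_irreducible_deriv P d : disting v pi P d -> (0 < d)%N -> ~ pdv P (pp P^`()).
Proof.
move=> dP d0 /(pdv_poly hv pi0 vpi dP); case: dP => mP sP _.
have P'0 : P^`() != 0.
  apply/eqP => /(congr1 (fun F : {poly K} => F`_d.-1)); rewrite coef_deriv coef0 prednK //.
  move: mP; rewrite monicE lead_coefE sP => /eqP -> /char0 E; by rewrite E in d0.
move=> /(dvdp_leq P'0); rewrite leqNgt lt_size_deriv //; exact: monic_neq0.
Qed.

Variables (g u : ps K).
Hypotheses (Og : pall O g) (g0 : g 0%N = 0) (g1 : g 1%N = pi).
Hypotheses (Ou : pall O u) (u0 : u 0%N = 0) (u1 : ~ M (u 1%N))
  (u1n : forall n, (0 < n)%N -> u 1%N ^+ n != 1).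
Hypothesis gu : co u g = co g u.

(* Each factor [G(g^m)] of an iterate, where [g = x G], has constant term the
   uniformizer [pi], so it has no multiple root. *)
Lemma uniformizer_deriv : pall (dvS O (g 1%N)) (psd g).
Proof.
apply: contrapT => nd.
have Mg1 : M (g 1%N) by rewrite g1 -[X in M X]mulr1; apply/dvS_self/(sub1 hS).
have g1n : g 1%N != 0 by rewrite g1.
have [P [d [m0 [[dP iP d0 m00] [P00 Pm0 Pdg]]]]] :=
  derivative_root hv pi0 vpi hc Og g0 g1n Mg1 Ou u0 u1 u1n gu nd.
have [OP wP] := distingP hv pi0 vpi dP; case: (dP) => mP sP MP.
have ex : exists m, (0 < m)%N && `[< pdv P (itr g m) >].
  by exists m0; rewrite m00; apply/asboolP.
(* With m + 1 minimal, P divides g^(m+1) = g^m G(g^m) but not g^m: by minimality if m > 0, and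
   because P(0) is nonzero if m = 0. So P divides the factor G(g^m). *)
case: (ex_minnP ex) => -[//|m] /andP[_ /asboolP Pm] min.
have it k : pall O (itr g k) /\ itr g k 0%N = 0 by split; [apply: (itr_pall hS)|apply: itr0].
have [Om m_0] := it m.
pose G := tau 1 g.
have OG : pall O G by move=> n; apply: Og.
have Eg : g = px * G.
  by apply: psP => -[|n]; rewrite pxM ?g0 // /G /tau addn1.
have nPx : ~ pdv P px.
  rewrite -[px]expr1 -ppXn expr1 => /(pdv_poly hv pi0 vpi dP) /dvdpP[C EX].
  have := congr1 (fun F : {poly K} => F`_0) EX; rewrite coefX coefM big_ord1 => /esym/eqP.
  rewrite mulf_eq0 (negPf P00) orbF => /eqP C0.
  have [C' EC] : exists C', C = C' * 'X.
    by have /factor_theorem[C'] : root C 0; [rewrite /root horner_coef0 C0|rewrite subr0 => ->; exists C'].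
  have : size P = 1%N.
    have : 'X * (C' * P - 1) = 0 by rewrite mulrBr mulr1 {2}EX EC; ring.
    move/eqP; rewrite mulf_eq0 polyX_eq0 /= subr_eq0 => /eqP E1.
    apply/eqP; rewrite -dvdp1; apply/dvdpP; exists C'; by rewrite E1.
  by rewrite sP; case: d d0 {dP wP sP MP}.
pose A := co G (itr g m).
have OA : pall O A by apply: (pall_co hS).
have A0 : A 0%N = pi by rewrite /A psco0E /G /tau add0n g1.
have Eit : itr g m.+1 = itr g m * A by rewrite itrS {1}Eg pscoM // psco_px.
have PA : pdv P A.
  move: Pm; rewrite Eit => /(pdv_prime hv pi0 vpi hc dP iP Om OA) [Pm|//].
  have [m_eq0|m_gt0] := posnP m; first by move: Pm; rewrite m_eq0 => /nPx.
  by have := min m; rewrite m_gt0 (asboolT Pm) => /(_ isT); rewrite ltnn.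
(* For m > 0 the chain rule puts the factor g' into the derivative of g^m; for m = 0 one has x G' =
   g' - G, and P does not divide x. *)
have PA' : pdv P (psd A).
  rewrite /A psd_comp //; have [m_eq0|m_gt0] := posnP m.
    have Em : itr g m = px by rewrite m_eq0.
    rewrite Em psd_px mulr1 psco_idpx; move: PA; rewrite /A Em psco_idpx => PG.
    have : pdv P (px * psd G).
      have -> : px * psd G = psd g - G by rewrite Eg psdM psd_px; ring.
      by apply: (pdvB hv).
    by case/(pdv_prime hv pi0 vpi hc dP iP (pall_px hS) (pall_psd hS OG)).
  have [Ok k0] := it m.-1.
  apply: (pdvMl hv); first by apply: (pall_co hS) => //; apply: (pall_psd hS).
  rewrite -(prednK m_gt0) itrSr // psd_comp //; apply: (pdvMl hv) => //.
  by apply: (pall_co hS) => //; apply: (pall_psd hS).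
have [Q OQ EA] := PA.
have : pdv P (pp P^`() * Q).
  have -> : pp P^`() * Q = psd A - pp P * psd Q by rewrite EA psdM psd_pp; ring.
  by apply: (pdvB hv) => //; exists (psd Q) => //; apply: (pall_psd hS).
have OP' : pall O (pp P^`()) by rewrite -psd_pp; apply: (pall_psd hS).
case/(pdv_prime hv pi0 vpi hc dP iP OP' OQ) => [/(pdv_irreducible_deriv dP)|[Q2 OQ2 EQ]]; first by apply.
have MP0 : M P`_0 by apply: MP.
(* P does not divide P', so it divides the cofactor Q as well; thus P^2 divides A, and pi^2 would
   divide A(0) = pi. *)
have : dvS O (pi * pi) pi.
  rewrite -{3}A0 EA EQ !psM0E mulrA /pp; case: (dvSM hS MP0 MP0) => s Os ->.
  by exists (s * Q2 0%N); [apply: (subM hS)|rewrite mulrA].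
move/(dvOP hv) => /(_ (mulf_neq0 pi0 pi0)); rewrite (negPf pi0) vM // vpi /=.
by [].
Qed.
End EisensteinCase.

(** * Extension of the valuation to finite extensions *)

Section Hensel.
Variables (K : fieldType) (v : K -> int) (pi : K).
Hypotheses (hv : is_valuation v) (pi0 : pi != 0) (vpi : v pi = 1) (hc : v_complete v).
Notation O := (OK v).
Notation M := (dvS O pi).
Let hS := OK_sub hv.
Let hI := MK_idl hv vpi.
Notation pdv := (pdv v).

Lemma dvdp_pdv P d (F : {poly K}) : disting v pi P d -> P %| F -> pall O (pp F) -> pdv P (pp F).
Proof.
move=> dP PF OF; have [r [sr Dr]] := pdv_rem hv pi0 vpi hc dP OF.
have [mP sP _] := dP.
have : P %| F - r by apply: (pdv_poly hv pi0 vpi dP); rewrite ppB.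
rewrite (dvdp_subr _ PF) => Pr.
suff r0 : r = 0 by move: Dr; rewrite r0 -ppB subr0.
by apply/eqP; apply: contraTT Pr => r0; apply: contraL sr => Pr; rewrite -ltnNge -sP dvdp_leq.
Qed.

(** The Newton polygon of F has at least two slopes. Scaled to be primitive, F has its constant and
    its leading coefficient in the maximal ideal, so its Weierstrass degree lies strictly between 0
    and its degree, and Weierstrass preparation splits off a distinguished factor. The cofactor has
    a unit constant term, hence no distinguished factor in common with it. *)
Lemma hensel_split (F : {poly K}) : F \is monic -> O F`_0 -> ~ pall O (pp F) ->
  exists F1 F2, [/\ F = F1 * F2, coprimep F1 F2, (1 < size F1)%N & (1 < size F2)%N].
Proof.
move=> mF OF0 nF.
have Fn : F != 0 by apply: monic_neq0.
have ppF0 : pp F <> 0.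
  by move=> E; case/eqP: Fn; apply: pp_inj; rewrite E; apply/esym/psP => n; rewrite /pp coef0.
have [N HN] := pp_bound hv pi0 vpi F.
have [c [h [c0 ph Eh]]] := contentK hv pi0 vpi HN ppF0.
have Oh := proj1 ph.
have vc : v c < 0.
  rewrite ltNge; apply/negP => ge; apply: nF; rewrite Eh; apply: (pallM hS) => //.
  by apply: (pallC hS); rewrite /OK /inO ge orbT.
have McV : M c^-1 by apply/(MKE hv pi0 vpi); rewrite /inM vV // oppr_gt0 vc orbT.
pose H := c^-1 *: F.
have hE : h = pp H.
  apply: psP => n; rewrite /pp coefZ; have := congr1 (fun k => k n) Eh.
  by rewrite psCM /pp => ->; rewrite mulKf.
have [m wh] := prim_wd hv pi0 vpi ph.
set n := (size F).-1.
have sF : size F = n.+1 by rewrite prednK // size_poly_gt0.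
have Fl : F`_n = 1 by move: mF; rewrite monicE lead_coefE => /eqP.
have m0 : (0 < m)%N.
  case: m wh => // -[_ []]; rewrite hE /pp coefZ; exact: (idlMr hI).
have mn : (m < n)%N.
  rewrite ltnNge; apply/negP; rewrite leq_eqVlt => /orP[/eqP E|lt].
    by case: wh => _ []; rewrite -E hE /pp coefZ Fl mulr1.
  by case: wh => _ []; rewrite hE /pp coefZ nth_default ?sF // mulr0; apply: (idl0 hI).
have [P [U [dP OU nU EhP]]] := weierstrass_prep hv pi0 vpi hc Oh wh.
have [OP wP] := distingP hv pi0 vpi dP; have [mP sP MP] := dP.
have pH : pdv P (pp H) by exists U => //; rewrite -hE.
have [C EC] := dvdpP _ _ (pdv_poly hv pi0 vpi dP pH).
have EU : U = pp C.
  have [N' HN'] := pp_bound hv pi0 vpi C.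
  have [|||E _] := @weierstrass_uniq K v pi hv pi0 vpi (pp P) m (U - pp C) 0 N' OP wP.
  - rewrite mulrBr; apply: (pallB hS) => //; apply: (pallM hS) => //; apply: (pallC hS).
    by apply/(subX hS)/(OKpi vpi).
  - by [].
  - by rewrite mulrBr -EhP hE EC ppM mulrC subrr.
  by apply/eqP; rewrite -subr_eq0 E.
have C0 : C != 0 by apply/eqP => E; apply: nU; rewrite EU E /pp coef0; apply: (idl0 hI).
exists P, (c *: C); split.
- by rewrite -scalerAr mulrC -EC /H scalerA mulfV // scale1r.
- rewrite coprimepZr //; apply: contraT => ncop.
  have [|phi [iphi mphi]] := @irreducible_factor K (gcdp P C).
    rewrite ltn_neqAle eq_sym ncop size_poly_gt0 gcdp_eq0 negb_and C0 orbT //.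
  rewrite dvdp_gcd => /andP[phiP phiC].
  have dphi := disting_factor hv pi0 vpi dP mphi phiP.
  have OC : pall O (pp C) by rewrite -EU.
  have [Q OQ EQ] := dvdp_pdv dphi phiC OC.
  case: nU; rewrite EU EQ psM0E; apply: (idlMr hI) => //.
  by case: dphi => _ _; apply; case: iphi => + _; case: (size phi) => [|[]].
- by rewrite sP ltnS.
rewrite size_scale //.
have : size H = n.+1 by rewrite size_scale ?invr_eq0.
rewrite EC size_Mmonic // sP; move: mn; move: (size C) => sC; lia.
Qed.
End Hensel.

Import VectorInternalTheory.
Section ExtendedValuation.
Variables (K : fieldType) (v : K -> int) (pi : K).
Hypotheses (hv : is_valuation v) (pi0 : pi != 0) (vpi : v pi = 1) (hc : v_complete v).
Notation O := (OK v).
Let hS := OK_sub hv.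
Variable L : fieldExtType K.
Notation n := (dim L).

Definition mulmat (x : L) : 'M[K]_n := f2mx (amull x).
Lemma mulmatE x y : v2r y *m mulmat x = v2r (x * y).
Proof.
have : (amull x : 'End(L)) y = x * y by rewrite lfunE.
by rewrite unlock /= => <-; rewrite r2vK.
Qed.
Lemma mulmat_eq (A B : 'M[K]_n) : (forall y : L, v2r y *m A = v2r y *m B) -> A = B.
Proof. by move=> E; apply/row_matrixP => i; rewrite !rowE -[delta_mx _ _]r2vK E. Qed.
Lemma mulmatM x y : mulmat (x * y) = mulmat y *m mulmat x.
Proof. by apply: mulmat_eq => z; rewrite mulmxA !mulmatE mulrA. Qed.
Lemma mulmatD x y : mulmat (x + y) = mulmat x + mulmat y.
Proof. by apply: mulmat_eq => z; rewrite mulmxDr !mulmatE mulrDl linearD. Qed.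
Lemma mulmatZ c x : mulmat (c *: x) = c *: mulmat x.
Proof. by apply: mulmat_eq => z; rewrite -scalemxAr !mulmatE -scalerAl linearZ. Qed.
Lemma mulmat1 : mulmat 1 = 1%:M.
Proof. by apply: mulmat_eq => z; rewrite mulmx1 mulmatE mul1r. Qed.
Lemma mulmat0 : mulmat 0 = 0.
Proof. by apply: mulmat_eq => z; rewrite mulmx0 mulmatE mul0r linear0. Qed.

Definition norm (x : L) : K := \det (mulmat x).
Lemma normM x y : norm (x * y) = norm x * norm y.
Proof. by rewrite /norm mulmatM det_mulmx mulrC. Qed.
Lemma norm1 : norm 1 = 1. Proof. by rewrite /norm mulmat1 det1. Qed.
Lemma norm_neq0 x : x != 0 -> norm x != 0.
Proof.
move=> x0; apply: contraTneq (oner_neq0 K) => N0.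
by rewrite -norm1 -(mulfV x0) normM N0 mul0r eqxx.
Qed.
Lemma norm_scalar c : norm c%:A = c ^+ n.
Proof. by rewrite /norm mulmatZ mulmat1 scalemx1 det_scalar. Qed.

(** A root s of psi is an eigenvalue of multiplication by x, and psi(x) acts on an eigenvector by
    psi(s) = 0. So the norm of psi(x) vanishes, whereas nonzero elements of L have nonzero norm. In
    particular the characteristic polynomial has no two coprime nonconstant factors. *)
Lemma char_poly_factor_root (x : L) (psi : {poly K}) : (1 < size psi)%N ->
  psi %| char_poly (mulmat x) -> root (map_poly (in_alg L) psi) x.
Proof.
move=> spsi psiA; have [phi [iphi mphi phipsi]] := irreducible_factor spsi.
have [E _ [s rs _]] := irredp_FAdjoin iphi.
have rdiv (F G : {poly K}) : F %| G -> root (map_poly (in_alg E) F) s -> root (map_poly (in_alg E) G) s.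
  by move=> /dvdpP[C ->] rF; rewrite rmorphM rootM rF orbT.
have rpsi := rdiv _ _ phipsi rs; have rA := rdiv _ _ psiA rpsi.
pose A y := map_mx (in_alg E) (mulmat y).
have [r rA' r0] : exists2 r : 'rV[E]_n, r *m A x = s *: r & r != 0.
  by apply/eigenvalueP; rewrite eigenvalue_root_char -map_char_poly.
have rAk k : r *m A (x ^+ k) = s ^+ k *: r.
  elim: k => [|k IH]; first by rewrite expr0 /A mulmat1 map_mx1 mulmx1 scale1r.
  rewrite exprSr /A mulmatM map_mxM mulmxA -/(A x) rA' -scalemxAl -/(A _) IH.
  by rewrite scalerA -exprS.
rewrite /root; apply: contraTT isT => y0.
have : map_poly (in_alg E) psi != 0 -> \det (A (map_poly (in_alg L) psi).[x]) = 0.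
  move=> _; apply/eqP/det0P; exists r => //.
  have -> : A (map_poly (in_alg L) psi).[x] = \sum_(i < size psi) (psi`_i)%:A *: A (x ^+ i).
    rewrite horner_coef size_map_poly /A.
    elim/big_rec2: _ => [|i y z _ IH]; first by rewrite mulmat0 map_mx0.
    by rewrite mulmatD map_mxD IH coef_map /= mulr_algl mulmatZ map_mxZ.
  rewrite mulmx_sumr; under eq_bigr => i _ do rewrite -scalemxAr rAk scalerA.
  rewrite -scaler_suml; move: rpsi; rewrite /root horner_coef size_map_poly.
  under eq_bigr => i _ do rewrite coef_map /=.
  by move/eqP => ->; rewrite scale0r.
rewrite map_poly_eq0 -size_poly_gt0 (ltnW spsi) => /(_ isT)/eqP.
by rewrite /A det_map_mx fmorph_eq0 (negPf (norm_neq0 y0)).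
Qed.

(** The heart of the ultrametric inequality. The characteristic polynomial of x is integral, for
    otherwise [hensel_split] would give two coprime factors vanishing at x; its value at -1 is the
    norm of 1 + x up to sign. *)
Lemma norm_integral (x : L) : O (norm x) -> O (norm (1 + x)).
Proof.
move=> ON; set chi := char_poly (mulmat x).
have Ochi : pall O (pp chi).
  apply: contrapT => nO.
  have Ochi0 : O chi`_0.
    rewrite char_poly_det; apply: (subM hS) => //; apply: (subX hS).
    by apply/(subN hS)/(sub1 hS).
  have [F1 [F2 [EF cop s1 s2]]] := hensel_split hv pi0 vpi hc (char_poly_monic _) Ochi0 nO.
  have r1 := @char_poly_factor_root x F1 s1; have r2 := @char_poly_factor_root x F2 s2.
  rewrite EF dvdp_mulr // in r1; rewrite EF dvdp_mull // in r2.
  move: cop; rewrite -(coprimep_map (in_alg L)) => cop.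
  by have /negP[] := coprimep_root cop (r1 isT); exact: (r2 isT).
have -> : norm (1 + x) = (-1) ^+ n * chi.[-1].
  rewrite /chi /char_poly -horner_evalE -det_map_mx.
  have -> : map_mx (horner_eval (-1)) (char_poly_mx (mulmat x)) = - mulmat (1 + x).
    rewrite mulmatD mulmat1; apply/matrixP => i j; rewrite !mxE /horner_eval.
    by rewrite hornerD hornerN hornerC hornerMn hornerX opprD mulNrn.
  by rewrite -scaleN1r detZ mulrA -exprMn mulrNN mulr1 expr1n mul1r.
apply: (subM hS); first by apply/(subX hS)/(subN hS)/(sub1 hS).
rewrite horner_coef; apply: (sub_sum hS) => i _; apply: (subM hS); first exact: Ochi.
by apply/(subX hS)/(subN hS)/(sub1 hS).
Qed.

Hypothesis n_gt0 : (0 < n)%N.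
Definition wnorm (x : L) : rat := (v (norm x))%:~R / n%:R.
Lemma wnorm_valuation : is_valuation wnorm.
Proof.
have n0 : (0 : rat) < n%:R by rewrite ltr0n.
split=> [x y x0 y0|].
  by rewrite /wnorm normM vM ?norm_neq0 // rmorphD mulrDl.
suff A (x y : L) : x != 0 -> y != 0 -> x + y != 0 -> v (norm x) <= v (norm y) -> wnorm x <= wnorm (x + y).
  move=> x y x0 y0 xy0; case/orP: (le_total (v (norm x)) (v (norm y))) => le.
    by rewrite A.
  by rewrite [x + y]addrC A ?orbT // addrC.
move=> x0 y0 xy0 le; rewrite /wnorm ler_pM2r ?invr_gt0 // ler_int.
have E : x + y = x * (1 + y / x) by rewrite mulrDr mulr1 mulrC divfK.
have t0 : 1 + y / x != 0 by apply: contraNneq xy0 => t0; rewrite E t0 mulr0.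
rewrite E normM vM ?norm_neq0 // lerDl.
have : O (norm (y / x)).
  rewrite /OK /inO (negPf (norm_neq0 _)) ?mulf_neq0 ?invr_eq0 //=.
  have := congr1 v (normM (y / x) x); rewrite divfK // vM ?norm_neq0 ?mulf_neq0 ?invr_eq0 //.
  by move=> Ev; rewrite Ev lerDr in le.
by move/norm_integral; rewrite /OK /inO (negPf (norm_neq0 t0)).
Qed.
Lemma wnorm_scalar a : a != 0 -> wnorm a%:A = (v a)%:~R.
Proof.
move=> a0; rewrite /wnorm norm_scalar vX // rmorphMn /= -[X in X / _]mulr_natr mulfK //.
by rewrite pnatr_eq0 -lt0n.
Qed.
End ExtendedValuation.

(** * Passage from the definitions of the statement to the series ring *)

Section Bridge.
Variable K : fieldType.
Lemma pspowE (b : ps K) k : pspow b k = (b ^+ k : ps K).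
Proof. by elim: k => [|k IH]; [|rewrite exprS -IH]. Qed.
Lemma pscompE (a b : ps K) : pscomp a b = psco idfun a b.
Proof. by apply: psP => n; apply: eq_bigr => k _; rewrite pspowE. Qed.
Lemma psiterE (g : ps K) n : psiter g n = itr g n.
Proof. by elim: n => // n IH; rewrite /psiter iterS -/(psiter g n) IH pscompE. Qed.
End Bridge.

(** * From divisibility in O[[x]] to roots in an extension *)

Section SimpleRoots.
Variables (K : fieldType) (v : K -> int) (pi : K).
Hypotheses (hv : is_valuation v) (pi0 : pi != 0) (vpi : v pi = 1) (hc : v_complete v).
Notation O := (OK v).
Notation M := (dvS O pi).
Let hS := OK_sub hv.

Section Sums.
Variables (L : fieldType) (w : L -> rat).
Hypothesis hw : is_valuation w.
Definition wge (c : rat) (x : L) := (x == 0) || (c <= w x).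
Lemma wgeD c x y : wge c x -> wge c y -> wge c (x + y).
Proof.
rewrite /wge; have [->|x0] := eqVneq x 0; first by rewrite add0r.
have [->|y0] := eqVneq y 0; first by rewrite addr0 (negPf x0).
have [//|d0] := eqVneq (x + y) 0.
rewrite /= => vx vy; case: hw => _ /(_ x y x0 y0 d0) /orP[|]; exact: le_trans.
Qed.
Lemma wge_sum c (J : Type) (r : seq J) (P : pred J) (F : J -> L) :
  (forall i, P i -> wge c (F i)) -> wge c (\sum_(i <- r | P i) F i).
Proof. by move=> H; elim/big_ind: _ => //; [rewrite /wge eqxx|apply: wgeD]. Qed.
Lemma w1 : w 1 = 0.
Proof.
case: hw => + _ => /(_ 1 1 (oner_neq0 L) (oner_neq0 L)).
by rewrite mulr1 => /eqP; rewrite -subr_eq0 opprD addNKr oppr_eq0 => /eqP.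
Qed.
Lemma wX x n : x != 0 -> w (x ^+ n) = w x *+ n.
Proof.
move=> x0; elim: n => [|n IH]; first by rewrite w1.
by case: hw => hwM _; rewrite exprS hwM ?expf_neq0 // IH mulrS.
Qed.
End Sums.

Variables (L : fieldExtType K) (w : L -> rat).
Hypotheses (hw : is_valuation w) (hwv : forall a : K, a != 0 -> w a%:A = (v a)%:~R).
Lemma alg_neq0 (a : K) : a != 0 -> a%:A != 0 :> L.
Proof. by move=> a0; rewrite scaler_eq0 (negPf a0) oner_eq0. Qed.
Lemma wge_term (a : K) (z : L) i : z != 0 -> a != 0 ->
  w (a%:A * z ^+ i) = (v a)%:~R + w z *+ i.
Proof.
move=> z0 a0; have [hwM _] := hw.
by rewrite hwM ?alg_neq0 ?expf_neq0 // hwv // wX.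
Qed.

(** If w(z) <= 0, each lower term P_i z^i has valuation at least 1 + d w(z), so their sum cannot
    cancel z^d. *)
Lemma disting_root_pos P d (z : L) : disting v pi P d -> P`_0 != 0 -> (0 < d)%N ->
  root (map_poly (in_alg L) P) z -> z != 0 /\ 0 < w z.
Proof.
move=> [mP sP MP] P0 d0; rewrite /root horner_coef size_map_poly sP.
have Pd : P`_d = 1 by move: mP; rewrite monicE lead_coefE sP => /eqP.
move=> rz; have z0 : z != 0.
  apply: contraNneq P0 => z0; move: rz; rewrite z0 big_ord_recl expr0 mulr1 coef_map /=.
  rewrite big1 ?addr0; first by rewrite scaler_eq0 oner_eq0 orbF.
  by move=> i _; rewrite expr0n mulr0.
split=> //; rewrite ltNge; apply/negP => wz.
move: rz; rewrite big_ord_recr /= coef_map /= Pd scale1r mul1r addr_eq0 => /eqP E.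
have : wge w (1 + w z *+ d) (- z ^+ d).
  rewrite -E; apply: wge_sum => // -[i id] _ /=; rewrite coef_map /= /wge.
  have [->|Pi0] := eqVneq P`_i 0; first by rewrite scale0r mul0r eqxx.
  rewrite wge_term //; apply/orP; right; apply: lerD.
    have /(MKE hv pi0 vpi) := MP i id; rewrite /inM (negPf Pi0) /= => lt.
    by rewrite -[1]/(1%:~R) ler_int; move: lt; case: (v P`_i) => [[|m]|m].
  by rewrite -(subnK (ltnW id)) mulrnDr gerDr mulrn_wle0.
have -> : - z ^+ d = (-1 : K)%:A * z ^+ d by rewrite scaleN1r mulN1r.
rewrite /wge mulf_eq0 expf_eq0 (negPf z0) andbF orbF scaler_eq0 oppr_eq0 !oner_eq0 /=.
rewrite wge_term ?oppr_eq0 ?oner_eq0 // (vN hv) (v1 hv) add0r.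
by rewrite gerDr ler10.
Qed.

(** With h = P Q, the polynomial T = P tr_m(Q) - tr_m(h) is integral and has no term below x^m.
    Since P(z) = 0, the m-th partial sum of h at z is -T(z), of valuation at least m w(z). *)
Lemma pdv_sums_to P d (z : L) h : disting v pi P d -> z != 0 -> 0 < w z ->
  root (map_poly (in_alg L) P) z -> pdv v P h -> ps_sums_to w h z 0.
Proof.
move=> dP z0 wz rz [Q OQ Eh] N; have [OP wP] := distingP hv pi0 vpi dP; have [mP sP _] := dP.
pose m0 := Num.bound (N%:Q / w z).
exists m0 => m lem; rewrite subr0.
have Nm : N%:Q <= w z *+ m.
  rewrite -mulr_natr mulrC -ler_pdivrMr //.
  have : N%:Q / w z < m0%:R by apply: archi_boundP; rewrite divr_ge0 // ltW.
  by move/ltW/le_trans; apply; rewrite ler_nat.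
pose T := P * tr m Q - tr m h.
have sumE : \sum_(i < m) (h i)%:A * z ^+ i = (map_poly (in_alg L) (tr m h)).[z].
  rewrite (@horner_coef_wide _ m) ?size_map_poly ?size_poly //.
  by apply: eq_bigr => i _; rewrite coef_map /= coef_tr ltn_ord.
have -> : \sum_(i < m) (h i)%:A * z ^+ i = - (map_poly (in_alg L) T).[z].
  rewrite sumE /T rmorphB rmorphM hornerD hornerM hornerN.
  by move: rz; rewrite /root => /eqP ->; rewrite mul0r add0r opprK.
have Oh : pall O h by rewrite Eh; apply: (pallM hS).
have T0 i : (i < m)%N -> T`_i = 0.
  move=> im; rewrite coefB coef_tr im; apply/eqP; rewrite subr_eq0; apply/eqP.
  rewrite coefM Eh psME; apply: eq_bigr => -[j ji] _ /=; rewrite coef_tr ifT //; lia.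
have OT i : O T`_i.
  rewrite coefB; apply: (subB hS); last first.
    by rewrite coef_tr; case: ifP => _; [apply: Oh|apply: (sub0 hS)].
  rewrite coefM; apply: (sub_sum hS) => j _; apply: (subM hS); first exact: OP.
  by rewrite coef_tr; case: ifP => _; [apply: OQ|apply: (sub0 hS)].
suff H : wge w N%:Q (map_poly (in_alg L) (- T)).[z].
  by rewrite -hornerN -rmorphN; exact: H.
rewrite horner_coef size_map_poly; apply: wge_sum => // i _.
rewrite coef_map /= coefN /wge.
have [E|Ti0] := eqVneq (- T`_i) 0; first by rewrite E scale0r mul0r eqxx.
rewrite wge_term // (vN hv); apply/orP; right.
have mi : (m <= i)%N by rewrite leqNgt; apply: contra Ti0 => /T0 ->; rewrite oppr0.
have -> : w z *+ i = w z *+ (i - m) + w z *+ m by rewrite -mulrnDr subnK.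
apply: (le_trans Nm); rewrite addrA lerDr addr_ge0 //.
  rewrite -[0]/(0%:~R) ler_int; have := OT i; rewrite /OK /inO.
  by rewrite -[T`_i == 0](oppr_eq0) (negPf Ti0).
by rewrite mulrn_wge0 // ltW.
Qed.
End SimpleRoots.

Section SimpleRootsCase.
Variables (K : fieldType) (v : K -> int) (pi : K).
Hypotheses (hv : is_valuation v) (pi0 : pi != 0) (vpi : v pi = 1) (hc : v_complete v).
Notation O := (OK v).
Notation M := (dvS O pi).
Notation co := (psco idfun).
Let hS := OK_sub hv.
Variables (g u : ps K).
Hypotheses (Og : pall O g) (g0 : g 0%N = 0) (g1 : g 1%N != 0) (Mg1 : M (g 1%N)).
Hypotheses (Ou : pall O u) (u0 : u 0%N = 0) (u1 : ~ M (u 1%N))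
  (u1n : forall n, (0 < n)%N -> u 1%N ^+ n != 1).
Hypothesis gu : co u g = co g u.

(** The class z of X in K[X]/(P), with the valuation given by the norm, is a root of g^m, and a
    multiple one because g' divides the derivative of g^m. *)
Lemma simple_roots_deriv : iterates_simple_roots v g -> pall (dvS O (g 1%N)) (psd g).
Proof.
move=> simple; apply: contrapT => nd.
have [P [d [m [[dP iP d0 m0] [P00 Pm Pdg]]]]] :=
  derivative_root hv pi0 vpi hc Og g0 g1 Mg1 Ou u0 u1 u1n gu nd.
have [L dimL [z rz _]] := irredp_FAdjoin iP.
have [mP sP _] := dP.
have n0 : (0 < dim L)%N by rewrite -dimvf dimL sP.
have hw := wnorm_valuation hv pi0 vpi hc n0.
have hwv := wnorm_scalar hv (L := L) n0.
have [z0 wz] := disting_root_pos hv pi0 vpi hw hwv dP P00 d0 rz.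
have sums h := pdv_sums_to hv pi0 vpi hw hwv dP z0 wz rz (h := h).
have := simple m m0 L _ hw hwv z; rewrite (negPf z0) wz => /(_ isT).
rewrite psiterE => /(_ (sums _ Pm)); apply; apply: sums.
case: m m0 {Pm} => // m _; rewrite itrSr //.
have -> : psderiv (co (itr g m) g) = psd (co (itr g m) g) by [].
rewrite psd_comp //; apply: (pdvMl hv) => //.
by apply: (pall_co hS) => //; apply: (pall_psd hS); apply: (itr_pall hS).
Qed.
End SimpleRootsCase.

(** * The logarithm of the commuting family *)

Section Logarithm.
Variables (K : fieldType) (v : K -> int) (pi : K).
Hypotheses (hv : is_valuation v) (pi0 : pi != 0) (vpi : v pi = 1).
Notation O := (OK v).
Notation M := (dvS O pi).
Notation co := (psco idfun).
Let hS := OK_sub hv.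
Let hI := MK_idl hv vpi.
Variable g : ps K.
Hypotheses (Og : pall O g) (g0 : g 0%N = 0) (g1 : g 1%N != 0).
Hypothesis g1n : forall n, (0 < n)%N -> g 1%N ^+ n != 1.

Lemma log_den n : g 1%N - g 1%N ^+ n.+2 != 0.
Proof.
by rewrite exprS -{1}[g 1%N]mulr1 -mulrBr mulf_neq0 // subr_eq0 eq_sym g1n.
Qed.

(** In degree n >= 2 the coefficient L_n is multiplied by g'(0) - g'(0)^n, nonzero by stability. *)
Lemma log_exists : exists L : ps K, [/\ L 0%N = 0, L 1%N = 1 & co L g = psC (g 1%N) * L].
Proof.
pose Phi (L : nat -> K) n := if n is n'.+2 then
  (\sum_(k < n) L k * (g ^+ k) n) / (g 1%N - g 1%N ^+ n) else (n == 1%N)%:R.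
have [L HL] : exists L : ps K, forall n, L n = Phi L n.
  apply: (@ps_rec K Phi _ 0) => -[|[|n]] //= F G E; congr (_ / _).
  by apply: eq_bigr => -[k kn] _ /=; rewrite E.
have L0 : L 0%N = 0 by rewrite HL.
have L1 : L 1%N = 1 by rewrite HL.
exists L; split=> //; apply: psP => n; rewrite psCM /psco big_ord_recr /= ordpsXn //.
case: n => [|[|n]].
- by rewrite big_ord0 L0 mulr0 mul0r addr0.
- by rewrite big_ord1 L0 mul0r add0r L1 mul1r mulr1 expr1.
have E := HL n.+2; rewrite /= in E.
have -> : \sum_(i < n.+2) L i * (g ^+ i) n.+2 = L n.+2 * (g 1%N - g 1%N ^+ n.+2).
  by rewrite [L n.+2]E divfK ?log_den.
ring.
Qed.

Lemma log_zero (D : ps K) : D 0%N = 0 -> D 1%N = 0 -> co D g = psC (g 1%N) * D -> D = 0.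
Proof.
move=> D0 D1 E; apply: psP; elim/ltn_ind => -[|[|n]] IH //.
have := congr1 (fun h => h n.+2) E; rewrite psCM /psco big_ord_recr /= ordpsXn // big1 ?add0r.
  move/eqP; rewrite mulrC eq_sym -subr_eq0 -mulrBl mulf_eq0 (negPf (log_den n)).
  by move/eqP.
by move=> [k kn] _ /=; rewrite IH // mul0r.
Qed.

Variable L : ps K.
Hypotheses (L0 : L 0%N = 0) (L1 : L 1%N = 1) (Lg : co L g = psC (g 1%N) * L).

Lemma log_eigen (F : ps K) : F 0%N = 0 -> co F g = psC (g 1%N) * F -> F = psC (F 1%N) * L.
Proof.
move=> F0 E; apply/eqP; rewrite -subr_eq0; apply/eqP/log_zero.
- by rewrite psBE psCM L0 F0 mulr0 subr0.
- by rewrite psBE psCM L1 mulr1 subrr.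
rewrite pscoB pscoZ // E Lg /=; ring.
Qed.

Lemma log_comm (w : ps K) : w 0%N = 0 -> co w g = co g w -> co L w = psC (w 1%N) * L.
Proof.
move=> w0 C; rewrite -[w 1%N]mul1r -[in RHS]L1 -(psco1E idfun L w0).
apply: log_eigen; first by rewrite psco0E L0.
rewrite -pscoA // C pscoA // Lg pscoM // psco_psC //.
Qed.

Hypothesis Mg1 : M (g 1%N).
Hypothesis dg : pall (dvS O (g 1%N)) (psd g).
(** Writing g' = g'(0) h with h(0) = 1, differentiation of L(g) = g'(0) L gives L' = h L'(g). In
    degree n > 0 the coefficient of L' occurs with the unit factor 1 - g'(0)^n, and the other terms
    are integral by induction. *)
Lemma log_deriv_integral : pall O (psd L).
Proof.
have [h Oh Eh] := pall_dvS dg.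
have E : psd L = h * co (psd L) g.
  have := congr1 (@psd K) Lg; rewrite psd_comp // psdZ Eh => E.
  apply: psP => n; have := congr1 (fun k => k n) E.
  have -> : co (psd L) g * (psC (g 1%N) * h) = psC (g 1%N) * (h * co (psd L) g) by ring.
  by rewrite !psCM => /(mulfI g1).
elim/ltn_ind => -[|n] IH; first by rewrite psd0E L1; apply: (sub1 hS).
have h0 : h 0%N = 1.
  have := congr1 (fun k => k 0%N) Eh; rewrite psd0E psCM -{1}[g 1%N]mulr1.
  by move/(mulfI g1).
have Olow i : (i < n.+1)%N -> O (co (psd L) g i).
  move=> iN; apply: (sub_sum hS) => -[k kn] _ /=; apply: (subM hS); first by apply: IH; lia.
  exact: (pallX hS).
have Otop : O (psd L n.+1 * (1 - g 1%N ^+ n.+1)).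
  have := congr1 (fun k => k n.+1) E; rewrite psME big_ord_recl h0 mul1r subn0.
  have -> : co (psd L) g n.+1 = \sum_(k < n.+1) psd L k * (g ^+ k) n.+1 + psd L n.+1 * g 1%N ^+ n.+1.
    by rewrite /psco big_ord_recr /= ordpsXn.
  move=> En.
  rewrite mulrBr mulr1 {1}En [X in X - _]addrAC addrK.
  apply: (subD hS); first by apply: (sub_sum hS) => -[k kn] _ /=; apply: (subM hS); [apply: IH|apply: (pallX hS)].
  by apply: (sub_sum hS) => i _; apply: (subM hS) => //; apply: Olow; rewrite lift0; lia.
have Mn : M (g 1%N ^+ n.+1) by rewrite exprS; apply: (idlMr hI) => //; apply: (subX hS).
have [d0 vd] : 1 - g 1%N ^+ n.+1 != 0 /\ v (1 - g 1%N ^+ n.+1) = 0.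
  apply: (OK_unit hv pi0 vpi).
    by apply: (subB hS); [apply: (sub1 hS)|apply: (subX hS)].
  move=> H; apply: (MK1 hv pi0 vpi); rewrite -(subrK (g 1%N ^+ n.+1) 1).
  exact: (idlD hI).
by rewrite -[psd L n.+1](mulfK d0); apply: (subM hS) => //; apply: (OKV hv).
Qed.
End Logarithm.

(** * Stabilizer elements close to the identity modulo pi *)

Section DeepElements.
Variables (p f : nat) (K : fieldType) (v : K -> int) (pi : K).
Hypotheses (hv : is_valuation v) (pi0 : pi != 0) (vpi : v pi = 1) (p_pr : prime p).
Hypothesis hr : residue_card v (p ^ f)%N.
Hypothesis char0 : forall n : nat, (n%:R : K) = 0 -> n = 0%N.
Notation O := (OK v).
Notation M := (dvS O pi).
Notation co := (psco idfun).
Let hS := OK_sub hv.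
Let hI := MK_idl hv vpi.
Let Mp := residue_char hv pi0 vpi p_pr hr.
Variables (g L : ps K) (u : K -> ps K).
Hypotheses (Og : pall O g) (g0 : g 0%N = 0) (Mg1 : M (g 1%N)) (primg : prim v pi g).
Hypothesis dg : pall (dvS O (g 1%N)) (psd g).
Hypotheses (L0 : L 0%N = 0) (L1 : L 1%N = 1).
Hypothesis hu : forall a, a != 0 -> v a = 0 ->
  [/\ pall O (u a), u a 0%N = 0, u a 1%N = a, co (u a) g = co g (u a) & co L (u a) = psC a * L].

(** In degree n, L(u_a) = a L expresses u_a - x through a - 1 and the lower coefficients of u_a,
    multiplied by coefficients of L. Their denominators cost B digits of precision, which the
    induction hypothesis is asked to supply. *)
Lemma stab_continuous n s : exists A, forall a, a != 0 -> v a = 0 ->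
  dvS O (pi ^+ A) (a - 1) -> forall i, (i < n)%N -> dvS O (pi ^+ s) ((u a - px) i).
Proof.
elim: n s => [|n IH] s; first by exists 0%N.
have [B HB] : exists B, forall k, (k < n.+2)%N -> O (pi ^+ B * L k).
  have /choice[b Hb] : forall k, exists m, O (pi ^+ m * L k) by move=> k; apply: (dvpi_bound hv).
  exists (\sum_(k < n.+2) b k)%N => k kn; rewrite (bigD1 (Ordinal kn)) //= exprD mulrAC mulrC.
  by apply: (subM hS); [apply/(subX hS)/(OKpi vpi)|apply: Hb].
have [A HA] := IH (s + B)%N.
exists (maxn A (s + B))%N => a a0 va Da i.
have DA : dvS O (pi ^+ A) (a - 1) by apply: (dvpiW hv pi0 vpi _ Da); apply: leq_maxl.
have Ds : dvS O (pi ^+ (s + B)) (a - 1) by apply: (dvpiW hv pi0 vpi _ Da); apply: leq_maxr.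
have low_i := HA a a0 va DA.
have mulB x k : (k < n.+2)%N -> dvS O (pi ^+ (s + B)) x -> dvS O (pi ^+ s) (L k * x).
  move=> kn [t Ot ->]; exists (pi ^+ B * L k * t); first by apply: (subM hS) => //; apply: HB.
  by rewrite exprD; ring.
rewrite ltnS leq_eqVlt => /orP[/eqP->{i}|/low_i]; last first.
  by apply: (dvpiW hv pi0 vpi); apply: leq_addr.
have [Ou u0 u1 _ ua] := hu a0 va.
have E1 := congr1 (fun h => h n) ua; rewrite psCM pscoL_n //= in E1.
have E2 := pscoL_n idfun L0 L1 n (erefl : (px : ps K) 0%N = 0); rewrite psco_idpx /= in E2.
have -> : (u a - px) n = L n * (a - 1) - \sum_(k < n) L k.+2 * ((u a ^+ k.+2) n - (px ^+ k.+2 : ps K) n).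
  rewrite psBE; under eq_bigr => k _ do rewrite mulrBr.
  rewrite sumrB; set s1 := (\sum_(_ < _) _) in E1 *; set s2 := (\sum_(_ < _) _) in E2 *.
  have -> : L n * (a - 1) = a * L n - L n by ring.
  by rewrite -E1 {1}E2; ring.
apply: (idlB (dvpiX_idl hv vpi _)); first by apply: mulB.
apply: (idl_sum (dvpiX_idl hv vpi _)) => -[k kn] _ /=; apply: mulB; first by lia.
pose w : ps K := fun i => if (i < n)%N then u a i else px i.
have Ew : eqps n (u a) w by move=> j jn; rewrite /w jn.
have w0 : w 0%N = 0 by rewrite /w; case: ifP.
rewrite (pow_low _ u0 w0 Ew).
have I' := pall_is_idl (dvpiX_idl hv vpi (s + B)).
have Ow : pall O w by move=> j; rewrite /w; case: ifP => _; [apply: Ou|apply: (pall_px hS)].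
have Cw : cg (pall (dvS O (pi ^+ (s + B)))) w px.
  move=> j; rewrite psBE /w; case: ltnP => [/low_i //|_].
  by rewrite subrr; apply: (idl0 (dvpiX_idl hv vpi _)).
exact: (cgX (pall_is_sub hS) I' _ Ow (pall_px hS) Cw n).
Qed.

(** If u_a = x + pi^t h with t > 0 and h primitive, commutation with g and Taylor expansion give
    h(g) = h (g' + (u_a - x) w), which vanishes modulo pi; but h(g) is primitive by [psco_prim]. *)
Lemma stab_nontrivial a : a != 0 -> v a = 0 -> a != 1 -> prim v pi (u a - px).
Proof.
move=> a0 va a1; have [Ou u0 u1 ug _] := hu a0 va.
have OD : pall O (u a - px) by apply: (pallB hS) => //; apply: (pall_px hS).
have D0 : u a - px <> 0.
  move=> E; have := congr1 (fun h => h 1%N) E; rewrite psBE u1 => /eqP.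
  by rewrite subr_eq0 (negPf a1).
have [[|t] [h [ph Eh]]] := content hv pi0 vpi OD D0.
  by rewrite Eh expr0 rmorph1 mul1r.
have D00 : (u a - px) 0%N = 0 by rewrite psBE u0 subr0.
have [w [Ew Ow]] := taylor idfun g (erefl : (px : ps K) 0%N = 0) D00.
have {}Ow := Ow O O hS (fun _ => id) Og (pall_px hS) OD.
have : co (u a - px) g = (u a - px) * (psd g + (u a - px) * w).
  rewrite pscoB ug psco_px // -[in LHS](subrK px (u a)) [u a - px + px]addrC Ew !psco_idpx; ring.
rewrite {1 2}Eh pscoZ // => E.
have E' : co h g = h * (psd g + (u a - px) * w).
  apply: psP => n; have := congr1 (fun k => k n) E; rewrite -mulrA !psCM.
  by move/(mulfI (piX0 pi0 t.+1)).
have [_ []] := psco_prim hv pi0 vpi Og g0 primg ph.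
rewrite E'; apply: (idlM (pall_is_idl hI)); first exact: (proj1 ph).
apply: (idlD (pall_is_idl hI)).
  by move=> n; case: (dg n) => s Os ->; apply: (idlMr hI).
rewrite Eh; apply: (idlMr (pall_is_idl hI)) => //.
move=> n; rewrite psCM exprS -mulrA; apply: dvS_self; apply: (subM hS); last exact: (proj1 ph).
exact/(subX hS)/(OKpi vpi).
Qed.

Lemma deep_element N : exists a, [/\ a != 0, v a = 0, M (a - 1) &
  exists2 d, wd v pi (u a - px) d & (N <= d)%N].
Proof.
have [A HA] := stab_continuous N 1.
(* Characteristic 0 ensures that a differs from 1; the extra factor p puts a - 1 in the maximal
   ideal even when A = 0. *)
pose a : K := 1 + p%:R ^+ A.+1.
have Ea : a - 1 = p%:R ^+ A.+1 by rewrite /a addrC addKr.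
have p0 : p%:R != 0 :> K by apply/eqP => /char0 E; move: p_pr; rewrite E.
have Ma : M (a - 1) by rewrite Ea exprS; apply: (idlMr hI) => //; apply/(subX hS)/(sub_nat hS).
have Oa : O a by rewrite -(subrK 1 a); apply: (subD hS); [apply: (idlW hI)|apply: (sub1 hS)].
have [a0 va] : a != 0 /\ v a = 0.
  apply: (OK_unit hv pi0 vpi Oa) => H; apply: (MK1 hv pi0 vpi).
  by rewrite -[1](subKr a); apply: (idlB hI).
have a1 : a != 1 by rewrite -subr_eq0 Ea expf_neq0.
exists a; split=> //.
have [d wD] := prim_wd hv pi0 vpi (stab_nontrivial a0 va a1).
exists d => //; rewrite leqNgt; apply/negP => dN.
case: wD => _ []; have := HA a a0 va _ d dN; rewrite expr1; apply.
rewrite Ea; apply: (dvpiW hv pi0 vpi (leqnSn A)).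
have [s Os Es] := Mp; rewrite Es exprMn; apply: dvS_self; exact: (subX hS).
Qed.
End DeepElements.

Lemma frobD_iter (R : comNzRingType) (S I : R -> Prop) p : is_sub S -> is_idl S I ->
  prime p -> I p%:R -> forall a b i, S a -> S b ->
  cg I ((a + b) ^+ (p ^ i)) (a ^+ (p ^ i) + b ^+ (p ^ i)).
Proof.
move=> hS hI p_pr Ip a b i Sa Sb; elim: i => [|i IH]; first exact: (cg_refl hI).
have SX (x : R) : S x -> S (x ^+ (p ^ i)) by apply: (subX hS).
rewrite expnSr !exprM; apply: (@cg_trans _ _ _ hI ((a ^+ (p ^ i) + b ^+ (p ^ i)) ^+ p)).
  by apply: (cgX hS hI) => //; [apply: SX; apply: (subD hS)|apply: (subD hS); apply: SX].
by apply: (frobD hS hI p_pr Ip); apply: SX.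
Qed.

Lemma pall_nat (R : comNzRingType) (I : R -> Prop) n : I 0 -> I n%:R -> pall I n%:R.
Proof.
move=> I0 In; have -> : n%:R = psC n%:R :> ps R by rewrite rmorph_nat.
by move=> i; rewrite /psC; case: ifP.
Qed.

(** * Invariants of the stabilizer modulo pi *)

Section Invariants.
Variables (p f : nat) (K : fieldType) (v : K -> int) (pi : K).
Hypotheses (hv : is_valuation v) (pi0 : pi != 0) (vpi : v pi = 1) (p_pr : prime p).
Hypothesis hr : residue_card v (p ^ f)%N.
Notation O := (OK v).
Notation M := (dvS O pi).
Notation co := (psco idfun).
Let hS := OK_sub hv.
Let hI := MK_idl hv vpi.
Let hS' := pall_is_sub hS.
Let hI' := pall_is_idl hI.
Let Mp := residue_char hv pi0 vpi p_pr hr.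
Notation "x =~ y" := (cg (pall M) x y) (at level 70).
Variables (L : ps K) (u : K -> ps K).
Hypothesis hu : forall a, a != 0 -> v a = 0 ->
  [/\ pall O (u a), u a 0%N = 0, u a 1%N = a & co L (u a) = psC a * L].
Hypothesis deep : forall N, exists a, [/\ a != 0, v a = 0, M (a - 1) &
  exists2 d, wd v pi (u a - px) d & (N <= d)%N].
Hypotheses (L1 : L 1%N = 1) (OdL : pall O (psd L)).

Lemma unit_mod_p n : coprime p n -> ~ M (n%:R : K).
Proof.
move=> cop Mn; apply: (MK1 hv pi0 vpi).
have n0 : (0 < n)%N.
  by case: n cop {Mn} => //; rewrite /coprime gcdn0 => /eqP E; move: p_pr; rewrite E.
have := cop; rewrite coprime_sym => cop'.
case: (egcdnP p n0) => a b E _.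
have E1 : (a * n)%:R = (b * p + 1)%:R :> K by rewrite E gcdnC (eqP cop).
have -> : 1 = (a * n)%:R - (b * p)%:R :> K by rewrite E1 natrD addrC addKr.
by rewrite !natrM; apply: (idlB hI); apply: (idlM hI) => //; apply: (sub_nat hS).
Qed.

(** If H is not constant modulo pi, then H = h1(x^P) with P = p^s maximal, and h1' is nonzero modulo
    pi. With D = u_a - x, H(u_a) - H becomes D^P (h1'(x^P) + D^P w); once the order of D exceeds
    that of h1', neither factor vanishes modulo pi. *)
Lemma invariant_const (H : ps K) : pall O H ->
  (forall a, a != 0 -> v a = 0 -> M (a - 1) -> co H (u a) =~ H) ->
  forall n, (0 < n)%N -> M (H n).
Proof.
move=> OH inv n n0; apply: contrapT => nM.
pose Q s := `[< exists j, [/\ (0 < j)%N, ~ M (H j) & logn p j = s] >].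
have exQ : exists s, Q s by exists (logn p n); apply/asboolP; exists n.
case: (ex_minnP exQ) => s /asboolP[j [j0 nMj sj]] min.
pose P := (p ^ s)%N; have p0 := prime_gt0 p_pr.
have P0 : (0 < P)%N by rewrite expn_gt0 p0.
have PH i : (0 < i)%N -> ~ M (H i) -> (P %| i)%N.
  by move=> i0 nMi; rewrite pfactor_dvdn // min //; apply/asboolP; exists i.
pose h1 : ps K := fun i => H (P * i)%N.
have Oh1 : pall O h1 by move=> i; apply: OH.
have EH : H =~ psexp P h1.
  move=> i; rewrite psBE /psexp /h1; case: (boolP (P %| i)%N) => Pi.
    by rewrite mulnC divnK // subrr; apply: (idl0 hI).
  rewrite subr0; apply: contrapT => nMi; have /negP nPi := Pi; apply: nPi; apply: PH => //.
  by case: i {nMi} Pi => //; rewrite dvdn0.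
have [d1 wd1] : exists d1, wd v pi (psd h1) d1.
  apply: (prim_wd hv pi0 vpi); split; first exact: (pall_psd hS).
  have /dvdnP[m Em] := PH j j0 nMj.
  have m0 : (0 < m)%N by move: j0; rewrite Em muln_gt0 => /andP[].
  move=> /(_ m.-1); rewrite /psd prednK // -mulr_natr /h1 mulnC -Em.
  case/(MK_prime hv pi0 vpi (OH j) (sub_nat hS m)) => //.
  apply: unit_mod_p; rewrite prime_coprime // ; apply/negP => pm.
  have : (p ^ s.+1 %| j)%N by rewrite Em mulnC expnSr dvdn_mul.
  by rewrite pfactor_dvdn // sj ltnn.
have [a [a0 va Ma [d wD ltd]]] := deep d1.+1.
have [Ou u0 u1 _] := hu a0 va.
pose D := u a - px.
have OD : pall O D by apply: (pallB hS) => //; apply: (pall_px hS).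
have D0 : D 0%N = 0 by rewrite /D psBE u0 subr0.
have wDP k : wd v pi (D ^+ k) (k * d).
  elim: k => [|k IH].
    by rewrite mul0n expr0; split=> //; rewrite ps1E; apply: (MK1 hv pi0 vpi).
  by rewrite exprS mulSn; apply: (wd_mul hv pi0 vpi) => //; apply: (pallX hS).
have Mp' : pall M p%:R by apply: pall_nat => //; apply: (idl0 hI).
have xP0 : (px ^+ P : ps K) 0%N = 0 by rewrite pxX eq_sym gtn_eqF.
have DP0 : (D ^+ P) 0%N = 0 by case: (P) P0 => // k _; rewrite ordpsX0.
have Oy : pall O (px ^+ P) by apply: (pallX hS); apply: (pall_px hS).
have Oz : pall O (D ^+ P) by apply: (pallX hS).
have [w [Ew Ow]] := taylor idfun h1 xP0 DP0.
have {}Ow := Ow O O hS (fun _ => id) Oh1 Oy Oz.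
set B := co (psd h1) (px ^+ P) + D ^+ P * w in Ew.
have OB : pall O B.
  by apply: (pallD hS); [apply: (pall_co hS) => //; apply: (pall_psd hS)|apply: (pallM hS)].
have C : pall M (D ^+ P * B).
  have -> : D ^+ P * B = co h1 (px ^+ P + D ^+ P) - psexp P h1.
    by rewrite Ew psexp_psco // [_ + D ^+ P * B]addrC addrK.
  apply: (@cg_trans _ _ _ hI' (co h1 (u a ^+ P))).
    apply: (cg_cor hS hI) => //.
    - exact: (pallD hS).
    - exact: (pallX hS).
    apply: (cg_sym hI'); rewrite -{1}(subrK px (u a)) [u a - px + px]addrC.
    by apply: (frobD_iter hS' hI' p_pr Mp') => //; apply: (pall_px hS).
  rewrite -psco_psexp //.
  apply: (@cg_trans _ _ _ hI' (co H (u a))).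
    by apply: (cg_col hS hI) => //; apply: (cg_sym hI').
  by apply: (cg_trans hI' (inv a a0 va Ma)).
have pB : prim v pi B.
  split=> // MB; have := MB (P * d1)%N; rewrite /B psDE => H1.
  case: wd1 => _; apply; have -> : psd h1 d1 = psexp P (psd h1) (P * d1)%N by rewrite psexpX.
  rewrite psexp_psco // -[X in M X](addrK ((D ^+ P * w) (P * d1)%N)).
  apply: (idlB hI) => //; apply: (idl_sum hI) => -[k kn] _ /=.
  apply: (idlMr hI); first exact: Ow.
  by case: (wDP P) => + _; apply; apply: (@leq_ltn_trans (P * d1)); rewrite ?ltn_pmul2l.
have [_ []] := prim_mul hv pi0 vpi (wd_prim Oz (wDP P)) pB.
exact: C.
Qed.

(* [H = r(x^P) / (L')^P] is invariant under [u a] for every [a = 1] modulo [pi]; since [u a - x] is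
   nonzero modulo [pi] of arbitrarily large order, [H] is constant. *)
Lemma twisted_invariant i (r : ps K) : pall O r ->
  (forall a, a != 0 -> v a = 0 ->
     co r (fr (p ^ i) (u a)) * psd (fr (p ^ i) (u a)) =~ psC a * r) ->
  (i = 0%N -> r =~ psC (r 0%N) * psd L) /\ ((0 < i < f)%N -> pall M r).
Proof.
move=> Or inv; set P := (p ^ i)%N.
have P0 : (0 < P)%N by rewrite expn_gt0 prime_gt0.
have Mp' : pall M p%:R by apply: pall_nat => //; apply: (idl0 hI).
have w0 : psd L 0%N = 1 by rewrite psd0E.
have [eta weta] := ps_unit w0; set w := psd L in w0 weta.
have Oeta : pall O eta by apply: (pall_unit hS OdL w0).
pose A := psexp P r; pose H := A * eta ^+ P.
have OA : pall O A by apply: psexp_pall => //; apply: (sub0 hS).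
have OH : pall O H by apply: (pallM hS) => //; apply: (pallX hS).
(* The P-th power of u_a' is its twist at x^P, so the hypothesis at x^P reads A(u_a) (u_a')^P = a A
   modulo pi; L'(u_a) u_a' = a L' turns this into a relation for H. *)
have key a : a != 0 -> v a = 0 -> psC (a ^+ P) * co H (u a) =~ psC a * H.
  move=> a0 va; have [Ou u0 u1 ua] := hu a0 va.
  have Oa := OK0 va; have OCa := pallC hS Oa.
  have Odu : pall O (psd (u a)) by apply: (pall_psd hS).
  set ut := fr P (u a) in inv *.
  have Out : pall O ut by apply: (pall_fr hS).
  have ut0 : ut 0%N = 0 by rewrite /ut /fr u0 expr0n gtn_eqF.
  have C1 : co A (u a) * psd (u a) ^+ P =~ psC a * A.
    apply: (@cg_trans _ _ _ hI' (psexp P (co r ut * psd ut))); last first.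
      have := inv a a0 va; rewrite /A -psexpZ /cg -psexpB => H1.
      by apply: psexp_pall => //; apply: (idl0 hI).
    rewrite psexpM // psexp_pscoE // /A psco_psexp //.
    have Oe : pall O (psexp P ut) by apply: psexp_pall => //; apply: (sub0 hS).
    apply: (cgM hI').
    - exact: (pallX hS).
    - exact: (pall_co hS).
    - apply: (cg_cor hS hI) => //; first exact: (pallX hS).
      exact: (frob_ps hS hI p_pr Mp).
    apply: (cg_trans hI' (frob_ps hS hI p_pr Mp i Odu)).
    rewrite /cg -psexpB; apply: psexp_pall; first exact: (idl0 hI).
    by apply: (cg_sym hI'); apply: (frob_psd hS hI p_pr Mp).
  have E2 : co w (u a) * psd (u a) = psC a * w.
    by rewrite /w -psdZ -ua psd_comp.
  have E3 : co w (u a) * co eta (u a) = 1 by rewrite -pscoM // weta psco1.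
  have E4 : psd (u a) = psC a * w * co eta (u a) by rewrite -E2 mulrAC E3 mul1r.
  have -> : psC (a ^+ P) * co H (u a) = co A (u a) * psd (u a) ^+ P * eta ^+ P.
    rewrite E4 !exprMn rmorphXn /H pscoM // pscoX //.
    have : w ^+ P * eta ^+ P = 1 by rewrite -exprMn weta expr1n.
    move=> Ew; rewrite -[LHS]mulr1 -Ew; ring.
  rewrite /H mulrA; apply: (cgM hI') => //; first exact: (pallX hS).
    exact: (pallM hS).
  exact: (cg_refl hI').
have Hconst : forall n, (0 < n)%N -> M (H n).
  apply: invariant_const => // a a0 va Ma; have [Ou u0 u1 ua] := hu a0 va.
  have Oa := OK0 va; have OcH : pall O (co H (u a)) by apply: (pall_co hS).
  have C1 : cg M (a ^+ P) 1.
    by rewrite -(expr1n K P); apply: (cgX hS hI) => //; apply: (sub1 hS).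
  have C2 n : cg M (a ^+ P * co H (u a) n) (a * H n).
    by have := key a a0 va n; rewrite psBE !psCM.
  move=> n; rewrite psBE; change (cg M (co H (u a) n) (H n)).
  apply: (@cg_trans _ _ _ hI (a ^+ P * co H (u a) n)).
    rewrite -{1}[co H (u a) n]mul1r; apply: (cgM hI) => //; first exact: (subX hS).
      exact: (cg_sym hI).
    exact: (cg_refl hI).
  apply: (cg_trans hI (C2 n)); rewrite -{2}[H n]mul1r.
  by apply: (cgM hI); [apply: OH|apply: (sub1 hS)|apply: Ma|apply: (cg_refl hI)].
have EA : A = H * w ^+ P.
  by rewrite /H -mulrA -exprMn [eta * w]mulrC weta expr1n mulr1.
have HC : H =~ psC (H 0%N).
  move=> [|n]; rewrite psBE /psC /=; first by rewrite subrr; apply: (idl0 hI).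
  by rewrite subr0; apply: Hconst.
have Ow : pall O (w ^+ P) by apply: (pallX hS).
have CA : A =~ psC (H 0%N) * w ^+ P.
  rewrite EA; apply: (cgM hI') => //; last exact: (cg_refl hI').
  exact: (pallC hS).
split.
  move=> i0; have P1 : P = 1%N by rewrite /P i0.
  have Ar : A = r by rewrite /A P1 psexp1.
  have H0r : H 0%N = r 0%N.
    by have := congr1 (fun h => h 0%N) EA; rewrite Ar psM0E P1 expr1 w0 mulr1.
  by move: CA; rewrite Ar H0r P1 expr1.
(* The constant term of [key] is (a^P - a) H(0), and a^P - a is a unit for this a. *)
move=> iP; have [a [a0 va na]] := residue_nontrivial_power hv pi0 vpi p_pr hr iP.
have Oa := OK0 va.
have MH0 : M (H 0%N).
  have := key a a0 va 0%N; rewrite psBE !psCM psco0E /= -mulrBl.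
  by case/(MK_prime hv pi0 vpi (subB hS (subX hS _ Oa) Oa) (OH 0%N)).
apply: (psexp_pallK P0); rewrite -/A -[A](subrK (psC (H 0%N) * w ^+ P)).
apply: (idlD hI') => //; apply: (idlMr hI') => //.
by move=> n; rewrite /psC; case: ifP => // _; apply: (idl0 hI).
Qed.
End Invariants.

(** * Composition with the logarithm modulo a uniformizer *)

Section Goodness.
Variables (K : fieldType) (v : K -> int) (pi : K).
Hypotheses (hv : is_valuation v) (pi0 : pi != 0) (vpi : v pi = 1).
Notation O := (OK v).
Notation M := (dvS O pi).
Let hSK := OK_sub hv.
Variables (R : comNzRingType) (iota : {rmorphism K -> R}) (S : R -> Prop).
Hypotheses (hS : is_sub S) (SO : forall a, O a -> S (iota a)).
Notation I := (dvS S (iota pi)).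

Lemma iota_pi : S (iota pi). Proof. by apply/SO/(OKpi vpi). Qed.
Lemma iota_dvS (c x : K) : dvS O c x -> dvS S (iota c) (iota x).
Proof. by move=> [s Os ->]; exists (iota s); [apply: SO|rewrite rmorphM]. Qed.

Lemma good_binomial (L : ps K) :
  (forall m j, (0 < j)%N -> M (L m * 'C(m, j)%:R * pi ^+ j)) -> good iota L S I.
Proof.
move=> bin y z Sy Sz y0 z0 C.
have hI := dvS_idl hS iota_pi.
have [w Sw Ew] := pall_dvS C.
have -> : y = z + psC (iota pi) * w by rewrite -Ew addrC subrK.
move=> n; rewrite psBE /psco -sumrB; apply: (idl_sum hI) => k _.
rewrite -mulrBr -psBE exprDn big_ord_recl subn0 bin0 mulr1n expr0 mulr1 addrC addKr.
rewrite ps_sumE mulr_sumr; apply: (idl_sum hI) => j _.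
have -> : z ^+ (k - lift ord0 j) * (psC (iota pi) * w) ^+ lift ord0 j *+ 'C(k, lift ord0 j)
   = psC (iota ('C(k, lift ord0 j)%:R * pi ^+ lift ord0 j)) * (z ^+ (k - lift ord0 j) * w ^+ lift ord0 j).
  rewrite exprMn !rmorphM !rmorphXn !rmorph_nat -mulr_natr; ring.
rewrite psCM mulrA -rmorphM; apply: (idlMr hI); last by apply: iota_dvS; rewrite mulrA; apply: bin.
by apply: (pallM hS); apply: (pallX hS).
Qed.

Variables (g L : ps K).
Hypotheses (Og : pall O g) (g0 : g 0%N = 0) (g1 : g 1%N = pi) (dg : pall M (psd g)).
Hypotheses (L0 : L 0%N = 0) (L1 : L 1%N = 1) (Lg : psco idfun L g = psC pi * L).
Hypothesis reg : forall x, iota pi * x = 0 -> x = 0.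

Let Y k (y : ps R) := iter k (psco iota g) y.

(** As g' vanishes modulo pi, each application of g gains a factor pi: g^k(y) - g^k(z) is divisible
    by pi^(k+1), while L(g^k(y)) = pi^k L(y). Dividing by pi^k gives the claim once the denominators
    of L are controlled; this holds because the iterates lie in (pi, x)^(k+1). *)
Lemma good_uniformizer : good iota L S I.
Proof.
move=> y z Sy Sz y0 z0 C n.
have hI := dvS_idl hS iota_pi.
have Y0 k (x : ps R) : x 0%N = 0 -> Y k x 0%N = 0.
  by move=> x0; case: k => //= k; rewrite psco0E g0 rmorph0.
have SY k (x : ps R) : pall S x -> pall S (Y k x).
  by move=> Sx; elim: k => // k IH; apply: (pall_comp hS (SK := O)).
have Sg j : S (iota (g j)) by apply: SO.
have LY k (x : ps R) : x 0%N = 0 -> psco iota L (Y k x) = psC (iota pi ^+ k) * psco iota L x.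
  move=> x0; elim: k => [|k IH]; first by rewrite expr0 rmorph1 mul1r.
  rewrite /Y iterS -/(Y k x) pscoA ?Y0 // Lg pscoM ?Y0 // psco_psC IH mulrA -rmorphM.
  by rewrite exprS.
have CY k : exists2 w, pall S w & Y k y = Y k z + psC (iota pi ^+ k.+1) * w.
  elim: k => [|k [w Sw E]].
    by have [w Sw Ew] := pall_dvS C; exists w => //; rewrite expr1 -Ew addrC subrK.
  pose D := psC (iota pi ^+ k.+1) * w.
  have SD : pall S D by apply: (pallM hS) => //; apply/(pallC hS)/(subX hS)/iota_pi.
  have D0 : D 0%N = 0.
    by have := congr1 (fun h => h 0%N) E; rewrite psDE !Y0 // add0r => E0; exact: esym E0.
  have [w' [Ew' Sw']] := taylor iota g (Y0 k z z0) D0.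
  have {}Sw' := Sw' O S hS SO Og (SY k z Sz) SD.
  have [h Oh Eh] : exists2 h, pall S h & psco iota (psd g) (Y k z) = psC (iota pi) * h.
    have [h Oh Eh] := pall_dvS dg; exists (psco iota h (Y k z)).
      by apply: (pall_comp hS (SK := O)) => //; apply: SY.
    by rewrite Eh pscoM ?Y0 // psco_psC.
  exists (w * (h + psC (iota pi ^+ k) * w * w')).
    apply: (pallM hS) => //; apply: (pallD hS) => //; apply: (pallM hS) => //.
    by apply: (pallM hS) => //; apply/(pallC hS)/(subX hS)/iota_pi.
  rewrite /Y !iterS -/(Y k y) -/(Y k z) E -/D Ew' Eh /D !exprS !rmorphM; ring.
have adY k (x : ps R) : pall S x -> x 0%N = 0 -> adic S (iota pi) k.+1 (Y k x).
  move=> Sx x0; elim: k => [|k IH].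
    rewrite /Y /= => -[|i]; first by rewrite x0; apply: (idl0 (dvS_idl hS (subX hS _ iota_pi))).
    by rewrite subSS sub0n expr0; apply: dvS1; apply: Sx.
  rewrite /Y iterS -/(Y k x); apply: (adic_psco hS iota_pi) => //.
  by rewrite g1 -[X in dvS _ _ X]mulr1; apply/dvS_self/(sub1 hS).
have [B HB] : exists B, forall k, (k < n.+1)%N -> O (pi ^+ B * L k).
  have /choice[b Hb] : forall k, exists m, O (pi ^+ m * L k) by move=> k; apply: (dvpi_bound hv).
  exists (\sum_(k < n.+1) b k)%N => k kn; rewrite (bigD1 (Ordinal kn)) //= exprD mulrAC mulrC.
  by apply: (subM hSK); [apply/(subX hSK)/(OKpi vpi)|apply: Hb].
(* An element of (pi, x)^(k+1) has its coefficient n divisible by pi^(k+1-n) = pi^(B+1), which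
   absorbs the denominators of L up to degree n. *)
pose k := (n + B)%N.
have [w Sw Ew] := CY k.
have hIk := dvS_idl hS (subX hS k.+1 iota_pi).
have : dvS S (iota pi ^+ k.+1) ((psco iota L (Y k y) - psco iota L (Y k z)) n).
  rewrite psBE /psco -sumrB; apply: (idl_sum hIk) => -[m mn] _ /=.
  rewrite -mulrBr -psBE.
  case: m mn => [|m] mn; first by rewrite !expr0 subrr mulr0; apply: (idl0 hIk).
  rewrite subrXX {1}Ew [Y k z + _]addrC addrK -mulrA psCM mulrCA; apply: dvS_self.
  rewrite [w * _]mulr_sumr ps_sumE [iota _ * _]mulr_sumr; apply: (sub_sum hS) => -[i im] _ /=.
  case: m mn im => [|m] mn im.
    have -> : i = 0%N by lia.
    by rewrite subnn !expr0 !mulr1 L1 rmorph1 mul1r.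
  have Had : adic S (iota pi) k.+1 (w * (Y k y ^+ (m.+2.-1 - i) * Y k z ^+ i)).
    rewrite -[k.+1]add0n; apply: (adicM hS iota_pi); first exact: adic0.
    have Ay := adicX hS iota_pi (m.+2.-1 - i) (adY k y Sy y0).
    have Az := adicX hS iota_pi i (adY k z Sz z0).
    apply: (adicW hS iota_pi _ (adicM hS iota_pi Ay Az)).
    by rewrite -mulnDl subnK ?leq_pmull.
  have [s Ss ->] := Had n.
  rewrite [iota _ ^+ _](_ : _ = iota (pi ^+ B) * iota pi); last first.
    by rewrite -rmorphM -exprSr rmorphXn; congr (_ ^+ _); rewrite /k; lia.
  have -> : iota (L m.+2) * (iota (pi ^+ B) * iota pi * s) = iota (pi ^+ B * L m.+2) * (iota pi * s).
    by rewrite rmorphM; ring.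
  by apply: (subM hS); [apply/SO/HB|apply: (subM hS) => //; apply: iota_pi].
rewrite !LY // -mulrBr psCM => -[s Ss E]; exists s => //.
have regX j x : iota pi ^+ j * x = 0 -> x = 0.
  by elim: j => [|j IH]; rewrite ?expr0 ?mul1r // exprS -mulrA => /reg.
apply/eqP; rewrite -subr_eq0; apply/eqP/(regX k).
by rewrite mulrBr E exprSr; ring.
Qed.
End Goodness.

Section Limits.
Variables (K : fieldType) (v : K -> int) (pi : K).
Hypotheses (hv : is_valuation v) (pi0 : pi != 0) (vpi : v pi = 1) (hc : v_complete v).
Notation O := (OK v).
Notation M := (dvS O pi).
Let hS := OK_sub hv.
Let hI := MK_idl hv vpi.

(** In each degree j the denominator of L_j is fixed, so the congruence for a single large N passes
    to the limit of the c_N. *)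
Lemma multiple_limit (B L : ps K) (c : nat -> K) :
  (forall n, dvS O (pi ^+ n) (c n.+1 - c n)) ->
  (forall j, exists N0, forall N, (N0 <= N)%N -> M ((B - psC (c N) * L) j)) ->
  exists2 c' : K, cg (pall M) B (psC c' * L) & forall n, dvS O (pi ^+ n) (c' - c n).
Proof.
move=> hcau H; have [c' Hc'] := pi_complete hv pi0 vpi hc hcau.
exists c' => // j; have [N0 HN] := H j; have [b Hb] := dvpi_bound hv pi0 vpi (L j).
pose N := maxn N0 b.+1.
have -> : (B - psC c' * L) j = (B - psC (c N) * L) j - (c' - c N) * L j.
  by rewrite !psBE !psCM; ring.
apply: (idlB hI); first by apply: HN; apply: leq_maxl.
have [s Os ->] := dvpiW hv pi0 vpi (leq_maxr N0 b.+1) (Hc' N).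
have -> : pi ^+ b.+1 * s * L j = pi ^+ b * L j * (pi * s) by rewrite exprS; ring.
by apply: (idlM hI) => //; apply: dvS_self.
Qed.

Variable p : nat.
Hypotheses (p_pr : prime p) (unitp : forall n, coprime p n -> ~ M (n%:R : K)).

(** An index n prime to p is a unit, so the coefficient r_n vanishes modulo pi along with n r_n. *)
Lemma peel_deriv (r : ps K) : pall M (psd r) -> cg (pall M) r (psexp p (fun n => r (p * n)%N)).
Proof.
move=> dr n; rewrite psBE /psexp; case: (boolP (p %| n)%N) => pn.
  by rewrite mulnC divnK // subrr; apply: (idl0 hI).
rewrite subr0; case: n pn => [|n] pn; first by rewrite dvdn0 in pn.
have nM : ~ M (n.+1%:R : K) by apply: unitp; rewrite prime_coprime.
have [n0 vn] := OK_unit hv pi0 vpi (sub_nat hS n.+1) nM.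
rewrite -[r n.+1](mulfK n0) mulr_natr; apply: (idlMr hI); first exact: (OKV hv).
exact: (dr n).
Qed.

Lemma cg_psd (x y : ps K) : cg (pall M) x y -> cg (pall M) (psd x) (psd y).
Proof.
move=> C n; rewrite psBE /psd -mulrnBl -mulr_natr; apply: (idlMr hI); first exact: (sub_nat hS).
exact: (C n.+1).
Qed.

Lemma psd_psexp_p (Q : nat) (h : ps K) : M (p%:R : K) -> pall O h -> pall M (psd (psexp (p * Q) h)).
Proof.
move=> Mp Oh n; rewrite /psd /psexp; case: ifP => [/dvdnP[m ->]|_]; last by rewrite mul0rn; apply: (idl0 hI).
rewrite -mulr_natr; apply: (idlM hI); first exact: Oh.
by rewrite mulnC -mulnA natrM; apply: (idlMr hI) => //; apply: (sub_nat hS).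
Qed.
End Limits.

(** * Descent of eigenvectors to series in x^q *)

Section Peeling.
Variables (p f : nat) (K : fieldType) (v : K -> int) (pi : K).
Hypotheses (hv : is_valuation v) (pi0 : pi != 0) (vpi : v pi = 1) (p_pr : prime p).
Hypothesis hr : residue_card v (p ^ f)%N.
Notation O := (OK v).
Notation M := (dvS O pi).
Notation co := (psco idfun).
Let hS := OK_sub hv.
Let hI := MK_idl hv vpi.
Let hS' := pall_is_sub hS.
Let hI' := pall_is_idl hI.
Let Mp := residue_char hv pi0 vpi p_pr hr.
Let p0 := prime_gt0 p_pr.
Let q0 : (0 < p ^ f)%N. Proof. by rewrite expn_gt0 p0. Qed.
Notation "x =~ y" := (cg (pall M) x y) (at level 70).
Notation goodO B := (good idfun B O M).
Variables (L : ps K) (u : K -> ps K).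
Hypothesis hu : forall a, a != 0 -> v a = 0 ->
  [/\ pall O (u a), u a 0%N = 0, u a 1%N = a & co L (u a) = psC a * L].
Hypothesis deep : forall N, exists a, [/\ a != 0, v a = 0, M (a - 1) &
  exists2 d, wd v pi (u a - px) d & (N <= d)%N].
Hypotheses (L0 : L 0%N = 0) (L1 : L 1%N = 1) (OdL : pall O (psd L)).

Let pd := peel_deriv hv pi0 vpi p_pr (unit_mod_p hv pi0 vpi p_pr hr).

Lemma psexp_cg P (x y : ps K) : x =~ y -> psexp P x =~ psexp P y.
Proof. by move=> C; rewrite /cg -psexpB; apply: psexp_pall => //; apply: (idl0 hI). Qed.
Lemma psexp_cgK P (x y : ps K) : (0 < P)%N -> psexp P x =~ psexp P y -> x =~ y.
Proof. by move=> P0; rewrite /cg -psexpB; apply: psexp_pallK. Qed.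

Lemma good_integral (B : ps K) : pall O B -> goodO B.
Proof. by move=> OB y z Oy Oz _ _; apply: (cg_cor hS hI). Qed.

Lemma good_psexp P (B y : ps K) i : P = (p ^ i)%N -> goodO B -> pall O y -> y 0%N = 0 ->
  co (psexp P B) y =~ psexp P (co B (fr P y)).
Proof.
move=> EP gB Oy y0; have P0 : (0 < P)%N by rewrite EP expn_gt0 p0.
rewrite psco_psexp // psexp_pscoE //; last by rewrite /fr y0 expr0n gtn_eqF.
apply: gB.
- exact: (pallX hS).
- by apply: psexp_pall; [apply: (sub0 hS)|apply: (pall_fr hS)].
- by rewrite EP in P0 *; case: (p ^ i)%N P0 => // k _; rewrite ordpsX0.
- by rewrite /psexp dvdn0 div0n /fr y0 expr0n gtn_eqF.
by rewrite EP; apply: (frob_ps hS hI p_pr Mp).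
Qed.

Lemma fr_q (y : ps K) : pall O y -> fr (p ^ f) y =~ y.
Proof. by move=> Oy n; apply: (residue_fermat hv pi0 vpi p_pr hr). Qed.

(** h^q is the twist of h at x^q, and q-th powers are trivial on the residue field. *)
Lemma eigen_psexp (B h : ps K) c : goodO B -> pall O h -> h 0%N = 0 ->
  co B h =~ psC c * B -> co (psexp (p ^ f) B) h =~ psC c * psexp (p ^ f) B.
Proof.
move=> gB Oh h0 C; apply: (cg_trans hI' (good_psexp (erefl _) gB Oh h0)).
rewrite -psexpZ; apply: psexp_cg; apply: (cg_trans hI' _ C); apply: gB => //.
- exact: (pall_fr hS).
- by rewrite /fr h0 expr0n gtn_eqF.
exact: fr_q.
Qed.

(** The descent is used for integral series when g'(0) is a uniformizer, and for series with
    integral derivative when e = 1. *)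
Variable cls : ps K -> Prop.
Hypothesis cls_d : forall B, cls B -> pall O (psd B).
Hypothesis cls_good : forall B, cls B -> goodO B.
Hypothesis cls_peel : forall B, cls B -> pall M (psd B) -> cls (fun n => B (p * n)%N).

(* The defect [h] is a series in [x^q], so that its derivative vanishes at each of the [f] steps. *)
Lemma peel_step (h : K -> ps K) i (B : ps K) : (i < f)%N -> (forall a, pall O (h a)) -> cls B ->
  (i = 0%N -> M (B 1%N)) ->
  (forall a, a != 0 -> v a = 0 ->
     co B (fr (p ^ i) (u a)) =~ psC a * B + psexp (p ^ (f - i)) (h a)) ->
  let B' := fun n => B (p * n)%N in
  [/\ cls B', B =~ psexp p B' & forall a, a != 0 -> v a = 0 ->
     co B' (fr (p ^ i.+1) (u a)) =~ psC a * B' + psexp (p ^ (f - i.+1)) (h a)].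
Proof.
move=> ltif Oh cB B1 inv B'.
have Pi0 : (0 < p ^ i)%N by rewrite expn_gt0 p0.
have ut0 a : a != 0 -> v a = 0 -> fr (p ^ i) (u a) 0%N = 0.
  by move=> a0 va; have [_ u0 _ _] := hu a0 va; rewrite /fr u0 expr0n gtn_eqF.
have Out a : a != 0 -> v a = 0 -> pall O (fr (p ^ i) (u a)).
  by move=> a0 va; have [Ou _ _ _] := hu a0 va; apply: (pall_fr hS).
have dB : pall M (psd B).
  have [|r0 ri] := twisted_invariant hv pi0 vpi p_pr hr hu deep L1 OdL (i := i) (cls_d cB).
    move=> a a0 va; rewrite -psd_comp ?ut0 // -psdZ.
    apply: (cg_trans hI' (cg_psd hv vpi (inv a a0 va))).
    rewrite psdD /cg [X in X - _]addrC addrK.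
    have -> : (p ^ (f - i) = p * p ^ (f - i.+1))%N by rewrite -expnS -subSn.
    exact: (psd_psexp_p hv vpi).
  case: i ltif B1 r0 ri {inv Pi0 ut0 Out} => [|i] ltif B1 r0 ri; last by apply: ri; rewrite ltif.
  rewrite -[psd B](subrK (psC (psd B 0%N) * psd L)); apply: (idlD hI'); first exact: r0.
  apply: (idlMr hI') => // n; rewrite psd0E /psC; case: ifP => _; [exact: B1|exact: (idl0 hI)].
have C := pd dB.
have cB' := cls_peel cB dB.
split=> // a a0 va; have [Ou u0 u1 _] := hu a0 va.
apply: (psexp_cgK p0).
have -> : psexp p (psC a * B' + psexp (p ^ (f - i.+1)) (h a)) = psC a * psexp p B' + psexp (p ^ (f - i)) (h a).
  have -> : (p ^ (f - i) = p * p ^ (f - i.+1))%N by rewrite -expnS -subSn.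
  rewrite -psexpZ -psexp_psexp ?expn_gt0 ?p0 //.
  by apply: psP => n; rewrite psDE /psexp; case: ifP => _; rewrite ?psDE ?addr0.
have E1 : fr (p ^ i.+1) (u a) = fr p (fr (p ^ i) (u a)) by rewrite fr_fr expnS.
rewrite E1; apply: (cg_trans hI').
  apply: (cg_sym hI'); apply: (good_psexp (esym (expn1 p))).
  - exact: cls_good.
  - exact: Out.
  - exact: ut0.
apply: (cg_trans hI' (cg_sym hI' (cg_col hS hI (Out a a0 va) C))).
apply: (cg_trans hI' (inv a a0 va)); apply: (cgD hI'); last exact: (cg_refl hI').
by rewrite /cg -mulrBr; apply: (idlM hI') => //; apply/(pallC hS)/(OK0 va).
Qed.

(** The condition on B_1 serves the first step, where B' is only known to be a multiple of L' modulo
    pi. For 0 < i < f the twist by p^i-th powers is nontrivial on the residue field, and the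
    derivative vanishes outright. *)
Lemma peel (h : K -> ps K) (B : ps K) : (forall a, pall O (h a)) -> cls B -> M (B 1%N) ->
  (forall a, a != 0 -> v a = 0 -> co B (u a) =~ psC a * B + psexp (p ^ f) (h a)) ->
  exists B', [/\ cls B', B =~ psexp (p ^ f) B' & forall a, a != 0 -> v a = 0 ->
     co B' (fr (p ^ f) (u a)) =~ psC a * B' + h a].
Proof.
move=> Oh cB B1 inv.
have main i : (i <= f)%N -> exists B', [/\ cls B', (i = 0%N -> M (B' 1%N)), B =~ psexp (p ^ i) B' &
    forall a, a != 0 -> v a = 0 ->
     co B' (fr (p ^ i) (u a)) =~ psC a * B' + psexp (p ^ (f - i)) (h a)].
  elim: i => [|i IH] ltif.
    by exists B; rewrite expn0 psexp1 subn0; split=> //; apply: (cg_refl hI').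
  have [B' [cB' B'1 C inv']] := IH (ltnW ltif).
  have [c1 C1 inv1] := peel_step ltif Oh cB' B'1 inv'.
  eexists; split; [exact: c1|by []| |exact: inv1].
  by apply: (cg_trans hI' C); rewrite expnSr -psexp_psexp ?expn_gt0 ?p0 //; apply: psexp_cg.
have [B' [c' _ C inv']] := main f (leqnn f).
by exists B'; split=> // a a0 va; have := inv' a a0 va; rewrite subnn expn0 psexp1.
Qed.
End Peeling.

(** * The case of a uniformizer multiplier *)

Section UniformizerCase.
Variables (p f : nat) (K : fieldType) (v : K -> int) (pi : K).
Hypotheses (hv : is_valuation v) (pi0 : pi != 0) (vpi : v pi = 1) (hc : v_complete v).
Hypothesis (p_pr : prime p).
Hypothesis hr : residue_card v (p ^ f)%N.
Notation O := (OK v).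
Notation M := (dvS O pi).
Notation co := (psco idfun).
Let hS := OK_sub hv.
Let hI := MK_idl hv vpi.
Let hS' := pall_is_sub hS.
Let hI' := pall_is_idl hI.
Let Mp := residue_char hv pi0 vpi p_pr hr.
Let p0 := prime_gt0 p_pr.
Let q := (p ^ f)%N.
Let f0 := residue_f_gt0 hv pi0 vpi p_pr hr.
Let q1 : (1 < q)%N. Proof. by rewrite /q -(exp1n f) ltn_exp2r // prime_gt1. Qed.
Let q0 : (0 < q)%N. Proof. exact: ltnW. Qed.
Let Mpi : M pi. Proof. by rewrite -[X in M X]mulr1; apply/dvS_self/(sub1 hS). Qed.
Notation "x =~ y" := (cg (pall M) x y) (at level 70).
Notation goodO B := (good idfun B O M).
Variables (g L : ps K) (u : K -> ps K).
Hypotheses (Og : pall O g) (g0 : g 0%N = 0) (g1 : g 1%N = pi) (dg : pall M (psd g)).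
Hypotheses (L0 : L 0%N = 0) (L1 : L 1%N = 1) (Lg : co L g = psC pi * L).
Hypothesis hu : forall a, a != 0 -> v a = 0 ->
  [/\ pall O (u a), u a 0%N = 0, u a 1%N = a & co L (u a) = psC a * L].
Hypothesis ug : forall a, a != 0 -> v a = 0 -> co (u a) g = co g (u a).
Hypothesis deep : forall N, exists a, [/\ a != 0, v a = 0, M (a - 1) &
  exists2 d, wd v pi (u a - px) d & (N <= d)%N].
Hypothesis OdL : pall O (psd L).
Hypothesis wg : wd v pi g q.

Let pd := peel_deriv hv pi0 vpi p_pr (unit_mod_p hv pi0 vpi p_pr hr).

(** The same descent, for a conjugation relation instead of a linear one: L(u_a(G)) = a L(G) makes
    the derivative of L(G) a twisted eigenvector, so it vanishes modulo pi, and G' with it because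
    L' is invertible. The coefficient of x^q in g, a unit, ends up as G'(0). *)
Lemma uniformizer_frobenius : exists G : ps K,
  [/\ pall O G, G 0%N = 0, exists2 c, O c & G 1%N * c = 1 & g =~ psexp q G].
Proof.
have main i : (i <= f)%N -> exists G : ps K, [/\ pall O G, G 0%N = 0, i = 0%N -> M (G 1%N),
    g =~ psexp (p ^ i) G & forall a, a != 0 -> v a = 0 -> co (u a) G =~ co G (fr (p ^ i) (u a))].
  elim: i => [|i IH] ltif.
    exists g; split=> //; first by rewrite g1.
      by rewrite psexp1; apply: (cg_refl hI').
    by move=> a a0 va; rewrite ug //; apply: (cg_refl hI').
  have [G [OG G0 G1 C inv]] := IH (ltnW ltif).
  have ut0 a : a != 0 -> v a = 0 -> fr (p ^ i) (u a) 0%N = 0.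
    by move=> a0 va; have [_ u0 _ _] := hu a0 va; rewrite /fr u0 expr0n gtn_eqF // expn_gt0 p0.
  have Out a : a != 0 -> v a = 0 -> pall O (fr (p ^ i) (u a)).
    by move=> a0 va; have [Ou _ _ _] := hu a0 va; apply: (pall_fr hS).
  have [eta weta] := ps_unit (etrans (psd0E L) L1).
  have dG : pall M (psd G).
    pose r := co (psd L) G * psd G.
    have Or : pall O r by apply: (pallM hS); [apply: (pall_co hS)|apply: (pall_psd hS)].
    have [|r0 ri] := twisted_invariant hv pi0 vpi p_pr hr hu deep L1 OdL (i := i) Or.
      move=> a a0 va; have [Ou u0 _ ua] := hu a0 va.
      rewrite /r pscoM ?ut0 // -pscoA ?ut0 // -mulrA -psd_comp ?ut0 //.
      apply: (@cg_trans _ _ _ hI' (co (psd L) (co (u a) G) * psd (co (u a) G))).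
        apply: (cg_sym hI'); apply: (cgM hI').
        - by apply: (pall_psd hS); apply: (pall_co hS).
        - by do 2 apply: (pall_co hS) => //; apply: Out.
        - by apply: (cg_cor hS hI) => //; [apply: (pall_co hS)|apply: (pall_co hS) => //; apply: Out|apply: inv].
        - exact: (cg_psd hv vpi (inv a a0 va)).
      rewrite -psd_comp ?psco0E ?u0 // pscoA // ua pscoZ // psdZ psd_comp //.
      exact: (cg_refl hI').
    have Mr : pall M r.
      case: i ltif G1 r0 ri {IH C inv ut0 Out} => [|i] ltif G1 r0 ri; last by apply: ri; rewrite ltif.
      rewrite -[r](subrK (psC (r 0%N) * psd L)); apply: (idlD hI'); first exact: r0.
      apply: (idlMr hI') => // n; rewrite /psC; case: ifP => _; last exact: (idl0 hI).
      by rewrite /r psM0E psd0E; apply: (idlM hI); [apply: (pall_co hS)|apply: G1].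
    have -> : psd G = co eta G * r.
      by rewrite /r mulrA -pscoM // mulrC [eta * _]mulrC weta psco1 mulr1.
    apply: (idlM hI') => //; apply: (pall_co hS) => //.
    by apply: (pall_unit hS OdL (etrans (psd0E L) L1)).
  have CG := pd dG; set G' := (fun n => _) in CG.
  have OG' : pall O G' by move=> n; apply: OG.
  have G'0 : G' 0%N = 0 by rewrite /G' muln0.
  exists G'; split=> //.
    by apply: (cg_trans hI' C); rewrite expnSr -psexp_psexp ?expn_gt0 ?p0 //; apply: psexp_cg.
  move=> a a0 va; have [Ou u0 _ _] := hu a0 va.
  apply: (psexp_cgK p0); rewrite psexp_pscoE //.
  apply: (@cg_trans _ _ _ hI' (co (u a) G)).
    apply: (cg_cor hS hI) => //; last exact: (cg_sym hI').
    by apply: psexp_pall => //; apply: (sub0 hS).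
  apply: (cg_trans hI' (inv a a0 va)).
  apply: (cg_trans hI' (cg_col hS hI (Out a a0 va) CG)).
  have -> : fr (p ^ i.+1) (u a) = fr p (fr (p ^ i) (u a)) by rewrite fr_fr expnS.
  apply: (good_psexp hv pi0 vpi p_pr hr (esym (expn1 p))); [|exact: Out|exact: ut0].
  exact: (good_integral hv vpi).
have [G [OG G0 _ C _]] := main f (leqnn f); exists G; split=> //.
have [Gn vG] : G 1%N != 0 /\ v (G 1%N) = 0.
  apply: (OK_unit hv pi0 vpi) => // MG; case: wg => _; apply.
  rewrite -[g q](subrK (psexp q G q)); apply: (idlD hI); first exact: C.
  by rewrite /psexp dvdnn divnn q0.
by exists (G 1%N)^-1; [apply: (OKV hv)|rewrite mulfV].
Qed.

Definition eigen_mod (B : ps K) := [/\ B 0%N = 0, B 1%N = 0, co B g =~ psC pi * B &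
  forall a, a != 0 -> v a = 0 -> co B (u a) =~ psC a * B].

Lemma one_sub_unit x : M x -> exists2 c, O c & (1 - x) * c = 1.
Proof.
move=> Mx; have [n0 v0] : 1 - x != 0 /\ v (1 - x) = 0.
  apply: (OK_unit hv pi0 vpi).
    by apply: (subB hS); [apply: (sub1 hS)|apply: (idlW hI)].
  by move=> H; apply: (MK1 hv pi0 vpi); rewrite -(subrK x 1); apply: (idlD hI).
by exists (1 - x)^-1; [apply: (OKV hv)|rewrite mulfV].
Qed.

(** In degree j >= 2 the relation B(g) = pi B multiplies B_j by pi (1 - pi^(j-1)), so each degree
    costs at most one factor pi. The bound makes the remainders of [eigen_multiple] tend to 0 in
    each degree. *)
Lemma eigen_bound B : eigen_mod B -> forall j, O (pi ^+ j * B j).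
Proof.
move=> [B0 B1 Bg _]; elim/ltn_ind => -[|[|j]] IH; rewrite ?B0 ?B1 ?mulr0; try exact: (sub0 hS).
have [c Oc Ec] : exists2 c, O c & (1 - pi ^+ j.+1) * c = 1.
  by apply: one_sub_unit; rewrite exprS; apply: (idlMr hI) => //; apply/(subX hS)/(OKpi vpi).
have := Bg j.+2; rewrite psBE psCM /psco big_ord_recr /= ordpsXn // g1 => H.
have -> : pi ^+ j.+2 * B j.+2 = pi ^+ j.+1 * (pi * B j.+2 * (1 - pi ^+ j.+1)) * c.
  have -> : pi ^+ j.+1 * (pi * B j.+2 * (1 - pi ^+ j.+1)) * c = pi ^+ j.+1 * pi * B j.+2 * ((1 - pi ^+ j.+1) * c).
    by ring.
  by rewrite Ec mulr1 -exprSr.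
apply: (subM hS) => //.
have -> : pi * B j.+2 * (1 - pi ^+ j.+1) = pi * B j.+2 - B j.+2 * pi ^+ j.+2 by rewrite [pi ^+ j.+2]exprS; ring.
set s := \sum_(_ < _) _ in H.
have -> : pi * B j.+2 - B j.+2 * pi ^+ j.+2 = s - (s + B j.+2 * pi ^+ j.+2 - pi * B j.+2) by ring.
rewrite mulrBr; apply: (subB hS).
  rewrite mulr_sumr; apply: (sub_sum hS) => -[k kj] _ /=; rewrite mulrA; apply: (subM hS); last exact: (pallX hS).
  have -> : pi ^+ j.+1 * B k = pi ^+ (j.+1 - k) * (pi ^+ k * B k) by rewrite mulrA -exprD subnK.
  by apply: (subM hS); [apply/(subX hS)/(OKpi vpi)|apply: IH].
by apply: (subM hS); [apply/(subX hS)/(OKpi vpi)|apply: (idlW hI)].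
Qed.

(* Division of [B(g) - pi B] by [pi] gives [th], which is a series in [x^q] modulo [pi], hence [xi(g)]. *)
Lemma eigen_step B : eigen_mod B -> exists xi B2 : ps K,
  [/\ pall O xi, eigen_mod B2 & B = psC pi * xi - psC (pi * xi 1%N) * L + psC pi * B2].
Proof.
move=> [B0 B1 Bg Bu].
have [G [OG G0 [c Oc Gc] CG]] := uniformizer_frobenius.
have OpG : pall O (psexp q G) by apply: psexp_pall => //; apply: (sub0 hS).
have [th Oth Eth] := pall_dvS Bg.
have /choice[ka Hka] : forall a, exists k : ps K, pall O k /\
    (a != 0 -> v a = 0 -> co B (u a) - psC a * B = psC pi * k).
  move=> a; have [a0|a0] := eqVneq a 0; first by exists 0; split=> //; apply: (pall0 hS).
  have [va|va] := eqVneq (v a) 0; last first.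
    by exists 0; split; [apply: (pall0 hS)|move=> _ E; rewrite E eqxx in va].
  by have [k Ok Ek] := pall_dvS (Bu a a0 va); exists k.
have Oka a : pall O (ka a) by case: (Hka a).
have cancel (x y : ps K) : psC pi * x = psC pi * y -> x = y.
  by move=> E; apply: psP => n; have := congr1 (fun h => h n) E; rewrite !psCM => /(mulfI pi0).
(* Both defects arise from B(g(u_a)) = B(u_a(g)), expanded in either order. *)
have thu a : a != 0 -> v a = 0 -> co th (u a) - psC a * th = co (ka a) g - psC pi * ka a.
  move=> a0 va; have [Ou u0 _ ua] := hu a0 va; apply: cancel.
  have Ek : co B (u a) - psC a * B = psC pi * ka a by case: (Hka a) => _; apply.
  have E1 := congr1 (fun x => co x (u a)) Eth; rewrite pscoB !pscoZ // -pscoA // in E1.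
  have E2 := congr1 (fun x => co x g) Ek; rewrite pscoB !pscoZ // -pscoA // in E2.
  rewrite mulrBr -E1 mulrCA -Eth [psC pi * (_ - psC pi * ka a)]mulrBr -E2 -Ek -ug //=; ring.
have th0 : th 0%N = 0.
  have := congr1 (fun x => x 0%N) Eth; rewrite psBE !psCM psco0E B0 mulr0 subr0.
  by move/esym/eqP; rewrite mulf_eq0 (negPf pi0) => /eqP.
have [T [OT T0 CT]] : exists T : ps K, [/\ pall O T, T 0%N = 0 & th =~ psexp q T].
  have [] := peel hv pi0 vpi p_pr hr hu deep L1 OdL (cls := pall O) _ _ _
    (h := fun a => co (ka a) G) (B := th).
  - by move=> B'; apply: (pall_psd hS).
  - by move=> B'; apply: (good_integral hv vpi).
  - by move=> B' OB' _ n; apply: OB'.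
  - by move=> a; apply: (pall_co hS).
  - exact: Oth.
  - have := congr1 (fun x => x 1%N) Eth; rewrite psBE !psCM psco1E // B1 mul0r mulr0 subr0.
    move/esym/eqP; rewrite mulf_eq0 (negPf pi0) => /eqP ->; exact: (idl0 hI).
  - move=> a a0 va; rewrite -[co th (u a)](subrK (psC a * th)) thu // addrC.
    apply: (cgD hI'); first exact: (cg_refl hI').
    rewrite psexp_pscoE //; apply: (@cg_trans _ _ _ hI' (co (ka a) g)).
      by rewrite /cg addrAC subrr sub0r; apply: (idlN hI'); apply: dvS_pall.
    exact: (cg_cor hS hI).
  move=> T [OT CT _]; exists (T - psC (T 0%N)); split.
  - by apply: (pallB hS) => //; apply: (pallC hS).
  - by rewrite psBE /psC subrr.
  move=> n; have := CT n; rewrite !psBE /psexp; case: ifP => // _; rewrite psBE /psC.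
  case: eqP => [E|_]; last by rewrite subr0.
  have T0 : M (T 0%N) by have := CT 0%N; rewrite psBE th0 sub0r /psexp dvdn0 div0n => /(idlN hI); rewrite opprK.
  by rewrite E subrr subr0 => H; rewrite -(subrK (T 0%N) (th n)); apply: (idlD hI).
(* xi is T composed with the inverse of G, so that xi(g) = xi(G(x^q)) = T(x^q) = th modulo pi. *)
have [xi Oxi Exi] := psco_divr hS OG OT Oc G0 Gc.
have Cxi : co xi g =~ th.
  apply: (@cg_trans _ _ _ hI' (co xi (psexp q G))); first exact: (cg_cor hS hI).
  by rewrite -psexp_pscoE // Exi; apply: (cg_sym hI').
have xi0 : xi 0%N = 0 by have := congr1 (fun x => x 0%N) Exi; rewrite psco0E T0.
(* (B / pi)(g) - B = th is only integral; subtracting xi removes it modulo pi, and the multiple of L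
   restores a zero linear coefficient while respecting the eigen-relations. *)
pose B2 := psC pi^-1 * B - xi + psC (xi 1%N) * L.
have piB2 : psC pi * B2 = B - psC pi * xi + psC (pi * xi 1%N) * L.
  rewrite /B2 mulrDr mulrBr !mulrA -!rmorphM mulfV // rmorph1; ring.
exists xi, B2; split=> //; last by rewrite piB2; ring.
have lift_pi x y z : psC pi * x = psC pi * y + psC pi * z -> x = y + z by rewrite -mulrDr => /cancel.
split.
- by rewrite /B2 psDE psBE !psCM B0 L0 xi0 !mulr0 subrr addr0.
- by rewrite /B2 psDE psBE !psCM B1 L1 mulr0 sub0r mulr1 addNr.
- have -> : co B2 g = psC pi * B2 + (th - co xi g + psC pi * xi).
    apply: lift_pi; rewrite -(pscoZ idfun pi) // piB2 pscoD pscoB !pscoZ // Lg.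
    have -> : co B g = psC pi * th + psC pi * B by rewrite -Eth subrK.
    rewrite /= rmorphM; ring.
  rewrite /cg addrC addKr; apply: (idlD hI'); first exact: (cg_sym hI').
  exact: dvS_pall.
move=> a a0 va; have [Ou u0 u1 ua] := hu a0 va; have Oa := OK0 va.
have Ek : co B (u a) - psC a * B = psC pi * ka a by case: (Hka a) => _; apply.
pose tau := ka a - (co xi (u a) - psC a * xi).
have Otau : pall O tau.
  apply: (pallB hS) => //; apply: (pallB hS); first exact: (pall_co hS).
  by apply: (pallM hS) => //; apply: (pallC hS).
have -> : co B2 (u a) = psC a * B2 + tau.
  apply: lift_pi; rewrite -(pscoZ idfun pi) // piB2 pscoD pscoB !pscoZ // ua.
  have -> : co B (u a) = psC pi * ka a + psC a * B by rewrite -Ek subrK.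
  rewrite [psC pi * (psC a * B2)]mulrCA piB2 /tau /= rmorphM; ring.
(* The defect tau under u_a is integral; by [psco_prim] it vanishes modulo pi as soon as tau(g)
   does. *)
rewrite /cg addrC addKr; apply: contrapT => nM.
have [_ []] := psco_prim hv pi0 vpi Og g0 (wd_prim Og wg) (conj Otau nM).
have -> : co tau g = psC pi * ka a + (co th (u a) - co (co xi g) (u a)) - psC a * (th - co xi g).
  rewrite /tau !pscoB pscoZ // -[co (co xi (u a)) g]pscoA // ug // pscoA //= mulrBr.
  have E := thu a a0 va.
  have -> : co th (u a) = psC a * th + (co (ka a) g - psC pi * ka a) by rewrite -E addrC subrK.
  ring.
apply: (idlB hI'); last first.
  by apply: (idlM hI'); [apply: (pallC hS)|apply: (cg_sym hI')].
apply: (idlD hI'); first exact: dvS_pall.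
by apply: (cg_col hS hI) => //; apply: (cg_sym hI').
Qed.

(** Iterating [eigen_step] gives B = s_N + c_N L + pi^N B_N with s_N divisible by pi and c_N
    convergent. *)
Lemma eigen_multiple B : eigen_mod B -> exists2 w, B =~ psC w * L & M w.
Proof.
move=> eB.
have /choice[nx Hnx] : forall b : {B | eigen_mod B}, exists b2 : {B | eigen_mod B} * ps K,
    pall O b2.2 /\ sval b = psC pi * b2.2 - psC (pi * b2.2 1%N) * L + psC pi * sval b2.1.
  move=> [b eb]; have [xi [B2 [Oxi e2 E]]] := eigen_step eb.
  by exists (exist _ B2 e2, xi).
pose b n := iter n (fun b => (nx b).1) (exist _ B eB); pose xi n := (nx (b n)).2.
pose c n := - \sum_(i < n) pi ^+ i * (pi * xi i 1%N).
have Oxi n : pall O (xi n) by case: (Hnx (b n)).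
have Ob n : exists2 s, pall M s & B = s + psC (c n) * L + psC (pi ^+ n) * sval (b n).
  elim: n => [|n [s Os Es]].
    by exists 0; [apply: (idl0 hI')|rewrite /c big_ord0 oppr0 expr0 !rmorph0 rmorph1 mul0r mul1r !add0r].
  exists (s + psC (pi ^+ n.+1) * xi n).
    apply: (idlD hI') => //; rewrite exprS rmorphM -mulrA; apply: dvS_pall.
    by apply: (pallM hS) => //; apply/(pallC hS)/(subX hS)/(OKpi vpi).
  have [_ E] := Hnx (b n).
  have -> : c n.+1 = c n - pi ^+ n * (pi * xi n 1%N) by rewrite /c big_ord_recr opprD.
  rewrite Es {1}E -/(xi n) exprSr rmorphB !rmorphM /b iterS -/(b n); ring.
have Mc n : M (c n).
  apply: (idlN hI); apply: (idl_sum hI) => i _; rewrite mulrCA; apply: dvS_self.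
  by apply: (subM hS); [apply/(subX hS)/(OKpi vpi)|apply: Oxi].
(* The shift to N + 1 leaves a spare factor: in degree j <= N the remainder pi^(N+1) B_(N+1) is pi
   times an integral element. *)
have [||w Cw Hw] := multiple_limit hv pi0 vpi hc (B := B) (L := L) (c := fun n => c n.+1).
- move=> n; rewrite /c [X in - X - _]big_ord_recr opprD addrAC subrr add0r /=.
  apply: (idlN (dvpiX_idl hv vpi n)); rewrite exprS -mulrA mulrCA; apply: dvS_self.
  by apply: (subM hS); [apply: (OKpi vpi)|apply: (subM hS); [apply: (OKpi vpi)|apply: Oxi]].
- move=> j; exists j => N jN; have [s Os Es] := Ob N.+1.
  rewrite psBE Es !psDE !psCM addrAC addrK; apply: (idlD hI); first exact: Os.
  have -> : pi ^+ N.+1 = pi * (pi ^+ (N - j) * pi ^+ j) by rewrite -exprD subnK // exprS.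
  rewrite -!mulrA; apply: dvS_self; apply: (subM hS); first exact/(subX hS)/(OKpi vpi).
  by apply: eigen_bound; apply: (proj2_sig (b N.+1)).
exists w => //; rewrite -(subrK (c 2%N) w); apply: (idlD hI) => //.
by have := Hw 1%N; rewrite expr1.
Qed.

Lemma uniformizer_good : goodO L.
Proof.
apply: (good_uniformizer hv pi0 vpi hS (iota := idfun) _ Og g0 g1 dg L1 Lg) => //.
by move=> x /eqP; rewrite mulf_eq0 (negPf pi0) => /eqP.
Qed.

Lemma log_rec j : pi * L j.+2 * (1 - pi ^+ j.+1) = \sum_(k < j.+2) L k * (g ^+ k) j.+2.
Proof.
have := congr1 (fun h => h j.+2) Lg; rewrite psCM /psco big_ord_recr /= ordpsXn // g1 => E.
have -> : pi * L j.+2 * (1 - pi ^+ j.+1) = pi * L j.+2 - L j.+2 * pi ^+ j.+2.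
  by rewrite [pi ^+ j.+2]exprS; ring.
by rewrite -E addrK.
Qed.

Lemma log_low j : (j < q)%N -> O (L j).
Proof.
elim/ltn_ind: j => -[|[|j]] IH jq; rewrite ?L0 ?L1; [exact: (sub0 hS)|exact: (sub1 hS)|].
have [c Oc Ec] : exists2 c, O c & (1 - pi ^+ j.+1) * c = 1.
  by apply: one_sub_unit; rewrite exprS; apply: (idlMr hI) => //; apply/(subX hS)/(OKpi vpi).
have : M (\sum_(k < j.+2) L k * (g ^+ k) j.+2).
  apply: (idl_sum hI) => -[[|k] kj] _ /=; first by rewrite L0 mul0r; apply: (idl0 hI).
  apply: (idlM hI); first by apply: IH => //; apply: ltn_trans jq.
  rewrite exprS; apply: (idl_sum hI) => -[i ij] _ /=; apply: (idlMr hI); first exact: (pallX hS).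
  by case: wg => + _; apply; apply: leq_ltn_trans jq.
move=> [s Os Es]; have := log_rec j; rewrite Es -mulrA => /(mulfI pi0) E.
by rewrite -[L _]mulr1 -Ec mulrA E; apply: (subM hS).
Qed.

(** The valuation of w is read off in degree q, where 1 = w L_q modulo pi. As g vanishes modulo pi
    below degree q, L is integral there and pi L_q is integral, so w is not divisible by pi^2. *)
Lemma uniformizer_log_frobenius : exists w, [/\ psexp q L =~ psC w * L, w != 0 & v w = 1].
Proof.
have gL := uniformizer_good.
have [|w Cw Mw] := @eigen_multiple (psexp q L).
  split.
  - by rewrite /psexp dvdn0 div0n L0.
  - by rewrite /psexp dvdn1 gtn_eqF.
  - by apply: (eigen_psexp hv pi0 vpi p_pr hr) => //; rewrite Lg; apply: (cg_refl hI').
  move=> a a0 va; have [Ou u0 _ ua] := hu a0 va.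
  by apply: (eigen_psexp hv pi0 vpi p_pr hr) => //; rewrite ua; apply: (cg_refl hI').
exists w; have OpL : O (pi * L q).
  have [m qm] : exists m, q = m.+2 by exists q.-2; lia.
  have [c Oc Ec] : exists2 c, O c & (1 - pi ^+ m.+1) * c = 1.
    by apply: one_sub_unit; rewrite exprS; apply: (idlMr hI) => //; apply/(subX hS)/(OKpi vpi).
  have := log_rec m; rewrite -qm => E.
  rewrite -[pi * L q]mulr1 -Ec mulrA E; apply: (subM hS) => //; apply: (sub_sum hS) => -[k kq] _ /=.
  by apply: (subM hS); [apply: log_low|apply: (pallX hS)].
have nM2 : ~ dvS O (pi ^+ 2) w.
  move=> [s Os Es]; apply: (MK1 hv pi0 vpi); have := Cw q.
  rewrite psBE psCM /psexp dvdnn divnn q0 L1 => H; rewrite -(subrK (w * L q) 1).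
  apply: (idlD hI); first by [].
  have -> : w * L q = pi * (s * (pi * L q)) by rewrite Es; ring.
  by apply: dvS_self; apply: (subM hS).
have w0 : w != 0 by apply/eqP => E; apply: nM2; rewrite E; apply: (idl0 (dvpiX_idl hv vpi 2)).
split=> //; have := Mw; rewrite (MKE hv pi0 vpi) /inM (negPf w0) /= => v0.
have : ~~ vsmall v w 2 by apply/negP => /(dvpiE hv pi0 vpi).
by rewrite /vsmall (negPf w0) /=; lia.
Qed.
End UniformizerCase.

(** * The unramified case *)

Section UnramifiedCase.
Variables (p f : nat) (K : fieldType) (v : K -> int).
Notation pi := (p%:R : K).
Hypotheses (hv : is_valuation v) (vpi : v pi = 1) (hc : v_complete v).
Hypothesis (p_pr : prime p).
Hypothesis hr : residue_card v (p ^ f)%N.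
Hypothesis char0 : forall n : nat, (n%:R : K) = 0 -> n = 0%N.
Notation O := (OK v).
Notation M := (dvS O pi).
Notation co := (psco idfun).
Let pi0 : pi != 0. Proof. by apply/eqP => /char0 E; move: p_pr; rewrite E. Qed.
Let hS := OK_sub hv.
Let hI := MK_idl hv vpi.
Let hS' := pall_is_sub hS.
Let hI' := pall_is_idl hI.
Let p0 := prime_gt0 p_pr.
Let q := (p ^ f)%N.
Let f0 := residue_f_gt0 hv pi0 vpi p_pr hr.
Let q1 : (1 < q)%N. Proof. by rewrite /q -(exp1n f) ltn_exp2r // prime_gt1. Qed.
Let q0 : (0 < q)%N. Proof. exact: ltnW. Qed.
Let Mpi : M pi. Proof. by rewrite -[X in M X]mulr1; apply/dvS_self/(sub1 hS). Qed.
Notation "x =~ y" := (cg (pall M) x y) (at level 70).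
Notation goodO B := (good idfun B O M).
Notation T N := (psexp (q ^ N)).

Lemma p_power_div j : (0 < j)%N -> M (pi ^+ j / j%:R).
Proof.
move=> j0; have [m pm Em] := pfactor_coprime p_pr j0.
set k := logn p j in Em.
have m_gt0 : (0 < m)%N by case: (m) Em => // Ej; rewrite Ej in j0.
have kj : (k < j)%N.
  by apply: (leq_trans (ltn_expl k (prime_gt1 p_pr))); rewrite [leqRHS]Em leq_pmull.
have [m0 vm] := OK_unit hv pi0 vpi (sub_nat hS m) (unit_mod_p hv pi0 vpi p_pr hr pm).
have -> : pi ^+ j / j%:R = pi * (pi ^+ (j - k.+1) / m%:R).
  have -> : (j%:R : K) = m%:R * pi ^+ k by rewrite [in LHS]Em natrM natrX.
  have -> : pi ^+ j = pi ^+ k * pi * pi ^+ (j - k.+1) by rewrite -exprSr -exprD subnKC.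
  field.
  by rewrite m0 expf_neq0.
apply: dvS_self; apply: (subM hS); first exact/(subX hS)/(sub_nat hS).
exact: (OKV hv).
Qed.

(** B_m C(m, j) = (m B_m) C(m - 1, j - 1) / j, and p^j / j is divisible by p. *)
Lemma good_deriv (R : comNzRingType) (iota : {rmorphism K -> R}) (S : R -> Prop) (B : ps K) :
  is_sub S -> (forall a, O a -> S (iota a)) -> pall O (psd B) -> good iota B S (dvS S (iota pi)).
Proof.
move=> hSR SO OB; apply: (good_binomial vpi hSR SO) => -[|m] [|j] // _.
  by rewrite bin0n mulr0 mul0r; apply: (idl0 hI).
have nz k : (k.+1%:R : K) != 0 by apply/eqP => /char0.
have -> : B m.+1 * 'C(m.+1, j.+1)%:R * pi ^+ j.+1 = psd B m * 'C(m, j)%:R * (pi ^+ j.+1 / j.+1%:R).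
  have -> : psd B m = B m.+1 * m.+1%:R by rewrite mulr_natr.
  have : (m.+1%:R * 'C(m, j)%:R = j.+1%:R * 'C(m.+1, j.+1)%:R :> K) by rewrite -!natrM mul_bin_diag.
  move=> E; rewrite -[B m.+1 * m.+1%:R * _]mulrA E.
  have -> : B m.+1 * (j.+1%:R * 'C(m.+1, j.+1)%:R) * (pi ^+ j.+1 / j.+1%:R)
    = B m.+1 * 'C(m.+1, j.+1)%:R * pi ^+ j.+1 * (j.+1%:R / j.+1%:R) by ring.
  by rewrite divff ?mulr1.
by apply: (idlM hI); [apply: (subM hS); [apply: OB|apply: (sub_nat hS)]|apply: p_power_div].
Qed.

Variables (L : ps K) (u : K -> ps K).
Hypothesis hu : forall a, a != 0 -> v a = 0 ->
  [/\ pall O (u a), u a 0%N = 0, u a 1%N = a & co L (u a) = psC a * L].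
Hypothesis deep : forall N, exists a, [/\ a != 0, v a = 0, M (a - 1) &
  exists2 d, wd v pi (u a - px) d & (N <= d)%N].
Hypotheses (L0 : L 0%N = 0) (L1 : L 1%N = 1) (OdL : pall O (psd L)).

Definition eigen_deriv (B : ps K) := pall O (psd B) /\
  forall a, a != 0 -> v a = 0 -> co B (u a) =~ psC a * B.
Notation E := eigen_deriv.

Lemma eigen_log : E L.
Proof. by split=> // a a0 va; have [_ _ _ ->] := hu a0 va; apply: (cg_refl hI'). Qed.

Lemma eigenD A B : E A -> E B -> E (A + B).
Proof.
move=> [OA EA] [OB EB]; split; first by rewrite psdD; apply: (pallD hS).
by move=> a a0 va; rewrite pscoD mulrDr; apply: (cgD hI'); [apply: EA|apply: EB].
Qed.
Lemma eigenZ c B : O c -> E B -> E (psC c * B).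
Proof.
move=> Oc [OB EB]; split; first by rewrite psdZ; apply: (pallM hS) => //; apply: (pallC hS).
move=> a a0 va; have [_ u00 _ _] := hu a0 va; rewrite pscoZ // mulrCA /cg -mulrBr.
by apply: (idlM hI'); [apply: (pallC hS)|apply: EB].
Qed.
Lemma eigen1 B : E B -> O (B 1%N).
Proof. by move=> [/(_ 0%N) + _]; rewrite psd0E. Qed.

Lemma eigen_peel B : E B -> M (B 1%N) -> exists2 B', E B' & B =~ T 1 B'.
Proof.
move=> [OB EB] B1.
have [] := peel hv pi0 vpi p_pr hr hu deep L1 OdL (cls := fun B => pall O (psd B)) _ _ _
    (h := fun=> 0) (B := B) => //.
- by move=> C OC; apply: (good_deriv (iota := idfun)).
(* The uniformizer being p itself, p n C_(pn) in p O gives n C_(pn) in O: the derivative stays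
   integral. *)
- move=> C OC dC n; have := dC (p * n.+1).-1; rewrite /psd prednK ?muln_gt0 ?p0 //.
  have -> : C (p * n.+1)%N *+ (p * n.+1) = pi * (C (p * n.+1)%N *+ n.+1).
    by rewrite mulr_natl -mulrnA (mulnC n.+1).
  move=> -[s Os /(mulfI pi0) Es].
  by rewrite /psd Es.
- by move=> a; apply: (pall0 hS).
- move=> a a0 va; have -> : psexp (p ^ f) 0 = 0 :> ps K by apply: psP => n; rewrite /psexp; case: ifP.
  by rewrite addr0; apply: EB.
move=> B' [OB' CB EB']; exists B'; last by rewrite expn1.
split=> // a a0 va; have [Ou u00 _ _] := hu a0 va.
apply: (@cg_trans _ _ _ hI' (co B' (fr q (u a)))).
  apply: (good_deriv (iota := idfun) hS _ OB') => //.
  - exact: (pall_fr hS).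
  - by rewrite /fr u00 expr0n gtn_eqF.
  by apply: (cg_sym hI'); apply: (fr_q hv pi0 vpi p_pr hr).
by have := EB' a a0 va; rewrite addr0.
Qed.

Lemma eigen_div B : E B -> exists2 B', E B' & B =~ psC (B 1%N) * L + T 1 B'.
Proof.
move=> EB; have [||B' EB' C] := @eigen_peel (B - psC (B 1%N) * L).
- have EN : E (psC (- B 1%N) * L) by apply: eigenZ; [apply/(subN hS)/eigen1|apply: eigen_log].
  by have := eigenD EB EN; rewrite rmorphN mulNr.
- by rewrite psBE psCM L1 mulr1 subrr; apply: (idl0 hI).
by exists B' => //; move: C; rewrite /cg opprD addrA.
Qed.

Lemma eigen_pi B : E B -> exists2 B', E B' & psC pi * B =~ T 1 B'.
Proof.
move=> EB; apply: eigen_peel; first exact/eigenZ/EB/(sub_nat hS).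
by rewrite psCM; apply: (idlMr hI); [apply: eigen1|].
Qed.

Lemma TC N c (x : ps K) : T N (psC c * x) = psC c * T N x. Proof. exact: psexpZ. Qed.
Lemma TD N (x y : ps K) : T N (x + y) = T N x + T N y.
Proof. by apply: psP => n; rewrite psDE /psexp; case: ifP; rewrite ?psDE ?addr0. Qed.
Lemma TT m n (x : ps K) : T m (T n x) = T (m + n) x.
Proof.
have qX k : (0 < q ^ k)%N by rewrite expn_gt0 q0.
by rewrite (psexp_psexp _ (qX m) (qX n)) -expnD.
Qed.
Lemma Tcg N (x y : ps K) : x =~ y -> T N x =~ T N y.
Proof. exact: (psexp_cg hv vpi). Qed.
Lemma Zcg c (x y : ps K) : O c -> x =~ y -> psC c * x =~ psC c * y.
Proof. by move=> Oc C; rewrite /cg -mulrBr; apply: (idlM hI') => //; apply: (pallC hS). Qed.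

Variables (g : ps K) (n : nat).
Hypotheses (n_gt0 : (0 < n)%N) (Og : pall O g) (g0 : g 0%N = 0) (g1 : g 1%N != 0) (vg : v (g 1%N) = n%:Z).
Hypotheses (Lg : co L g = psC (g 1%N) * L) (wg : wd v pi g (q ^ n)).

(** If c1 were not a unit, each further factor p would descend one more power of q, giving p^n L =
    B'(x^(q^(n+1))) modulo p. Since v(g'(0)) = n, the series L(g) = g'(0) L, and hence g, would
    vanish modulo p below degree q^(n+1), against its Weierstrass degree q^n. *)
Lemma eigen_log_pi : exists c1 F, [/\ c1 != 0, v c1 = 0, E F & psC pi * L =~ psC c1 * T 1 L + T 2 F].
Proof.
have [B1 EB1 C1] := eigen_pi eigen_log.
have [F EF CF] := eigen_div EB1.
exists (B1 1%N), F.
have CL : psC pi * L =~ psC (B1 1%N) * T 1 L + T 2 F.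
  by apply: (cg_trans hI' C1); rewrite -TC -(TT 1 1) -TD; apply: Tcg.
have [M1|nM] := EM (M (B1 1%N)); last first.
  by have [] := OK_unit hv pi0 vpi (eigen1 EB1) nM.
have main k : exists B, [/\ E B, M (B 1%N) & psC (pi ^+ k.+1) * L =~ T k.+1 B].
  elim: k => [|k [B [EB MB CB]]]; first by exists B1; rewrite expr1.
  have [B' EB' CB'] := eigen_peel EB MB.
  exists (psC pi * B'); split; first exact/eigenZ/EB'/(sub_nat hS).
    by rewrite psCM; apply: (idlMr hI); [apply: eigen1|].
  rewrite exprS rmorphM -mulrA TC; apply: Zcg; first exact: (sub_nat hS).
  by apply: (cg_trans hI' CB); rewrite -[k.+2]addn1 -TT; apply: Tcg.
exfalso; have [B [EB MB CB]] := main n.-1; rewrite prednK // in CB.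
have [B' _ CB'] := eigen_peel EB MB.
have {}CB : psC (pi ^+ n) * L =~ T n.+1 B'.
  by apply: (cg_trans hI' CB); rewrite -[n.+1]addn1 -TT; apply: Tcg.
case: wg => _; apply.
have low i : (i < q ^ n.+1)%N -> cg M (co L g i) (co L 0 i).
  move=> iq; have -> : co L 0 i = 0.
    by rewrite /psco big1 // => -[[|k] ki] _ /=; rewrite ?L0 ?mul0r // exprS mul0r mulr0.
  rewrite /cg subr0 Lg psCM.
  have -> : g 1%N * L i = g 1%N / pi ^+ n * (pi ^+ n * L i) by rewrite mulrA divfK ?expf_neq0.
  apply: (idlM hI).
    by apply/OK0; rewrite (vM hv) ?invr_neq0 ?expf_neq0 // (vV hv) ?expf_neq0 // (vpiX hv pi0 vpi) vg; lia.
  have := CB i; rewrite psBE psCM /psexp; case: ifP => [di|_]; last by rewrite subr0.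
  case: i iq di => [|i] iq di; first by rewrite L0 mulr0 => _; apply: (idl0 hI).
  by have := dvdn_leq (ltn0Sn i) di; rewrite leqNgt iq.
have gL : goodO L by apply: (good_deriv (iota := idfun)).
have := pscoL_inj_cg L0 L1 hS hI gL (pall0 hS) g0 (erefl _) low.
by move=> /(_ (q ^ n)%N); rewrite /cg subr0; apply; rewrite ltn_exp2l.
Qed.

(** Solving [eigen_log_pi] for L(x^q) gives om L with an error in x^(q^2). The linear part of the
    error is a multiple of L(x^(q^2)), which is om^2 L up to a series in x^(q^3), and so on; the
    corrections converge and leave w equal to om modulo p^2. *)
Lemma unramified_log_frobenius : exists w, [/\ psexp q L =~ psC w * L, w != 0 & v w = 1].
Proof.
have [c1 [F [c10 vc1 EF CL]]] := eigen_log_pi.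
have Oc : O c1^-1 by apply: (OKV hv).
pose om := pi * c1^-1.
have Oom : O om by apply: (subM hS) => //; apply: (sub_nat hS).
have C1 : T 1 L =~ psC om * L + T 2 (psC (- c1^-1) * F).
  have -> : T 1 L = psC c1^-1 * (psC c1 * T 1 L) by rewrite mulrA -rmorphM mulVf // rmorph1 mul1r.
  apply: (@cg_trans _ _ _ hI' (psC c1^-1 * (psC pi * L - T 2 F))).
    apply: Zcg => //; rewrite -{1}[psC c1 * _](addrK (T 2 F)); apply: (cgB hI'); last exact: (cg_refl hI').
    exact: (cg_sym hI').
  have -> : psC c1^-1 * (psC pi * L - T 2 F) = psC om * L + T 2 (psC (- c1^-1) * F).
    by rewrite TC /om rmorphN rmorphM /=; ring.
  exact: (cg_refl hI').
have E1 : E (psC (- c1^-1) * F) by apply: eigenZ => //; apply: (subN hS).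
set F1 := psC (- c1^-1) * F in C1 E1.
have Tom B : E B -> exists2 B', E B' & psC om * B =~ T 1 B'.
  move=> EB; have [B' EB' CB] := eigen_pi EB; exists (psC c1^-1 * B'); first exact: eigenZ.
  by rewrite TC /om [pi * _]mulrC rmorphM -mulrA; apply: Zcg.
have CN N : exists2 G, E G & T N L =~ psC (om ^+ N) * L + T N.+1 G.
  elim: N => [|N [G EG CG]].
    exists (psC 0 * L); first exact/eigenZ/eigen_log/(sub0 hS).
    by rewrite TC !rmorph0 mul0r addr0 expr0 rmorph1 mul1r psexp1; apply: (cg_refl hI').
  have [G' EG' CG'] := Tom G EG.
  exists (G' + F1); first exact: eigenD.
  apply: (@cg_trans _ _ _ hI' (psC om * T N L + T N.+2 F1)).
    have -> : T N.+2 F1 = T N (T 2 F1) by rewrite TT addn2.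
    have -> : T N.+1 L = T N (T 1 L) by rewrite TT addn1.
    by rewrite -TC -TD; apply: Tcg.
  rewrite TD addrA; apply: (cgD hI'); last exact: (cg_refl hI').
  apply: (@cg_trans _ _ _ hI' (psC om * (psC (om ^+ N) * L + T N.+1 G))); first exact: Zcg.
  rewrite mulrDr mulrA -rmorphM -exprS; apply: (cgD hI'); first exact: (cg_refl hI').
  by rewrite -TC -[N.+2]addn1 -TT; apply: Tcg.
have /choice[G HG] : forall N, exists G, E G /\ T N L =~ psC (om ^+ N) * L + T N.+1 G.
  by move=> N; have [G] := CN N; exists G.
have /choice[dv Hdv] : forall B, exists B', E B -> E B' /\ B =~ psC (B 1%N) * L + T 1 B'.
  move=> B; have [EB|nE] := EM (E B); last by exists 0.
  by have [B' EB' CB] := eigen_div EB; exists B'.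
(* State N is a pair (w, B) with L(x^q) = w L + B(x^(q^(N+2))) modulo p; the linear coefficient of B
   is moved into w through the expansion of L(x^(q^(N+2))). *)
pose st := fix st N : K * ps K := if N is N'.+1
  then let: (w, B) := st N' in (w + B 1%N * om ^+ N'.+2, dv B + psC (B 1%N) * G N'.+2)
  else (om, F1).
have Hst N : E (st N).2 /\ T 1 L =~ psC (st N).1 * L + T N.+2 (st N).2.
  elim: N => [|N]; first by [].
  rewrite /=; case: (st N) => w B /= [EB CB].
  have [EG CG] := HG N.+2; have [Ed Cd] := Hdv B EB.
  split; first by apply: eigenD => //; apply: eigenZ => //; apply: eigen1.
  apply: (cg_trans hI' CB); rewrite rmorphD mulrDl -addrA; apply: (cgD hI'); first exact: (cg_refl hI').
  apply: (@cg_trans _ _ _ hI' (psC (B 1%N) * T N.+2 L + T N.+3 (dv B))).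
    by rewrite -TC -[N.+3]addn1 -TT -TD; apply: Tcg.
  rewrite TD TC [T _ (dv B) + _]addrC addrA; apply: (cgD hI'); last exact: (cg_refl hI').
  rewrite rmorphM -mulrA -mulrDr; apply: Zcg => //; exact: eigen1.
have dst N : dvS O (pi ^+ N.+2) ((st N.+1).1 - (st N).1).
  rewrite /=; case E2: (st N) => [w B] /=; rewrite addrC addKr /om exprMn mulrCA; apply: dvS_self.
  apply: (subM hS); last exact: (subX hS).
  by apply: eigen1; have [] := Hst N; rewrite E2.
have [||w Cw Hw] := multiple_limit hv pi0 vpi hc (B := T 1 L) (L := L) (c := fun N => (st N).1).
- by move=> N; apply: (dvpiW hv pi0 vpi _ (dst N)); lia.
- move=> j; exists j => N jN; have [EB CB] := Hst N.
  have T0 i : (i <= j)%N -> M (T N.+2 (st N).2 i).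
    move=> ij; rewrite /psexp; case: ifP => [di|_]; last exact: (idl0 hI).
    case: i ij di => [|i] ij di.
      rewrite div0n; have := CB 0%N; rewrite psBE psDE psCM L0 mulr0 add0r /psexp !dvdn0 !div0n L0 sub0r.
      by move/(idlN hI); rewrite opprK.
    have := dvdn_leq (ltn0Sn i) di; rewrite leqNgt.
    by rewrite (leq_ltn_trans ij) // (leq_ltn_trans jN) // ltnW // ltnW // ltn_expl.
  have := idlD hI (CB j) (T0 j (leqnn j)).
  by rewrite !psBE psDE opprD addrA subrK.
exists w; rewrite expn1 in Cw; have D2 : dvS O (pi ^+ 2) (w - om).
  have -> : w - om = (w - (st 2%N).1) + ((st 2%N).1 - (st 1%N).1) + ((st 1%N).1 - (st 0%N).1) by rewrite /=; ring.
  have h2 := dvpiX_idl hv vpi 2.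
  apply: (idlD h2); last exact: (dst 0%N).
  by apply: (idlD h2); [apply: Hw|apply: (dvpiW hv pi0 vpi _ (dst 1%N))].
have vom : om != 0 /\ v om = 1.
  by rewrite /om mulf_neq0 ?invr_neq0 // (vM hv) ?invr_neq0 // (vV hv) // vc1 vpi.
have nM2 : ~ dvS O (pi ^+ 2) w.
  move=> H; have : dvS O (pi ^+ 2) om by rewrite -[om](subKr w); apply: (idlB (dvpiX_idl hv vpi 2)).
  by rewrite (dvpiE hv pi0 vpi) /vsmall (negPf vom.1) vom.2.
have w0 : w != 0 by apply/eqP => E0; apply: nM2; rewrite E0; apply: (idl0 (dvpiX_idl hv vpi 2)).
have Mw : M w.
  rewrite -(subrK om w); apply: (idlD hI); last by apply: (idlMr hI).
  by have := dvpiW hv pi0 vpi (leqnSn 1) D2; rewrite expr1.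
split=> //; have : ~~ vsmall v w 2 by apply/negP => /(dvpiE hv pi0 vpi).
by move: Mw; rewrite (MKE hv pi0 vpi) /inM /vsmall (negPf w0) /=; lia.
Qed.
End UnramifiedCase.

(** * The formal group of a logarithm *)

Section FormalGroup.
Variables (K : fieldType).
Notation co := (psco idfun).
Notation P := {poly K}.
Notation cop := (psco (polyC : {rmorphism K -> P})).

(** Characterizes the series over K[X] that encode bivariate ones: X^i Y^j is represented by X^j
    t^(i+j). On these [bicoef] respects products, and the univariate composition lemmas become
    available. *)
Definition homog (G : ps P) := forall n, (size (G n) <= n.+1)%N.
Definition bicoef (G : ps P) (i j : nat) : K := (G (i + j)%N)`_j.

Lemma homog1 : homog 1.
Proof. by move=> n; rewrite ps1E; case: eqP; rewrite ?size_poly1 // size_poly0. Qed.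
Lemma homogD G H : homog G -> homog H -> homog (G + H).
Proof.
by move=> hG hH n; rewrite psDE (leq_trans (size_polyD _ _)) // geq_max hG hH.
Qed.
Lemma homogM G H : homog G -> homog H -> homog (G * H).
Proof.
move=> hG hH n; rewrite psME (leq_trans (size_sum _ _ _)) //; apply/bigmax_leqP => -[k kn] _ /=.
by apply: leq_trans (size_polyMleq _ _) _; have := hG k; have := hH (n - k)%N; lia.
Qed.
Lemma homogX G n : homog G -> homog (G ^+ n).
Proof. by move=> hG; elim: n => [|n IH]; [apply: homog1|rewrite exprS; apply: homogM]. Qed.
Lemma homog_cop (A : ps K) G : homog G -> homog (cop A G).
Proof.
move=> hG n; rewrite /psco (leq_trans (size_sum _ _ _)) //; apply/bigmax_leqP => k _ /=.
by rewrite mul_polyC (leq_trans (size_scale_leq _ _)) // homogX.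
Qed.

Lemma bicoefM G H : homog G -> homog H -> bicoef (G * H) = ps2mul (bicoef G) (bicoef H).
Proof.
move=> hG hH; apply/funext => i; apply/funext => j; rewrite /bicoef /ps2mul psME coef_sum.
under eq_bigr => k _ do rewrite coefM.
rewrite exchange_big [RHS]exchange_big; apply: eq_bigr => -[b bj] _ /=.
pose t k := (G k)`_b * (H (i + j - k)%N)`_(j - b).
rewrite -(big_mkord xpredT t) (big_cat_nat (n := b)) //=; last by lia.
rewrite [X in X + _]big_nat_cond [X in X + _]big1 ?add0r; last first.
  by move=> k /andP[/andP[_ kb] _]; rewrite /t nth_default ?mul0r // (leq_trans (hG k)).
rewrite (big_cat_nat (n := (b + i.+1)%N)) /=; [|by lia|by lia].
rewrite [X in _ + X]big_nat_cond [X in _ + X]big1 ?addr0; last first.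
  move=> k /andP[/andP[bk kij] _]; rewrite /t [X in _ * X]nth_default ?mulr0 //.
  by apply: leq_trans (hH _) _; lia.
rewrite -{1}[b]add0n [(b + _)%N]addnC big_addn addnK big_mkord.
apply: eq_bigr => -[a ai] _; rewrite /t /=; congr (_ * (H _)`_ _); lia.
Qed.
Lemma bicoefX G n : homog G -> bicoef (G ^+ n) = ps2pow (bicoef G) n.
Proof.
move=> hG; elim: n => [|n IH]; last by rewrite exprS bicoefM ?IH //; apply: homogX.
apply/funext => i; apply/funext => j; rewrite /bicoef expr0 ps1E /ps2pow /=.
by case: i j => [|i] [|j] //=; rewrite ?coef1 ?coef0.
Qed.
Lemma bicoef_cop (A : ps K) G i j : homog G ->
  \sum_(a < (i + j).+1) A a * ps2pow (bicoef G) a i j = bicoef (cop A G) i j.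
Proof.
move=> hG; rewrite /bicoef /psco coef_sum; apply: eq_bigr => a _.
by rewrite coefCM -bicoefX.
Qed.

Variable L : ps K.
Hypotheses (L0 : L 0%N = 0) (L1 : L 1%N = 1).
(* A series [A(X, Y)] is encoded as [A(t, X t)] in [K[X][[t]]]; below, [L(X)], [L(Y)] and their sum. *)
Definition lin1 : ps P := fun n => (L n)%:P.
Definition lin2 : ps P := fun n => (L n)%:P * 'X^n.
Definition lin12 := lin1 + lin2.

Lemma lin12_homog : homog lin12.
Proof.
apply: homogD => n; first by rewrite (leq_trans (size_polyC_leq1 _)).
by rewrite /lin2 mul_polyC (leq_trans (size_scale_leq _ _)) // size_polyXn.
Qed.
Lemma lin2X k n : (lin2 ^+ k) n = ((L ^+ k) n)%:P * 'X^n.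
Proof.
elim: k n => [|k IH] n.
  by rewrite !expr0 !ps1E; case: eqP => [->|_]; rewrite ?mulr1 // mul0r.
rewrite !exprS !psME rmorph_sum mulr_suml; apply: eq_bigr => -[i ni] _ /=.
by rewrite IH /lin2 mulrACA -exprD subnKC // -rmorphM.
Qed.
Lemma bicoef_lin a b i j : bicoef (lin1 ^+ a * lin2 ^+ b) i j = (L ^+ a) i * (L ^+ b) j.
Proof.
rewrite /bicoef psME coef_sum.
have E k : (lin1 ^+ a) k = ((L ^+ a) k)%:P by rewrite -[lin1]/(ps_map polyC L) -ps_mapX.
have ii : (i < (i + j).+1)%N by rewrite ltnS leq_addr.
rewrite (bigD1 (Ordinal ii)) //= big1 ?addr0.
  by rewrite E lin2X addKn mulrA -rmorphM coefCM coefXn eqxx mulr1.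
move=> [k kij] /eqP ne /=; rewrite E lin2X mulrA -rmorphM coefCM coefXn.
case: eqP => [Ej|_]; last by rewrite mulr0.
by case: ne; apply: val_inj => /=; lia.
Qed.
Lemma bicoef_lin12X l i j :
  bicoef (lin12 ^+ l) i j = \sum_(m < l.+1) 'C(l, m)%:R * ((L ^+ (l - m)) i * (L ^+ m) j).
Proof.
rewrite /lin12 exprDn /bicoef ps_sumE coef_sum; apply: eq_bigr => m _.
rewrite -bicoef_lin /bicoef -mulr_natl -[in LHS](rmorph_nat (@psC P)) psCM.
by rewrite -(rmorph_nat (polyC : {rmorphism K -> P})) coefCM.
Qed.

(** Coefficient of X^i Y^j in (L(X) + L(Y))^l. *)
Definition lin12c l i j := \sum_(m < l.+1) 'C(l, m)%:R * ((L ^+ (l - m)) i * (L ^+ m) j).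

Lemma lin12_0 : lin12 0%N = 0.
Proof. by rewrite /lin12 psDE /lin1 /lin2 L0 !rmorph0 mul0r addr0. Qed.

Lemma bicoef_expand (A : ps K) c i j N : (i + j < N)%N ->
  bicoef (cop A (psC c%:P * lin12)) i j = \sum_(l < N) A l * (c ^+ l * lin12c l i j).
Proof.
move=> ijN; have x0 : (psC c%:P * lin12) 0%N = 0 by rewrite psCM lin12_0 mulr0.
rewrite /bicoef (psco_wide _ _ x0 ijN) coef_sum; apply: eq_bigr => l _.
by rewrite coefCM exprMn -!rmorphXn psCM coefCM -[_`_j]/(bicoef (lin12 ^+ l) i j) bicoef_lin12X.
Qed.

Variable (F : ps P).
Hypotheses (F0 : F 0%N = 0) (LF : cop L F = lin12).

(** Composition with L is injective and sends both sides to c (L(X) + L(Y)). The instance y = x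
    describes F itself. *)
Lemma cop_eigen (E y : ps K) c : E 0%N = 0 -> co L E = px -> y 0%N = 0 -> co L y = psC c * L ->
  cop y F = cop E (psC c%:P * lin12).
Proof.
move=> E0 LE y0 Ly; have x0 : (psC c%:P * lin12) 0%N = 0 by rewrite psCM lin12_0 mulr0.
have y1 : cop y F 0%N = 0 by rewrite psco0E y0 rmorph0.
have E1 : cop E (psC c%:P * lin12) 0%N = 0 by rewrite psco0E E0 rmorph0.
apply: (pscoL_inj (iota := (polyC : {rmorphism K -> P})) L0 L1 y1 E1).
rewrite (pscoA (polyC : {rmorphism K -> P}) L y0 F0) (pscoA (polyC : {rmorphism K -> P}) L E0 x0) Ly LE (pscoZ _ _ _ F0) LF.
by rewrite (psco_px _ x0).
Qed.

Lemma F_eigen (E : ps K) : E 0%N = 0 -> co L E = px -> F = cop E (psC 1%:P * lin12).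
Proof.
move=> E0 LE; have Lx : co L px = psC 1 * L by rewrite psco_pxr rmorph1 mul1r; apply: psP.
by rewrite -(cop_eigen E0 LE (erefl _) Lx) (psco_px _ F0).
Qed.

Lemma bicoef_endo (y : ps K) c i j : homog F -> y 0%N = 0 -> co L y = psC c * L ->
  \sum_(a < (i + j).+1) y a * ps2pow (bicoef F) a i j
    = \sum_(a < i.+1) \sum_(b < j.+1) bicoef F a b * (y ^+ a) i * (y ^+ b) j.
Proof.
move=> hF y0 Ly; have [E E0 LE] := pscoL_solve (idfun : {rmorphism K -> K}) L0 L1 (erefl : (px : ps K) 0%N = 0).
rewrite bicoef_cop // (cop_eigen E0 LE y0 Ly) (bicoef_expand _ _ (ltnSn (i + j))).
transitivity (\sum_(a < i.+1) \sum_(b < j.+1) \sum_(l < (i + j).+1) \sum_(m < l.+1)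
    E l * ('C(l, m)%:R * (((L ^+ (l - m)) a * (y ^+ a) i) * ((L ^+ m) b * (y ^+ b) j)))); last first.
  apply: eq_bigr => -[a ai] _; apply: eq_bigr => -[b bj] _ /=.
  have abN : (a + b < (i + j).+1)%N by lia.
  rewrite {1}(F_eigen E0 LE) (bicoef_expand _ _ abN) !mulr_suml; apply: eq_bigr => l _.
  rewrite expr1n mul1r /lin12c mulr_sumr !mulr_suml; apply: eq_bigr => m _; ring.
under [RHS]eq_bigr => a _ do rewrite exchange_big.
rewrite exchange_big; apply: eq_bigr => l _.
under [RHS]eq_bigr => a _ do rewrite exchange_big.
rewrite exchange_big /lin12c !mulr_sumr; apply: eq_bigr => m _.
have D k n : co (L ^+ k) y n = c ^+ k * (L ^+ k) n.
  by rewrite pscoX // Ly exprMn -rmorphXn psCM.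
transitivity (E l * ('C(l, m)%:R * (co (L ^+ (l - m)) y i * co (L ^+ m) y j))).
  have El : c ^+ l = c ^+ (l - m) * c ^+ m by rewrite -exprD (subnK (ltn_ord m : (m <= l)%N)).
  by rewrite !D El; ring.
rewrite /psco mulr_suml !mulr_sumr; apply: eq_bigr => a _.
rewrite !mulr_sumr; apply: eq_bigr => b _; by [].
Qed.

Lemma lin12c_sym l i j : lin12c l i j = lin12c l j i.
Proof.
rewrite /lin12c (reindex_inj rev_ord_inj); apply: eq_bigr => -[m ml] _ /=.
by rewrite subSS bin_sub // subKn // [(L ^+ m) i * _]mulrC.
Qed.

Lemma bicoef_sym i j : bicoef F i j = bicoef F j i.
Proof.
have [E E0 LE] := pscoL_solve (idfun : {rmorphism K -> K}) L0 L1 (erefl : (px : ps K) 0%N = 0).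
have ji : (j + i < (i + j).+1)%N by rewrite addnC.
rewrite (F_eigen E0 LE) (bicoef_expand _ _ (ltnSn (i + j))) (bicoef_expand _ _ ji).
by apply: eq_bigr => l _; rewrite lin12c_sym.
Qed.

Lemma psMnE (R : comNzRingType) (h : ps R) k i : (h *+ k) i = h i *+ k.
Proof. by elim: k => // k IH; rewrite !mulrS psDE IH. Qed.

(** Three variables as iterated series, X outermost and Z innermost. *)
Let jx (h : ps K) : ps (ps (ps K)) := ps_map (psC \o psC) h.
Let jy (h : ps K) : ps (ps (ps K)) := psC (ps_map psC h).
Let jz (h : ps K) : ps (ps (ps K)) := psC (psC h).

Lemma coef3 A B C i j k : (jx A * jy B * jz C) i j k = A i * B j * C k.
Proof.
rewrite [_ * jz C]mulrC [jx A * _]mulrC /jz /jy !psCM [_ * jx A i]mulrC /jx /ps_map /= !psCM.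
by rewrite mulrC -rmorphM psCM.
Qed.

(* Both sides are coefficients of [(L(X) + L(Y) + L(Z)) ^ l]. *)
Lemma lin123 l i j k :
  \sum_(m < l.+1) 'C(l, m)%:R * (lin12c (l - m) i j * (L ^+ m) k) =
  \sum_(m < l.+1) 'C(l, m)%:R * ((L ^+ (l - m)) i * lin12c m j k).
Proof.
have jxX m : jx L ^+ m = jx (L ^+ m) by rewrite /jx ps_mapX.
have jyX m : jy L ^+ m = jy (L ^+ m) by rewrite /jy -rmorphXn ps_mapX.
have jzX m : jz L ^+ m = jz (L ^+ m) by rewrite /jz -!rmorphXn.
transitivity (((jx L + jy L + jz L) ^+ l) i j k).
  rewrite exprDn !ps_sumE; apply: eq_bigr => m _.
  rewrite !psMnE mulr_natl; congr (_ *+ _).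
  rewrite exprDn /lin12c !mulr_suml !ps_sumE; apply: eq_bigr => s _.
  by rewrite [in RHS]mulrnAl !psMnE mulr_natl mulrnAl jxX jyX jzX coef3.
rewrite -addrA exprDn !ps_sumE; apply: eq_bigr => m _.
rewrite !psMnE mulr_natl; congr (_ *+ _).
rewrite exprDn /lin12c !mulr_sumr !ps_sumE; apply: eq_bigr => s _.
by rewrite [in LHS]mulrnAr !psMnE mulr_natl mulrnAr jxX jyX jzX mulrA coef3 mulrA.
Qed.

(** Expanding the outer F through E turns the inner sums into coefficients of L(F)^m = (L(X) +
    L(Y))^m; both sides become coefficients of E(L(X) + L(Y) + L(Z)). *)
Lemma bicoef_assoc : homog F -> fgl_assoc (bicoef F).
Proof.
move=> hF i j k; have [E E0 LE] := pscoL_solve (idfun : {rmorphism K -> K}) L0 L1 (erefl : (px : ps K) 0%N = 0).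
have FE a b : (a + b < (i + j + k).+1)%N ->
    bicoef F a b = \sum_(l < (i + j + k).+1) E l * lin12c l a b.
  move=> abN; rewrite (F_eigen E0 LE) (bicoef_expand _ _ abN).
  by apply: eq_bigr => l _; rewrite expr1n mul1r.
have LX m r s : \sum_(a < (r + s).+1) (L ^+ m) a * ps2pow (bicoef F) a r s = lin12c m r s.
  by rewrite bicoef_cop // pscoX // LF bicoef_lin12X.
transitivity (\sum_(l < (i + j + k).+1) E l * \sum_(m < l.+1) 'C(l, m)%:R * (lin12c (l - m) i j * (L ^+ m) k)).
  transitivity (\sum_(a < (i + j).+1) \sum_(l < (i + j + k).+1)
      E l * (lin12c l a k * ps2pow (bicoef F) a i j)).
    apply: eq_bigr => -[a aij] _ /=; rewrite FE; last by lia.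
    by rewrite mulr_suml; apply: eq_bigr => l _; rewrite mulrA.
  rewrite exchange_big; apply: eq_bigr => l _; rewrite -mulr_sumr; congr (_ * _).
  under eq_bigr => a _ do rewrite mulr_suml.
  rewrite exchange_big; apply: eq_bigr => m _ /=.
  rewrite -LX mulr_suml mulr_sumr; apply: eq_bigr => a _; ring.
under [LHS]eq_bigr => l _ do rewrite lin123.
transitivity (\sum_(b < (j + k).+1) \sum_(l < (i + j + k).+1)
    E l * (lin12c l i b * ps2pow (bicoef F) b j k)); last first.
  apply: eq_bigr => -[b bjk] _ /=; rewrite FE; last by lia.
  by rewrite mulr_suml; apply: eq_bigr => l _; rewrite mulrA.
rewrite [RHS]exchange_big; apply: eq_bigr => l _; rewrite -mulr_sumr; congr (_ * _).
under [RHS]eq_bigr => b _ do rewrite mulr_suml.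
rewrite [RHS]exchange_big; apply: eq_bigr => m _ /=.
rewrite -LX !mulr_sumr; apply: eq_bigr => b _; ring.
Qed.
End FormalGroup.

Lemma psco_recl (K R : comNzRingType) (iota : {rmorphism K -> R}) (A : ps K) (h : ps R) n :
  A 0%N = 0 -> psco iota A h n.+1 =
  iota (A 1%N) * h n.+1 + \sum_(k < n) iota (A k.+2) * (h ^+ k.+2) n.+1.
Proof.
by move=> A0; rewrite /psco big_ord_recl A0 rmorph0 mul0r add0r big_ord_recl expr1.
Qed.

(** * Integrality of the group law *)

Section Integrality.
Variables (p f : nat) (K : fieldType) (v : K -> int) (pi : K).
Hypotheses (hv : is_valuation v) (pi0 : pi != 0) (vpi : v pi = 1) (p_pr : prime p).
Hypothesis hr : residue_card v (p ^ f)%N.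
Notation O := (OK v).
Notation M := (dvS O pi).
Notation P := {poly K}.
Notation cop := (psco (polyC : {rmorphism K -> P})).
Let hS := OK_sub hv.
Let hI := MK_idl hv vpi.
Let Mp := residue_char hv pi0 vpi p_pr hr.
Let q := (p ^ f)%N.
Let f0 := residue_f_gt0 hv pi0 vpi p_pr hr.
Let q1 : (1 < q)%N. Proof. by rewrite /q -(exp1n f) ltn_exp2r // prime_gt1. Qed.
Let q0 : (0 < q)%N. Proof. exact: ltnW. Qed.

Definition OP (F : P) : Prop := forall i, O F`_i.
Notation MP := (dvS OP pi%:P).

Lemma OP_sub : is_sub OP.
Proof.
split; first by move=> i; rewrite coef1; apply: (sub_nat hS).
  by move=> x y Ox Oy i; rewrite coefB; apply: (subB hS).
by move=> x y Ox Oy i; rewrite coefM; apply: (sub_sum hS) => k _; apply: (subM hS).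
Qed.
Lemma OPC a : O a -> OP a%:P.
Proof. by move=> Oa i; rewrite coefC; case: eqP => // _; apply: (sub0 hS). Qed.
Let hP := OP_sub.
Let Opi : OP pi%:P. Proof. exact/OPC/(OKpi vpi). Qed.
Let hPI : is_idl OP MP. Proof. exact: (dvS_idl hP Opi). Qed.

Lemma MPE (F : P) : MP F <-> forall i, M F`_i.
Proof.
split=> [[G OG ->] i|MF]; first by rewrite coefCM; apply: dvS_self; apply: OG.
exists (pi^-1%:P * F); last by rewrite mulrA -rmorphM mulfV // mul1r.
by move=> i; rewrite coefCM; case: (MF i) => s Os ->; rewrite mulKf.
Qed.

Lemma poly_frobenius (F : P) : OP F -> cg MP (F ^+ q) (F \Po 'X^q).
Proof.
move=> OF; apply/MPE => i.
have ppX k : pp (F ^+ k) = pp F ^+ k.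
  elim: k => [|k IH]; last by rewrite !exprS ppM IH.
  by have := ppC (1 : K); rewrite !rmorph1 !expr0.
have Ec : pp (F \Po 'X^q) = psexp q (pp F).
  by apply: psP => k; rewrite /pp coef_comp_poly_Xn.
have hI' := pall_is_idl hI.
have : cg (pall M) (pp F ^+ q) (psexp q (pp F)).
  apply: (cg_trans hI' (frob_ps hS hI p_pr Mp f OF)).
  by apply: (psexp_cg hv vpi); apply: (fr_q hv pi0 vpi p_pr hr).
by move=> /(_ i); rewrite -ppX -Ec psBE coefB.
Qed.

Variables (L : ps K) (w : K).
Hypotheses (L0 : L 0%N = 0) (L1 : L 1%N = 1) (w0 : w != 0) (vw : v w = 1).
Hypothesis Lw : cg (pall M) (psexp q L) (psC w * L).
Hypothesis gL : good (polyC : {rmorphism K -> P}) L OP MP.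
Variable (F : ps P).
Hypotheses (F0 : F 0%N = 0) (LF : cop L F = lin12 L).

Lemma sg_cop (h : ps P) : ps_map (comp_poly 'X^q) (cop L h) = cop L (ps_map (comp_poly 'X^q) h).
Proof.
apply: psP => n; rewrite /psco {1}/ps_map rmorph_sum; apply: eq_bigr => k _.
by rewrite rmorphM /= comp_polyC -ps_mapX.
Qed.

(* [w L - L(x^q) = pi ka] with [ka 1] a unit. The coefficient [n] of [L(F^q)] only involves lower
   coefficients of [F], for which [F^q] is [F(X^q, Y^q)] modulo [pi]. *)
Lemma group_integral : pall OP F.
Proof.
have [ka Oka Eka] := pall_dvS (cg_sym (pall_is_idl hI) Lw).
have Ek1 : pi * ka 1%N = w.
  have := congr1 (fun h => h 1%N) Eka; rewrite psBE !psCM L1 mulr1 /psexp dvdn1 gtn_eqF // subr0.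
  by move->.
have ka0 : ka 0%N = 0.
  have := congr1 (fun h => h 0%N) Eka; rewrite psBE !psCM L0 mulr0 /psexp dvdn0 div0n L0 subr0.
  by move/esym/eqP; rewrite mulf_eq0 (negPf pi0) => /eqP.
have k1 : ka 1%N != 0 by apply: contraNneq w0 => E; rewrite -Ek1 E mulr0.
have vk : v (ka 1%N) = 0 by have := vw; rewrite -Ek1 (vM hv) // vpi; lia.
have [m Eq] : exists m, q = m.+2 by exists q.-2; lia.
elim/ltn_ind => n IH; case: n IH => [|n] IH; first by rewrite F0; apply: (sub0 hP).
set N := n.+1 in IH *.
(* F is not yet known to be integral from degree N on; its truncation is, so the Frobenius
   congruence and [gL] apply to it. *)
have [F' [OF' EF FN]] : exists F' : ps P, [/\ pall OP F', eqps N F' F & F' N = 0].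
  exists (low N F); split; [|exact: low_eqps|by rewrite /low ltnn].
  by move=> i; rewrite /low; case: ifP => [/IH //|_]; apply: (sub0 hP).
have F'0 : F' 0%N = 0 by rewrite EF.
pose F2 := psexp q (ps_map (comp_poly 'X^q) F').
have OF2 : pall OP F2.
  apply: psexp_pall; first exact: (sub0 hP).
  move=> k i; rewrite /ps_map coef_comp_poly_Xn //; case: ifP => _; [exact: OF'|exact: (sub0 hS)].
have F20 : F2 0%N = 0 by rewrite /F2 /psexp dvdn0 div0n /ps_map F'0 rmorph0.
have C2 : cg (pall MP) (F' ^+ q) F2.
  apply: (cg_trans (pall_is_idl hPI) (frob_ps hP hPI p_pr _ f OF')).
    apply/MPE => i; rewrite -(rmorph_nat (polyC : {rmorphism K -> P})) coefC.
    by case: eqP => // _; apply: (idl0 hI).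
  move=> k; rewrite psBE /F2 /psexp; case: ifP => _; last by rewrite subrr; apply: (idl0 hPI).
  by apply: poly_frobenius; apply: OF'.
have F'q0 : (F' ^+ q) 0%N = 0 by rewrite ordpsX0.
have Fq0 : (F ^+ q) 0%N = 0 by rewrite ordpsX0.
have CL := gL (pallX hP q OF') OF2 F'q0 F20 C2 N.
have E1 : cop L (F ^+ q) N = cop L (F' ^+ q) N.
  apply: (psco_eqps _ L (N := N.+1)) => // i; rewrite ltnS leq_eqVlt => /orP[/eqP->|iN].
    by rewrite Eq; apply: pow_low => //; apply: eqps_sym.
  by apply: (eqps_exp q (eqps_sym EF)).
(* In degree N = k q only the coefficient k < N of L(F') enters, where it agrees with that of L(F) =
   L(X) + L(Y). *)
have E2 : cop L F2 N = (psexp q L N)%:P * (1 + 'X^N).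
  have x0 : ps_map (comp_poly 'X^q) F' 0%N = 0 by rewrite /ps_map F'0 rmorph0.
  have -> : cop L F2 = psexp q (cop L (ps_map (comp_poly 'X^q) F')) by apply/esym/psexp_pscoE.
  rewrite -sg_cop.
  rewrite 2!{1}/psexp; case: ifP => [/dvdnP[k Ek]|_]; last by rewrite mul0r.
  have kN : (k < N)%N by have Ek' : n.+1 = (k * q)%N := Ek; move: (q) q1 Ek' => Q; rewrite /N; nia.
  rewrite Ek (mulnK _ q0) /ps_map (psco_eqps _ L EF kN) LF /lin12 psDE /lin1 /lin2.
  rewrite rmorphD rmorphM /= comp_polyC comp_Xn_poly.
  rewrite -exprM [(q * k)%N]mulnC.
  by rewrite mulrDr mulr1.
have E3 : w%:P * lin12 L N - cop L (F ^+ q) N = cop (psC pi * ka) F N.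
  rewrite -Eka pscoB (pscoZ _ w L F0) LF psBE psCM.
  by rewrite (psco_psexp _ L q0 F0).
have E4 : cop (psC pi * ka) F N = w%:P * F N + cop (psC pi * ka) F' N.
  have pk0 : (psC pi * ka) 0%N = 0 by rewrite psCM ka0 mulr0.
  have pk1 : (psC pi * ka) 1%N = w by rewrite psCM.
  rewrite /N !(psco_recl _ _ _ pk0) pk1.
  rewrite FN (mulr0 w%:P) (add0r (\sum_(i < n) _)).
  have ES k : (F ^+ k.+2) n.+1 = (F' ^+ k.+2) n.+1.
    exact: (pow_low k F0 F'0 (eqps_sym EF)).
  apply: (congr1 (fun x => w%:P * F n.+1 + x)); apply: eq_bigr => k _.
  exact: (congr1 (fun x => ((psC pi * ka) k.+2)%:P * x) (ES k)).
(* The coefficient N of F enters pi ka(F) only through the linear term w F_N; the rest of the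
   identity is divisible by pi, and v(w) = v(pi). *)
have [s Os Es] : MP (w%:P * F N).
  have -> : w%:P * F N = w%:P * lin12 L N - cop L (F ^+ q) N - cop (psC pi * ka) F' N.
    by rewrite E3 E4 addrK.
  apply: (idlB hPI); last first.
    rewrite (pscoZ _ pi ka F'0) psCM; apply: dvS_self.
    exact: (pall_comp hP OPC Oka OF' N).
  have -> : w%:P * lin12 L N - cop L (F ^+ q) N =
      (w%:P * lin12 L N - cop L F2 N) - (cop L (F' ^+ q) - cop L F2) N.
    by rewrite E1 psBE; ring.
  apply: (idlB hPI); last exact: CL.
  have -> : w%:P * lin12 L N - cop L F2 N = pi%:P * ((ka N)%:P * (1 + 'X^N)).
    rewrite E2 /lin12 psDE /lin1 /lin2.
    have := congr1 (fun h => h N) Eka; rewrite psBE !psCM => Ek.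
    have -> : (psexp q L N) = w * L N - pi * ka N by rewrite -Ek subKr.
    by rewrite rmorphB !rmorphM /=; ring.
  apply: dvS_self; apply: (subM hP); first exact: OPC.
  move=> i; rewrite coefD coef1 coefXn; apply: (subD hS); exact: (sub_nat hS).
move=> i; have := congr1 (fun G : P => G`_i) Es; rewrite !coefCM -Ek1 -mulrA => /(mulfI pi0) E.
rewrite -[_`_i](mulKf k1) E; apply: (subM hS); [exact: (OKV hv)|exact: Os].
Qed.
End Integrality.

(** * The Lubin-Tate group attached to a logarithm *)

Section LubinTate.
Variables (p f : nat) (K : fieldType) (v : K -> int) (pi : K).
Hypotheses (hv : is_valuation v) (pi0 : pi != 0) (vpi : v pi = 1) (p_pr : prime p).
Hypothesis hr : residue_card v (p ^ f)%N.
Notation O := (OK v).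
Notation M := (dvS O pi).
Notation co := (psco idfun).
Notation P := {poly K}.
Let hS := OK_sub hv.
Let hI := MK_idl hv vpi.
Let hI' := pall_is_idl hI.

Lemma lubin_tate_of_log (L : ps K) (w : K) : L 0%N = 0 -> L 1%N = 1 -> w != 0 -> v w = 1 ->
  cg (pall M) (psexp (p ^ f) L) (psC w * L) ->
  good (polyC : {rmorphism K -> P}) L (OP v) (dvS (OP v) pi%:P) -> good idfun L O M ->
  exists F, lubin_tate v (p ^ f) F /\
    forall (y : ps K) c, pall O y -> y 0%N = 0 -> co L y = psC c * L -> is_fgl_endo v F y.
Proof.
move=> L0 L1 w0 vw Cw gP gL.
have q0 : (0 < p ^ f)%N by rewrite expn_gt0 prime_gt0.
have Z0 : lin12 L 0%N = 0 by apply: lin12_0.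
have [F F0 LF] := pscoL_solve (polyC : {rmorphism K -> P}) L0 L1 Z0.
have OF := group_integral hv pi0 vpi p_pr hr L0 L1 w0 vw Cw gP F0 LF.
have x0 : (px : ps K) 0%N = 0 by [].
have [E E0 LE] := pscoL_solve (idfun : {rmorphism K -> K}) L0 L1 x0.
have hF : homog F.
  rewrite (F_eigen L0 L1 F0 LF E0 LE); apply: homog_cop.
  by rewrite !rmorph1 mul1r; apply: lin12_homog.
have endo (y : ps K) c : pall O y -> y 0%N = 0 -> co L y = psC c * L -> is_fgl_endo v (bicoef F) y.
  move=> Oy y0 Ly; split; first by split.
  move=> i j; rewrite (bicoef_endo L0 L1 F0 LF i j hF y0 Ly).
  by apply: eq_bigr => a _; apply: eq_bigr => b _; rewrite !pspowE.
exists (bicoef F); split=> //.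
have F1 : F 1%N = 1 + 'X.
  have E1 := pscoL_n (polyC : {rmorphism K -> P}) L0 L1 1 F0.
  rewrite big_ord1 ordpsX0 // mulr0 addr0 LF /lin12 psDE /lin1 /lin2 L1 in E1.
  by rewrite -E1 rmorph1 mul1r.
split.
  split.
  - by move=> i j; apply: OF.
  - rewrite /bicoef F0 !F1 !coefD !coef1 !coefX coef0 /= addr0 add0r; by [].
  - exact: (bicoef_sym L0 L1 F0 LF).
  - exact: (bicoef_assoc L0 L1 F0 LF hF).
exists w; split=> //.
have wL0 : (psC w * L) 0%N = 0 by rewrite psCM L0 mulr0.
have [h h0 Lh] := pscoL_solve (idfun : {rmorphism K -> K}) L0 L1 wL0.
have xq0 : (px ^+ (p ^ f) : ps K) 0%N = 0 by rewrite pxX eq_sym gtn_eqF.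
have Oxq : pall O (px ^+ (p ^ f)) by apply: (pallX hS); apply: (pall_px hS).
(* Only x^q is known to be integral here; the integrality of h is deduced from the congruence. *)
have Ch i : cg M (h i) (i == (p ^ f)%N)%:R.
  rewrite -pxX; apply: (pscoL_inj_cg L0 L1 hS hI gL Oxq h0 xq0 _ (ltnSn i)) => k _.
  rewrite Lh -psexp_psco //; exact: (cg_sym hI' Cw k).
have Oh : pall O h by move=> i; apply: (cg_sub hS hI (Ch i)); apply: (sub_nat hS).
exists h; split; first exact: (endo h w Oh h0 Lh).
  by have := congr1 (fun x => x 1%N) Lh; rewrite (psco1E _ _ h0) psCM L1 mulr1 mul1r.
by move=> i; apply/(MKE hv pi0 vpi)/Ch.
Qed.
End LubinTate.

Theorem theorem3p2 (p e f : nat) (K : fieldType) (v : K -> int) (g : nat -> K) :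
  padic_field p e f v ->
  inD0 v g -> stable g -> ~~ inU v (g 1%N) ->
  height_is p e v g (e * f) ->
  stab_deriv_full v g ->
  (v (g 1%N) = 1 \/ (e = 1%N /\ iterates_simple_roots v g)) ->
  exists F : nat -> nat -> K, lubin_tate v (p ^ f)%N F /\ is_fgl_endo v F g.
Proof.
move=> [p_pr hv _ char0 [ve hc hr]] [g0 Og] [g1 g1n] nU [d [k [[Ud low] Ed ek]]] stab cases.
have hS := OK_sub hv.
have /choice[u Hu] : forall a, exists ua : ps K, a != 0 -> v a = 0 ->
    [/\ pall (OK v) ua, ua 0%N = 0, ua 1%N = a & psco idfun ua g = psco idfun g ua].
  move=> a; have [Ua|nUa] := boolP (inU v a); last first.
    by exists px => a0 va; case/negP: nUa; rewrite /inU a0 va.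
  have [_ /(_ Ua) [ua [[u0 Ou] _ ug u1]]] := stab a.
  by exists ua => _ _; split=> //; rewrite -!pscompE.
have [L [L0 L1 Lg]] := log_exists g0 g1 g1n.
have hu5 a : a != 0 -> v a = 0 -> [/\ pall (OK v) (u a), u a 0%N = 0, u a 1%N = a,
    psco idfun (u a) g = psco idfun g (u a) & psco idfun L (u a) = psC a * L].
  move=> a0 va; have [Ou u0 u1 ug] := Hu a a0 va; split=> //.
  by rewrite (log_comm g0 g1 g1n L0 L1 Lg u0 ug) u1.
have hu a : a != 0 -> v a = 0 -> [/\ pall (OK v) (u a), u a 0%N = 0, u a 1%N = a &
    psco idfun L (u a) = psC a * L].
  by move=> a0 va; have [? ? ? _ ?] := hu5 a a0 va.
have inMg : inM v (g 1%N).
  move: (Og 1%N) nU; rewrite /inO /inM /inU (negPf g1) /= => ge ne; lia.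
have Mg pi : pi != 0 -> v pi = 1 -> dvS (OK v) pi (g 1%N).
  by move=> pi0 vpi; apply/(MKE hv pi0 vpi).
have wg pi : pi != 0 -> v pi = 1 -> wd v pi g d.
  move=> pi0 vpi; split=> [i id|].
    apply/(MKE hv pi0 vpi); move: (Og i) (low i id); rewrite /inO /inM /inU.
    by case: eqVneq => //= gi ge ne; lia.
  by move: Ud; rewrite /inU => /andP[gd /eqP vd]; apply: unit_notMK.
(* A unit that is not a root of unity, by characteristic 0: it yields the stabilizer element of
   infinite order used to study the roots of g'. *)
pose c : K := p.+1%:R.
have cn n : (0 < n)%N -> c ^+ n != 1.
  move=> n0; apply/eqP => E; have : (p.+1 ^ n).-1%:R = 0 :> K.
    by rewrite -subn1 natrB ?expn_gt0 // natrX -/c E subrr.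
  have p1 : (1 < p.+1)%N by rewrite ltnS prime_gt0.
  by move/char0; have := ltn_expl n p1; lia.
have cU pi : pi != 0 -> v pi = 1 -> c != 0 /\ v c = 0.
  move=> pi0 vpi; apply: (OK_unit hv pi0 vpi); first exact: (sub_nat hS).
  by apply: (unit_mod_p hv pi0 vpi p_pr hr); rewrite coprimenS.
have finish pi : pi != 0 -> v pi = 1 -> pall (dvS (OK v) (g 1%N)) (psd g) ->
  [/\ pall (OK v) (psd L) & forall N, exists a, [/\ a != 0, v a = 0, dvS (OK v) pi (a - 1) &
    exists2 d', wd v pi (u a - px) d' & (N <= d')%N]].
  move=> pi0 vpi dg; have Mg1 := Mg pi pi0 vpi; split.
    exact: (log_deriv_integral hv pi0 vpi Og g0 g1 L1 Lg Mg1 dg).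
  exact: (deep_element hv pi0 vpi p_pr hr char0 Og g0 Mg1 (wd_prim Og (wg pi pi0 vpi)) dg L0 L1 hu5).
have polyK (pi : K) : pi != 0 -> forall x : {poly K}, pi%:P * x = 0 -> x = 0.
  by move=> pi0 x /eqP; rewrite mulf_eq0 polyC_eq0 (negPf pi0) => /eqP.
case: cases => [vg|[e1 simple]].
  have [c0 vc] := cU _ g1 vg; have [Ou u0 u1 ug _] := hu5 c c0 vc.
  have dg : pall (dvS (OK v) (g 1%N)) (psd g).
    apply: (uniformizer_deriv hv g1 vg hc char0 Og g0 _ Ou u0 _ _ ug) => //; last by rewrite u1.
    by rewrite u1; apply: (unit_notMK hv g1 vg).
  have [OdL deep] := finish _ g1 vg dg.
  have e0 : (0 < e)%N.
    by have := residue_char hv g1 vg p_pr hr; rewrite (MKE hv g1 vg) /inM ve; case/orP=> // /eqP/char0 E; move: p_pr; rewrite E.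
  (* With v(g'(0)) = 1 the height condition reads e k = e f. *)
  have dq : d = (p ^ f)%N.
    by rewrite Ed; congr (_ ^ _)%N; move: ek; rewrite vg; nia.
  have wq : wd v (g 1%N) g (p ^ f) by rewrite -dq; apply: wg.
  have ug' a : a != 0 -> v a = 0 -> psco idfun (u a) g = psco idfun g (u a).
    by move=> a0 va; have [] := hu5 a a0 va.
  have [w [Cw w0 vw]] := uniformizer_log_frobenius hv g1 vg hc p_pr hr Og g0 (erefl _) dg L0 L1 Lg hu ug' deep OdL wq.
  have gP := good_uniformizer hv g1 vg (OP_sub hv) (@OPC _ v hv) Og g0 (erefl _) dg L1 Lg (polyK _ g1).
  have gK := uniformizer_good hv g1 vg Og g0 (erefl _) dg L1 Lg.
  have [F [FLT endo]] := lubin_tate_of_log hv g1 vg p_pr hr L0 L1 w0 vw Cw gP gK.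
  by exists F; split=> //; apply: (endo _ _ Og g0 Lg).
have vp : v p%:R = 1 by rewrite ve e1.
have p0 : p%:R != 0 :> K by apply/eqP => /char0 E; move: p_pr; rewrite E.
have [c0 vc] := cU _ p0 vp; have [Ou u0 u1 ug _] := hu5 c c0 vc.
have dg : pall (dvS (OK v) (g 1%N)) (psd g).
  apply: (simple_roots_deriv hv p0 vp hc Og g0 g1 (Mg _ p0 vp) Ou u0 _ _ ug) => //; last by rewrite u1.
  by rewrite u1; apply: (unit_notMK hv p0 vp).
have [OdL deep] := finish _ p0 vp dg.
have [n n0 vn] : exists2 n : nat, (0 < n)%N & v (g 1%N) = n%:Z.
  by exists `|v (g 1%N)|%N; move: inMg; rewrite /inM (negPf g1) /=; lia.
(* With e = 1 and v(g'(0)) = n the height condition reads k = f n. *)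
have dq : d = ((p ^ f) ^ n)%N.
  by rewrite Ed -expnM; congr (_ ^ _)%N; move: ek; rewrite vn e1; nia.
have wq : wd v p%:R g ((p ^ f) ^ n) by rewrite -dq; apply: wg.
have [w [Cw w0 vw]] := unramified_log_frobenius hv vp hc p_pr hr char0 hu deep L0 L1 OdL n0 g0 g1 vn Lg wq.
have gP := good_deriv hv vp p_pr hr char0 (OP_sub hv) (@OPC _ v hv) OdL.
have gK := good_deriv hv vp p_pr hr char0 (iota := idfun) hS (fun _ => id) OdL.
have [F [FLT endo]] := lubin_tate_of_log hv p0 vp p_pr hr L0 L1 w0 vw Cw gP gK.
by exists F; split=> //; apply: (endo _ _ Og g0 Lg).
Qed.
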